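(* A fat CW complex $X$ has enough many smooth functions: the $D$-topology of $X$ has an open basis consisting of sets of the form $f^{-1}((0,1))$ with $f:X\to\mathbb{R}$ smooth.
   Context: The $D$-topology of a diffeological space $X$: $O\subset X$ is open iff $P^{-1}(O)$ is open for every plot $P$. Let $\ell(t)=0$ for $t\le0$, $e^{-1/t}$ for $t>0$; $\alpha_0=\int_0^1\ell(3x)\ell(3-3x)dx$; $\lambda(t)=\frac1{\alpha_0}\int_0^t\ell(3x)\ell(3-3x)dx$; $\phi(t)=\int_0^{1/2+t}\lambda(x)dx$. For integers $n,m\ge0$: $\mathbb{D}^{n,m}=\{(u,v)\in\mathbb{R}^n\times\mathbb{R}^m:\|u\|\ge1-\phi(2-\|u\|-\|v\|)\}$, $\mathbb{S}^{n-1,m}=\{(u,v):\|u\|\ge1\}$ (empty for $n=0$), with subset diffeologies. A fat CW complex is a diffeological space $X$ with subspaces $\emptyset=X^{(-1)}\subset X^{(0)}\subset\cdots$, index sets $J_n$, maps $m_n:J_n\to\mathbb{N}_0$ and smooth maps $h_n:\coprod_{j\in J_n}\mathbb{S}^{n-1,m_n(j)}\to X^{(n-1)}$ such that each $X^{(n)}$ is the pushout in diffeological spaces of the inclusion $\coprod_j\mathbb{S}^{n-1,m_n(j)}\hookrightarrow\coprod_j\mathbb{D}^{n,m_n(j)}$ and $h_n$, and $X$ is the diffeological colimit of the $X^{(n)}$. *)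

(* Defs.v *)
From HB Require Import structures.
From mathcomp Require Import all_boot all_order all_algebra.
From mathcomp Require Import all_classical all_reals all_analysis.
From mathcomp Require Import Rstruct Rstruct_topology.
Set Implicit Arguments. Unset Strict Implicit. Unset Printing Implicit Defensive.
Import Order.TTheory GRing.Theory Num.Theory.
Import numFieldNormedType.Exports.
Local Open Scope classical_set_scope.
Local Open Scope ring_scope.

Notation R := Rdefinitions.R.

Fixpoint iterD (m : nat) (W : normedModType R) (vs : seq 'rV[R]_m)
    (F : 'rV[R]_m -> W) : 'rV[R]_m -> W :=
  match vs with
  | [::] => F
  | v :: vs' => fun x => derive (iterD vs' F) x v
  end.

Definition smooth_on (m : nat) (W : normedModType R) (V : set 'rV[R]_m)
    (F : 'rV[R]_m -> W) : Prop :=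
  forall vs : seq 'rV[R]_m,
    (forall x, V x -> {for x, continuous (iterD vs F)}) /\
    (forall v x, V x -> derivable (iterD vs F) x v).

(* points of a subset, as a type (membership is boolean, so proofs are irrelevant) *)
Definition dom (T : Type) (U : set T) := {x : T | x \in U}.

Definition smoothp (m : nat) (W : normedModType R) (V : set 'rV[R]_m)
    (g : dom V -> W) : Prop :=
  exists F : 'rV[R]_m -> W, smooth_on V F /\ forall y : dom V, F (val y) = g y.

Definition plots (X : Type) :=
  forall (n : nat) (U : set 'rV[R]_n), (dom U -> X) -> Prop.

Lemma in_setI_r (T : Type) (V U : set T) (x : T) :
  x \in V `&` U -> x \in U.
Proof. by rewrite in_setI => /andP[]. Qed.

Definition restr (T : Type) (V U : set T) (x : dom (V `&` U)) : dom U :=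
  exist _ (val x) (in_setI_r (valP x)).

Definition is_diffeology (X : Type) (p : plots X) : Prop :=
  (forall n U P, @p n U P -> open U) /\
  (forall n (U : set 'rV[R]_n) (x : X), open U -> p n U (fun _ => x)) /\
  (forall n (U : set 'rV[R]_n) (P : dom U -> X), open U ->
     (forall r : dom U, exists V : set 'rV[R]_n,
         [/\ open V, V (val r) & p n (V `&` U) (P \o @restr _ V U)]) ->
     p n U P) /\
  (forall n (U : set 'rV[R]_n) (P : dom U -> X), p n U P ->
     forall m (V : set 'rV[R]_m) (G : dom V -> dom U),
       open V -> smoothp (fun y => val (G y)) -> p m V (P \o G)).

Definition dsmooth (X Y : Type) (pX : plots X) (pY : plots Y) (f : X -> Y) :=
  forall n (U : set 'rV[R]_n) (P : dom U -> X), pX n U P -> pY n U (f \o P).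

Definition Dopen (X : Type) (pX : plots X) (O : set X) : Prop :=
  forall n (U : set 'rV[R]_n) (P : dom U -> X), pX n U P ->
    open [set x : 'rV[R]_n | exists hx : x \in U, O (P (exist _ x hx))].

Definition euc_plots (W : normedModType R) : plots W :=
  fun n U P => open U /\ smoothp P.

Definition sub_plots (X : Type) (pX : plots X) (A : set X) : plots (dom A) :=
  fun n U P => pX n U (val \o P).
Arguments sub_plots {X} pX A.

Definition coprod_plots (I : Type) (T : I -> Type) (p : forall i, plots (T i))
  : plots {i : I & T i} :=
  fun n U P => open U /\
    forall r : dom U, exists V : set 'rV[R]_n, open V /\ V (val r) /\
      exists (i : I) (Q : dom (V `&` U) -> T i),
        p i n (V `&` U) Q /\
        forall s : dom (V `&` U), P (restr s) = existT _ i (Q s).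

Definition is_pushout (A B C P : Type) (pA : plots A) (pB : plots B)
    (pC : plots C) (pP : plots P)
    (f : C -> A) (g : C -> B) (a : A -> P) (b : B -> P) : Prop :=
  dsmooth pA pP a /\ dsmooth pB pP b /\ (forall c, a (f c) = b (g c)) /\
  forall (Y : Type) (pY : plots Y), is_diffeology pY ->
    forall (u : A -> Y) (v : B -> Y), dsmooth pA pY u -> dsmooth pB pY v ->
      (forall c, u (f c) = v (g c)) ->
      exists! w : P -> Y, dsmooth pP pY w /\
        (forall x, w (a x) = u x) /\ (forall y, w (b y) = v y).

Definition ell (t : R) : R := if t <= 0 then 0 else expR (- t^-1).

Definition oint (a b : R) (f : R -> R) : R :=
  if a <= b then \int[lebesgue_measure]_(x in `[a, b]) f x
  else - \int[lebesgue_measure]_(x in `[b, a]) f x.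

Definition bump (x : R) : R := ell (3 * x) * ell (3 - 3 * x).

Definition alpha0 : R := oint 0 1 bump.

Definition lam (t : R) : R := alpha0^-1 * oint 0 t bump.

Definition phi (t : R) : R := oint 0 (2^-1 + t) lam.

Definition enorm (k : nat) (u : 'rV[R]_k) : R :=
  Num.sqrt (\sum_(i < k) u ord0 i ^+ 2).

(* R^n x R^m is identified with R^(n+m) = 'rV_(n+m); (u,v) = (lsubmx, rsubmx) *)
Definition Dset (n m : nat) : set 'rV[R]_(n + m) :=
  [set p | 1 - phi (2 - enorm (lsubmx p) - enorm (rsubmx p)) <= enorm (lsubmx p)].

Arguments Dset : clear implicits.

(* S^{n-1,m} = {(u,v) : |u| >= 1}, taken as a subset of D^{n,m} *)
Definition Sset (n m : nat) : set 'rV[R]_(n + m) :=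
  Dset n m `&` [set p | 1 <= enorm (lsubmx p)].

Arguments Sset : clear implicits.

Definition fatD (n m : nat) := dom (Dset n m).
Definition fatS (n m : nat) := dom (Sset n m).

Definition fatD_plots (n m : nat) : plots (fatD n m) :=
  sub_plots (@euc_plots 'rV[R]_(n + m)) (Dset n m).
Definition fatS_plots (n m : nat) : plots (fatS n m) :=
  sub_plots (@euc_plots 'rV[R]_(n + m)) (Sset n m).

Arguments fatD_plots : clear implicits.
Arguments fatS_plots : clear implicits.

Lemma in_setI_l (T : Type) (V U : set T) (x : T) :
  x \in V `&` U -> x \in V.
Proof. by rewrite in_setI => /andP[]. Qed.

Definition S_to_D (n m : nat) (x : fatS n m) : fatD n m :=
  exist _ (val x) (in_setI_l (valP x)).

Definition prevsk (X : Type) (sk : nat -> set X) (n : nat) : set X :=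
  match n with 0 => set0 | k.+1 => sk k end.

Definition incl (X : Type) (A B : set X) (h : A `<=` B) (x : dom A) : dom B :=
  exist _ (val x) (mem_set (h _ (set_mem (valP x)))).

Definition is_fat_CW (X : Type) (pX : plots X) : Prop :=
  exists (sk : nat -> set X) (hsk : forall n, prevsk sk n `<=` sk n)
         (J : nat -> Type) (mJ : forall n, J n -> nat)
         (h : forall n, {j : J n & fatS n (mJ n j)} -> dom (prevsk sk n)),
    (forall n, dsmooth
        (coprod_plots (fun j : J n => fatS_plots n (mJ n j)))
        (sub_plots pX (prevsk sk n)) (h n)) /\
    (forall n, exists Phi : {j : J n & fatD n (mJ n j)} -> dom (sk n),
        is_pushout (sub_plots pX (prevsk sk n))
          (coprod_plots (fun j : J n => fatD_plots n (mJ n j)))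
          (coprod_plots (fun j : J n => fatS_plots n (mJ n j)))
          (sub_plots pX (sk n))
          (h n)
          (fun s => existT _ (projT1 s) (S_to_D (projT2 s)))
          (incl (hsk n)) Phi) /\
    (forall (Y : Type) (pY : plots Y), is_diffeology pY ->
      forall u : forall n, dom (sk n) -> Y,
        (forall n, dsmooth (sub_plots pX (sk n)) pY (u n)) ->
        (forall n (x : dom (sk n)), u n.+1 (incl (hsk n.+1) x) = u n x) ->
        exists! w : X -> Y, dsmooth pX pY w /\
          forall n (x : dom (sk n)), w (val x) = u n x).

Definition enough_smooth_functions (X : Type) (pX : plots X) : Prop :=
  (forall f : X -> R, dsmooth pX (@euc_plots R^o) f ->
     Dopen pX [set x | 0 < f x < 1]) /\
  (forall O : set X, Dopen pX O -> forall x, O x ->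
     exists f : X -> R, dsmooth pX (@euc_plots R^o) f /\
       0 < f x < 1 /\ [set y | 0 < f y < 1] `<=` O).

(* Main.v *)
Require Import Defs.
From HB Require Import structures.
From mathcomp Require Import all_boot all_order all_algebra.
From mathcomp Require Import all_classical all_reals all_analysis.
From mathcomp Require Import Rstruct Rstruct_topology.
From mathcomp Require Import ring lra.
Set Implicit Arguments. Unset Strict Implicit. Unset Printing Implicit Defensive.
Import Order.TTheory GRing.Theory Num.Theory.
Import numFieldNormedType.Exports.
Local Open Scope classical_set_scope.
Local Open Scope ring_scope.

(* Given O open and x in O, a smooth f with f x = 1/2 and f < 0 off O is built skeleton by
   skeleton, starting from -1 just before the skeleton where x appears. Across an n-cell one
   has to extend a function given on |u| >= 1 so that it is negative off the trace of O.
   After the substitution |u| = 1 + t^2, a function smooth for the subset diffeology of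
   {|u| >= 1} becomes an ordinary smooth function even in t; Seeley's reflection continues
   it to a smooth function of t^2 of either sign, which gives a smooth extension to R^(n+m).
   Plots of D^{n,m} in which the defining function is t^2 show similarly that the trace of O
   is relatively open. Since D^{n,m} is bounded where |u| < 1, compactness then allows one to
   restore negativity by subtracting a large multiple of exp(-1/(1-|u|^2)). *)

(** Asking only for [f < 0] off [O], rather than for support in [O], is what lets cells be treated
    one at a time: no bound from above has to survive an extension, and [0 < f] alone already forces
    a point into [O]. The obstacle is that a function on [|u| >= 1] is known only through plots that
    stay in this closed set, so nothing is given across [|u| = 1]. The map [t |-> 1 + t^2] touches
    the boundary without crossing it, hence produces genuine plots. Seeley's formula has the
    advantage that its derivatives are formulas of the same shape. This suits a definition of
    smoothness by iterated directional derivatives, for which a proof consists in naming a class of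
    functions stable under partial derivatives. Of [phi] the geometry uses that it is smooth,
    nonnegative, nondecreasing, zero up to [-1/2] and the identity from [1/2] on; [lam] serves also
    as a cutoff. Points where [u] or [v] vanishes need separate care, since the Euclidean norms are
    not smooth there. *)

Definition stdv (K : realType) m (i : 'I_m) : 'rV[K]_m := delta_mx ord0 i.

(** Both difference quotients are the same function of [h], so directional derivatives inherit the
    one-variable mean value theorem and chain rule. *)
Lemma is_derive_lineP (K : realType) (V W : normedModType K) (F : V -> W) (p v : V) (t : K) (l : W) :
  is_derive (p + t *: v) v F l <-> is_derive t 1 (fun s : K => F (p + s *: v)) l.
Proof.
have E : (fun h : K => h^-1 *: ((F \o shift (p + t *: v)) (h *: v) - F (p + t *: v)))
   = (fun h : K => h^-1 *: (((fun s : K => F (p + s *: v)) \o shift t) (h *: 1)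
        - (fun s : K => F (p + s *: v)) t)).
  by apply/funext => h /=; rewrite [h%:A]mulr1 scalerDl addrCA.
by split => -[d <-]; apply: DeriveDef; rewrite /derivable /derive ?E// -E.
Qed.

(** Stated without ordering [a] and [b], since coordinate increments come with either sign; the
    bound on [c] keeps it as close to [a] as [b] is. *)
Lemma MVT_le (K : realType) (f df : K -> K) (a b : K) :
  (forall t, `|t - a| <= `|b - a| -> is_derive t 1 f (df t)) ->
  exists2 c, `|c - a| <= `|b - a| & f b - f a = (b - a) * df c.
Proof.
move=> H.
have C u v : (forall t, t \in `[u, v] -> `|t - a| <= `|b - a|) ->
    {within `[u, v], continuous f}.
  move=> uv; apply: derivable_within_continuous => t /uv /H [].
  by [].
have [ab|ba] := leP a b.
  have sub t : t \in `[a, b] -> `|t - a| <= `|b - a|.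
    by rewrite in_itv/= => /andP[? ?]; rewrite !ger0_norm ?subr_ge0// lerD2r.
  have d t : t \in `]a, b[ -> is_derive t 1 f (df t).
    by move=> /subset_itv_oo_cc tab; apply/H/sub.
  have [c cab ->] := MVT_segment ab d (C _ _ sub).
  by exists c; [exact: sub|rewrite mulrC].
have sub t : t \in `[b, a] -> `|t - a| <= `|b - a|.
  rewrite in_itv/= => /andP[? ?].
  by rewrite ler0_norm ?subr_le0// ltr0_norm ?subr_lt0// lerN2 lerD2r.
have d t : t \in `]b, a[ -> is_derive t 1 f (df t).
  by move=> /subset_itv_oo_cc tab; apply/H/sub.
have [c cab E] := MVT_segment (ltW ba) d (C _ _ sub).
exists c; first exact: sub.
by apply/eqP; rewrite -eqr_opp opprB E -mulNr opprB mulrC.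
Qed.

Lemma ball_closer (K : realType) (V : normedModType K) (x y z : V) (r : K) :
  `|z - x| <= `|y - x| -> ball x r y -> ball x r z.
Proof.
rewrite -!ball_normE /ball_/= => zy; rewrite distrC.
by apply: le_lt_trans; rewrite (distrC x).
Qed.

Lemma coord_ler_norm (K : realType) m (z : 'rV[K]_m) i : `|z ord0 i| <= `|z|.
Proof.
rewrite [leRHS]/Num.Def.normr/= mx_normrE.
by apply: le_trans; last exact: (le_bigmax _ _ (ord0, i)).
Qed.

Lemma continuous_distP (K : realType) (V W : normedModType K) (F : V -> W) (x : V) :
  {for x, continuous F} <-> forall e, 0 < e -> \forall y \near x, `|F x - F y| <= e.
Proof. by split => [/cvgrPdist_le|H]; last apply/cvgrPdist_le. Qed.

(** * Continuity and differentiability from partial derivatives *)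

Section C1.
Context (K : realType) (m : nat) (V : set 'rV[K]_m) (F : 'rV[K]_m -> K) (dF : 'I_m -> 'rV[K]_m -> K).
Hypothesis dFE : forall i x, V x -> is_derive x (stdv K i) F (dF i x).

(** Walk from [x] to [y] one coordinate at a time ([p k] takes its first [k] coordinates from [y]),
    apply the mean value theorem on each leg and telescope. In the sup norm no point of the path is
    farther from [x] than [y]. *)
Lemma increment_partials (x : 'rV[K]_m) (r : K) : ball x r `<=` V ->
  forall y, ball x r y -> exists c : 'I_m -> 'rV[K]_m,
    (forall i, `|c i - x| <= `|y - x|) /\
    F y - F x = \sum_(i < m) (y ord0 i - x ord0 i) * dF i (c i).
Proof.
move=> sV y xy.
have sub (z : 'rV_m) : `|z - x| <= `|y - x| -> V z.
  by move=> zx; apply/sV; exact: ball_closer xy.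
pose p (k : nat) : 'rV[K]_m := \row_j (if (j < k)%N then y ord0 j else x ord0 j).
have pS (i : 'I_m) : p i.+1 = p i + (y ord0 i - x ord0 i) *: stdv K i.
  apply/rowP => j; rewrite !mxE eqxx/= ltnS leq_eqVlt.
  have [->|ij] := eqVneq j i; first by rewrite eqxx ltnn/= mulr1 addrCA subrr addr0.
  by rewrite (negbTE (_ : (j != i :> nat)))//= mulr0 addr0.
have pin (i : 'I_m) (t : K) : `|t - 0| <= `|(y ord0 i - x ord0 i) - 0| ->
    `|p i + t *: stdv K i - x| <= `|y - x|.
  rewrite !subr0 => ti.
  rewrite [leLHS]/Num.Def.normr/= mx_normrE (bigmax_le _ (normr_ge0 _))// => -[k j] _ /=.
  rewrite !mxE (ord1 k) eqxx/=.
  have le j' : `|y ord0 j' - x ord0 j'| <= `|y - x|.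
    by have := coord_ler_norm (y - x) j'; rewrite !mxE.
  case: (eqVneq j i) => [->|ij].
    by rewrite ltnn mulr1 addrC addKr (le_trans ti).
  by case: ifPn => _; rewrite mulr0 addr0 ?subrr ?normr0.
have st (i : 'I_m) : exists2 c, `|c - x| <= `|y - x| &
    F (p i.+1) - F (p i) = (y ord0 i - x ord0 i) * dF i c.
  have [t /pin Hp|t tb] := @MVT_le K (fun t : K => F (p i + t *: stdv K i))
     (fun t => dF i (p i + t *: stdv K i)) 0 (y ord0 i - x ord0 i).
    exact: (is_derive_lineP F (p i) (stdv K i) t _).1 (dFE i (sub _ Hp)).
  rewrite scale0r addr0 -pS subr0 => E.
  by exists (p i + t *: stdv K i); [exact: pin|].
have /choice[c Hc] : forall i : 'I_m, exists c, `|c - x| <= `|y - x| /\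
    F (p i.+1) - F (p i) = (y ord0 i - x ord0 i) * dF i c.
  by move=> i; have [c] := st i; exists c.
exists c; split => [i|]; first exact: (Hc i).1.
have pm : p m = y by apply/rowP => j; rewrite mxE ltn_ord.
have p0 : p 0%N = x by apply/rowP => j; rewrite mxE.
rewrite -{1}pm -{1}p0 -(telescope_sumr (F \o p))// big_mkord.
by apply: eq_bigr => i _; exact: (Hc i).2.
Qed.

(** The increment formula gives a local Lipschitz estimate, with the sum [S] of the bounds on the
    partials as constant. *)
Lemma locally_bounded_partials_continuous (x : 'rV[K]_m) : open V -> V x ->
  (forall i, exists M, \forall y \near x, `|dF i y| <= M) ->
  {for x, continuous F}.
Proof.
move=> oV Vx /choice[M HM].
have HM' : \forall y \near x, forall i, `|dF i y| <= M i.
  by near=> y => i; move: i; near: y; apply: filter_forall => i; exact: HM.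
have oVx : nbhs x V by exact: open_nbhs_nbhs.
have /nbhs_ballP[r /= r0 rH] : \forall y \near x, V y /\ forall i, `|dF i y| <= M i.
  exact: filterI.
pose S := \sum_i `|M i|.
apply/continuous_distP => e e0.
near=> y.
have xy : ball x r y by near: y; exact: nbhsx_ballx.
have [c [cx E]] := increment_partials (fun z h => (rH z h).1) xy.
rewrite distrC E.
have yx : `|y - x| * (S + 1) <= e.
  rewrite -ler_pdivlMr ?ltr_wpDl//; last exact: sumr_ge0.
  rewrite distrC; near: y; apply: cvgr_dist_le => //.
  by rewrite divr_gt0// ltr_wpDl//; exact: sumr_ge0.
apply: le_trans yx; apply: le_trans (ler_norm_sum _ _ _) _.
apply: (@le_trans _ _ (`|y - x| * S)); last by rewrite ler_wpM2l// lerDl.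
rewrite mulr_sumr ler_sum// => i _; rewrite normrM ler_pM//.
  by have := coord_ler_norm (y - x) i; rewrite !mxE.
apply: (le_trans _ (ler_norm _)); apply: (rH (c i) _).2.
exact: ball_closer xy.
Unshelve. all: by end_near. Qed.

Lemma continuous_partials_differentiable (x : 'rV[K]_m) : open V -> V x ->
  (forall i, {for x, continuous (dF i)}) ->
  differentiable F x /\
  forall v, is_derive x v F (\sum_(i < m) v ord0 i * dF i x).
Proof.
move=> oV Vx cd.
pose L (v : 'rV[K]_m) : K := \sum_(i < m) v ord0 i * dF i x.
have linL : linear L.
  move=> a u v; rewrite /L [in RHS]/GRing.scale/= mulr_sumr -big_split/=.
  by apply: eq_bigr => i _; rewrite !mxE mulrDl mulrA.
pose lL := GRing.isLinear.Build _ _ _ _ L linL.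
pose L' : {linear 'rV[K]_m -> K} := HB.pack L lL.
have cL : continuous (L' : _ -> _).
  move=> z; apply/continuous_distP => e e0.
  pose S := \sum_i `|dF i x|.
  have S0 : 0 < S + 1 by rewrite ltr_wpDl//; exact: sumr_ge0.
  have eS0 : 0 < e / (S + 1) by rewrite divr_gt0.
  near=> y; rewrite -linearB /L' /= /L (le_trans (ler_norm_sum _ _ _))//.
  apply: (@le_trans _ _ (`|z - y| * (S + 1))).
    rewrite mulrDr mulr1 -[leLHS]addr0 lerD// mulr_sumr ler_sum// => i _.
    by rewrite normrM ler_wpM2r//; exact: coord_ler_norm.
  rewrite -ler_pdivlMr//; near: y; exact: (@cvgr_dist_le _ _ _ _ _ id).
have oVx : nbhs x V by exact: open_nbhs_nbhs.
have key : forall e, 0 < e -> \forall y \near x,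
    `|F y - (F x + L' (y - x))| <= e * `|y - x|.
  move=> e e0.
  (* Each of the [m] legs contributes at most [e'] times the distance; [m.+1] keeps the division
     meaningful when [m = 0]. *)
  pose e' := e / (m.+1)%:R.
  have e'0 : 0 < e' by rewrite divr_gt0.
  have H : \forall y \near x, forall i, `|dF i x - dF i y| <= e'.
    near=> y => i; move: i; near: y; apply: filter_forall => i.
    exact: (continuous_distP _ _).1 (cd i) _ e'0.
  have /nbhs_ballP[r /= r0 rH] :
    \forall y \near x, V y /\ forall i, `|dF i x - dF i y| <= e' by exact: filterI.
  near=> y.
  have xy : ball x r y by near: y; exact: nbhsx_ballx.
  have [c [cx E]] := increment_partials (fun z h => (rH z h).1) xy.
  rewrite opprD addrA E /L' /= /L -sumrB.
  rewrite (le_trans (ler_norm_sum _ _ _))//.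
  apply: (@le_trans _ _ (\sum_(i < m) `|y - x| * e')).
    rewrite ler_sum// => i _; rewrite !mxE -mulrBr normrM ler_pM//.
      by have := coord_ler_norm (y - x) i; rewrite !mxE.
    rewrite distrC; apply: (rH (c i) _).2.
    exact: ball_closer xy.
  rewrite sumr_const card_ord -mulr_natr -mulrA mulrC ler_wpM2r//.
  by rewrite /e' mulrAC ler_pdivrMr// ler_wpM2l ?ltW// ltr_nat.
have key0 (e : {posnum K}) : \forall h \near (0 : 'rV[K]_m),
    `|F (h + x) - (F x + L' h)| <= e%:num * `|h|.
  have e0 : 0 < e%:num by [].
  have := key _ e0; rewrite (near_shift (0 : 'rV[K]_m) x) subr0.
  apply: filterS => h.
  by rewrite /= addrK.
have dF_eq : 'd F x = L' :> (_ -> _).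
  apply: diff_unique => //; apply/eqaddoP => _ /posnumP[e] /=.
  exact: key0.
have dif : differentiable F x.
  apply/diff_locallyP; rewrite dF_eq; split => //.
  apply/eqaddoP => _ /posnumP[e] /=.
  exact: key0.
split => // v; have -> : \sum_(i < m) v ord0 i * dF i x = 'D_v F x.
  by rewrite deriveE// dF_eq.
exact/derivableP/diff_derivable.
Unshelve. all: by end_near. Qed.
End C1.

(** * Smooth functions and a coinduction principle for them *)

Fixpoint iterDK (K : realType) (m : nat) (W : normedModType K) (vs : seq 'rV[K]_m)
    (F : 'rV[K]_m -> W) : 'rV[K]_m -> W :=
  match vs with
  | [::] => F
  | v :: vs' => fun x => derive (iterDK vs' F) x v
  end.

(** The copy of [smooth_on] over an arbitrary [realType], in which all the analysis is done;
    [smoothE] returns to the reals of the statement. *)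
Definition smooth (K : realType) (m : nat) (W : normedModType K) (V : set 'rV[K]_m)
    (F : 'rV[K]_m -> W) : Prop :=
  forall vs : seq 'rV[K]_m,
    (forall x, V x -> {for x, continuous (iterDK vs F)}) /\
    (forall v x, V x -> derivable (iterDK vs F) x v).

Section smooth_basics.
Context (K : realType) (m : nat) (W : normedModType K).
Implicit Types (V U : set 'rV[K]_m) (F G : 'rV[K]_m -> W).

Lemma open_near V x : open V -> V x -> \forall y \near x, V y.
Proof. by move=> oV Vx; exact: open_nbhs_nbhs. Qed.

Lemma near_eq_continuous (f g : 'rV[K]_m -> W) (x : 'rV[K]_m) :
  (\forall y \near x, f y = g y) -> {for x, continuous f} -> {for x, continuous g}.
Proof.
move=> fg cf; rewrite /prop_for /continuous_at -(nbhs_singleton fg).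
have gf : \forall y \near x, f y = g y by [].
exact: cvg_trans (near_eq_cvg gf) cf.
Qed.

Lemma iterDK_eq V F G vs : open V -> (forall x, V x -> F x = G x) ->
  forall x, V x -> iterDK vs F x = iterDK vs G x.
Proof.
move=> oV FG; elim: vs => //= v vs IH x Vx; apply: near_eq_derive.
by near=> y; apply: IH; near: y; exact: open_near.
Unshelve. all: by end_near. Qed.

Lemma smooth_eq V F G : open V -> (forall x, V x -> F x = G x) ->
  smooth V F -> smooth V G.
Proof.
move=> oV FG sF vs.
have E x : V x -> \forall y \near x, iterDK vs F y = iterDK vs G y.
  by move=> Vx; near=> y; apply: (iterDK_eq _ oV FG); near: y; exact: open_near.
split=> [x Vx|v x Vx].
  by apply: near_eq_continuous (E _ Vx) _; exact: (sF vs).1.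
by apply: near_eq_derivable (E _ Vx) _; exact: (sF vs).2.
Unshelve. all: by end_near. Qed.

Lemma smooth_sub V U F : U `<=` V -> smooth V F -> smooth U F.
Proof. by move=> UV sF vs; split=> [x|v x] /UV; [exact: (sF vs).1|exact: (sF vs).2]. Qed.

Lemma smooth_loc V F :
  (forall x, V x -> exists2 U, U x & smooth U F) -> smooth V F.
Proof.
move=> H vs; split=> [x|v x] /H [U Ux sF]; [exact: (sF vs).1|exact: (sF vs).2].
Qed.

Lemma iterDK_rcons F vs v : iterDK vs (fun x => 'D_v F x) = iterDK (rcons vs v) F.
Proof. by elim: vs => //= u vs ->. Qed.

Lemma smooth_derive V F v : smooth V F -> smooth V (fun x => 'D_v F x).
Proof. by move=> sF vs; rewrite iterDK_rcons. Qed.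

Lemma smooth_continuous V F x : smooth V F -> V x -> {for x, continuous F}.
Proof. by move=> sF; exact: (sF [::]).1. Qed.

Lemma smooth_is_derive V F v x : smooth V F -> V x -> is_derive x v F ('D_v F x).
Proof. by move=> sF Vx; apply/derivableP; exact: (sF [::]).2. Qed.

End smooth_basics.

Section lspan.
Context (K : realType) (T : Type).

(** The derivative of a product or a composite is a sum of members of the class at hand, so
    stability is asked up to finite linear combinations. *)
Inductive lspan (C : (T -> K) -> Prop) : (T -> K) -> Prop :=
| lspan0 : lspan C (fun=> 0)
| lspan_step (a : K) (F G : T -> K) : C F -> lspan C G -> lspan C (fun x => a * F x + G x).

Lemma lspanW C F : C F -> lspan C F.
Proof.
move=> CF; have := lspan_step 1 CF (lspan0 C).
by congr lspan; apply/funext => x; rewrite mul1r addr0.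
Qed.

Lemma lspanD C F G : lspan C F -> lspan C G -> lspan C (fun x => F x + G x).
Proof.
move=> sF sG; elim: sF => [|a F' H CF' _ IH].
  by move: sG; congr lspan; apply/funext => x; rewrite add0r.
by move: (lspan_step a CF' IH); congr lspan; apply/funext => x; rewrite addrA.
Qed.

Lemma lspanZ C a F : lspan C F -> lspan C (fun x => a * F x).
Proof.
elim => [|b F' H CF' _ IH].
  by move: (lspan0 C); congr lspan; apply/funext => x; rewrite mulr0.
by move: (lspan_step (a * b) CF' IH); congr lspan; apply/funext => x; rewrite mulrDr mulrA.
Qed.

Lemma lspan_sum C (I : Type) (r : seq I) (F : I -> T -> K) :
  (forall i, lspan C (F i)) -> lspan C (fun x => \sum_(i <- r) F i x).
Proof.
move=> H; elim: r => [|i r IH].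
  by move: (lspan0 C); congr lspan; apply/funext => x; rewrite big_nil.
by move: (lspanD (H i) IH); congr lspan; apply/funext => x; rewrite big_cons.
Qed.

End lspan.

Section coinduction.
Context (K : realType) (m : nat).

Definition locally_bounded (F : 'rV[K]_m -> K) (x : 'rV[K]_m) :=
  exists M : K, \forall y \near x, `|F y| <= M.

Lemma locally_bounded_cst (a : K) x : locally_bounded (fun=> a) x.
Proof. by exists `|a|; near=> y. Unshelve. all: by end_near. Qed.

(* A class of locally bounded functions whose partial derivatives exist and stay in its
   lspan consists of smooth functions: bounded partials give continuity, continuous ones
   give differentiability. *)
Lemma smooth_coind (V : set 'rV[K]_m) (C : ('rV[K]_m -> K) -> Prop) : open V ->
  (forall F, C F -> forall x, V x -> locally_bounded F x) ->
  (forall F i, C F -> exists2 G, lspan C G &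
     forall x, V x -> is_derive x (stdv K i) F (G x)) ->
  forall F, lspan C F -> smooth V F.
Proof.
move=> oV bd dC.
have bdS F : lspan C F -> forall x, V x -> locally_bounded F x.
  move=> + x Vx; elim => [|a F' G CF' _ [M HM]].
    exact: locally_bounded_cst.
  have [M' HM'] := bd _ CF' x Vx; exists (`|a| * M' + M); near=> y.
  rewrite (le_trans (ler_normD _ _))// lerD//; last by near: y.
  by rewrite normrM ler_wpM2l//; near: y.
have dS F i : lspan C F -> exists2 G, lspan C G &
     forall x, V x -> is_derive x (stdv K i) F (G x).
  elim => [|a F' G CF' _ [H sH dH]].
    by exists (fun=> 0); [exact: lspan0|move=> x _; exact: is_derive_cst].
  have [H' sH' dH'] := dC _ i CF'; exists (fun x => a * H' x + H x).
    by apply: lspanD => //; exact: lspanZ.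
  move=> x Vx; have ? := dH _ Vx; have ? := dH' _ Vx.
  exact: (@is_deriveD _ _ _ (fun x => a * F' x)).
have dSv F v : lspan C F -> {in V, continuous F} /\ exists2 G, lspan C G &
     forall x, V x -> is_derive x v F (G x).
  have cS F' : lspan C F' -> {in V, continuous F'}.
    move=> sF x /set_mem Vx; have /choice[dF HdF] : forall i, exists G, lspan C G /\
        forall x, V x -> is_derive x (stdv K i) F' (G x).
      by move=> i; have [G ? ?] := dS _ i sF; exists G.
    apply: (locally_bounded_partials_continuous (fun i => (HdF i).2)) => // i.
    by apply: bdS => //; exact: (HdF i).1.
  move=> sF; split; first exact: cS.
  have /choice[dF HdF] : forall i, exists G, lspan C G /\
      forall x, V x -> is_derive x (stdv K i) F (G x).
    by move=> i; have [G ? ?] := dS _ i sF; exists G.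
  exists (fun x => \sum_i v ord0 i * dF i x).
    by apply: lspan_sum => i; apply: lspanZ; exact: (HdF i).1.
  move=> x Vx.
  have [_] := continuous_partials_differentiable (fun i => (HdF i).2) oV Vx
     (fun i => cS _ (HdF i).1 x (mem_set Vx)).
  exact.
(* Iterated derivatives coincide with members of the span on [V] only; openness of [V] is what
   transfers continuity and derivability. *)
have it vs F : lspan C F -> exists2 G, lspan C G & forall x, V x -> iterDK vs F x = G x.
  move=> sF; elim: vs => [|v vs [G sG EG]]; first by exists F.
  have [_ [G' sG' dG']] := dSv _ v sG; exists G' => // x Vx /=.
  have [_ <-] := dG' _ Vx; apply: near_eq_derive.
  by near=> y; apply: EG; near: y; exact: open_near.
move=> F sF vs; have [G sG EG] := it vs F sF.
have E x : V x -> \forall y \near x, G y = iterDK vs F y.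
  by move=> Vx; near=> y; apply/esym/EG; near: y; exact: open_near.
split=> [x Vx|v x Vx].
  by apply: near_eq_continuous (E _ Vx) _; apply: (dSv G 0 sG).1; exact: mem_set.
apply: near_eq_derivable (E _ Vx) _.
by have [_ [G' _ /(_ _ Vx) []]] := dSv _ v sG.
Unshelve. all: by end_near. Qed.

Lemma smooth_bounded (V : set 'rV[K]_m) (F : 'rV[K]_m -> K) x : smooth V F -> V x ->
  locally_bounded F x.
Proof.
move=> sF Vx; exists (`|F x| + 1).
have := smooth_continuous sF Vx => /cvgr_dist_le /(_ _ ltr01); apply: filterS => y.
move=> h; rewrite -[F y](subrK (F x)) addrC (le_trans (ler_normD _ _))// lerD2l.
by rewrite distrC.
Qed.

Lemma smooth_coindW (V : set 'rV[K]_m) (C : ('rV[K]_m -> K) -> Prop) : open V ->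
  (forall F, C F -> forall x, V x -> locally_bounded F x) ->
  (forall F i, C F -> exists2 G, lspan C G &
     forall x, V x -> is_derive x (stdv K i) F (G x)) ->
  forall F, C F -> smooth V F.
Proof. by move=> oV bd dC F /lspanW; exact: smooth_coind. Qed.

End coinduction.

Section algebra.
Context (K : realType) (m : nat) (V : set 'rV[K]_m).
Hypothesis oV : open V.
Implicit Types F G : 'rV[K]_m -> K.

(** Smooth functions themselves form a class for the coinduction; closure under sums and multiples
    is then closure of the span. *)
Lemma smooth_span F : lspan (fun F : 'rV[K]_m -> K => smooth V F) F -> smooth V F.
Proof.
apply: smooth_coind => // G; first by move=> *; exact: smooth_bounded.
move=> i sG; exists (fun x => 'D_(stdv K i) G x); first exact/lspanW/smooth_derive.
by move=> x; exact: smooth_is_derive.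
Qed.

Lemma smooth_cst a : smooth V (fun=> a : K).
Proof.
apply: (@smooth_coindW K m V (fun F => exists a, F = fun=> a)) => //; last by exists a.
- by move=> _ [b ->] x _; exact: locally_bounded_cst.
- move=> _ i [b ->]; exists (fun=> 0); first exact: lspan0.
  by move=> x _; exact: is_derive_cst.
Qed.

Lemma smoothD F G : smooth V F -> smooth V G -> smooth V (fun x => F x + G x).
Proof. by move=> /lspanW ? /lspanW ?; apply/smooth_span/lspanD. Qed.

Lemma smoothZ a F : smooth V F -> smooth V (fun x => a * F x).
Proof. by move=> /lspanW ?; apply/smooth_span/lspanZ. Qed.

Lemma smoothN F : smooth V F -> smooth V (fun x => - F x).
Proof.
by move=> /(smoothZ (-1)); congr smooth; apply/funext => x; rewrite mulN1r.
Qed.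

Lemma smoothB F G : smooth V F -> smooth V G -> smooth V (fun x => F x - G x).
Proof. by move=> ? /smoothN; exact: smoothD. Qed.

Lemma smooth_sum (I : Type) (r : seq I) (F : I -> 'rV[K]_m -> K) :
  (forall i, smooth V (F i)) -> smooth V (fun x => \sum_(i <- r) F i x).
Proof. by move=> sF; apply/smooth_span/lspan_sum => i; exact/lspanW. Qed.

(** The class of all products of two smooth functions is stable by one application of Leibniz's
    rule, which replaces a formula for iterated derivatives of a product. *)
Lemma smoothM F G : smooth V F -> smooth V G -> smooth V (fun x => F x * G x).
Proof.
move=> sF sG.
apply: (@smooth_coindW K m V (fun H => exists F G, [/\ smooth V F, smooth V G &
   H = fun x => F x * G x])) => //; last by exists F, G.
- move=> _ [{sF sG}F [{}G [sF sG ->]]] x Vx.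
  have [M HM] := smooth_bounded sF Vx; have [N HN] := smooth_bounded sG Vx.
  exists (M * N); near=> y; rewrite normrM ler_pM//; near: y; [exact: HM|exact: HN].
- move=> _ i [{sF sG}F [{}G [sF sG ->]]].
  exists (fun x => F x * 'D_(stdv K i) G x + G x * 'D_(stdv K i) F x).
    apply: lspanD; apply: lspanW.
      exists F, (fun x => 'D_(stdv K i) G x).
      by split; [exact: sF|exact: smooth_derive|].
    exists G, (fun x => 'D_(stdv K i) F x).
    by split; [exact: sG|exact: smooth_derive|].
  move=> x Vx; have ? := smooth_is_derive (stdv K i) sF Vx.
  have ? := smooth_is_derive (stdv K i) sG Vx.
  exact: is_deriveM.
Unshelve. all: by end_near. Qed.

Lemma smooth_coord j : smooth V (fun x => x ord0 j).
Proof.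
pose L (x : 'rV[K]_m) : K := x ord0 j.
have dL (v x : 'rV[K]_m) : is_derive x v L (v ord0 j).
  have E : (fun h : K => h^-1 *: ((L \o shift x) (h *: v) - L x)) @ 0^' --> v ord0 j.
    apply: cvg_trans (@cvg_cst _ (v ord0 j) _ (0^') _).
    apply: near_eq_cvg; near=> h; rewrite /L /= !mxE addrK.
    rewrite [_ *: _]mulrA mulVf ?mul1r//; near: h; exact: nbhs_dnbhs_neq.
  by apply: DeriveDef; [apply/cvg_ex; exists (v ord0 j)|exact/cvg_lim].
apply: (@smooth_coindW K m V (fun F => F = L \/ exists a, F = fun=> a)) => //; last by left.
- move=> F [->|[b ->]] x _; last exact: locally_bounded_cst.
  exists (`|x| + 1); near=> y; rewrite (le_trans (coord_ler_norm y j))//.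
  rewrite -[y](subrK x) addrC (le_trans (ler_normD _ _))// lerD2l distrC.
  by near: y; apply: cvgr_dist_le.
- move=> _ i [->|[b ->]].
    exists (fun=> stdv K i ord0 j); last by move=> x _; exact: dL.
    by apply: lspanW; right; eexists.
  by exists (fun=> 0); [exact: lspan0|move=> x _; exact: is_derive_cst].
Unshelve. all: by end_near. Qed.

End algebra.

Section composition.
Context (K : realType).

Lemma smooth_differentiable m (V : set 'rV[K]_m) (F : 'rV[K]_m -> K) x :
  open V -> smooth V F -> V x -> differentiable F x.
Proof.
move=> oV sF Vx.
have [|//] := continuous_partials_differentiable
  (fun i y Vy => smooth_is_derive (stdv K i) sF Vy) oV Vx.
by move=> i; exact: smooth_continuous (smooth_derive _ sF) Vx.
Qed.

Lemma smooth_deriveE m (V : set 'rV[K]_m) (F : 'rV[K]_m -> K) x v :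
  open V -> smooth V F -> V x ->
  'D_v F x = \sum_(i < m) v ord0 i * 'D_(stdv K i) F x.
Proof.
move=> oV sF Vx.
have [|_ /(_ v) []//] := continuous_partials_differentiable
  (fun i y Vy => smooth_is_derive (stdv K i) sF Vy) oV Vx.
by move=> i; exact: smooth_continuous (smooth_derive _ sF) Vx.
Qed.

(** Along the line through [x] the inner map is a curve [h], differentiated coordinatewise; the
    chain rule for differentials is then applied at [0]. *)
Lemma is_derive_comp_row m n (F : 'rV[K]_n -> K) (g : 'rV[K]_m -> 'rV[K]_n) x v
    (w : 'rV[K]_n) :
  differentiable F (g x) -> (forall j, is_derive x v (fun y => g y ord0 j) (w ord0 j)) ->
  is_derive x v (F \o g) ('D_w F (g x)).
Proof.
move=> dF dg.
have := @is_derive_lineP K _ _ (F \o g) x v 0; rewrite scale0r addr0 => lP.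
apply/lP => {lP}.
pose h (t : K) := g (x + t *: v).
have h0 : h 0 = g x by rewrite /h scale0r addr0.
have dh : is_derive (0 : K) (1 : K) h w.
  have d : derivable h 0 1.
    apply/derivable_mxP => i j; rewrite (ord1 i).
    have := @is_derive_lineP K _ _ (fun y => g y ord0 j) x v 0.
    by rewrite scale0r addr0 => lP; have [] := (lP _).1 (dg j).
  apply: DeriveDef => //; rewrite derive_mx//; apply/rowP => j; rewrite mxE.
  have := @is_derive_lineP K _ _ (fun y => g y ord0 j) x v 0.
  by rewrite scale0r addr0 => lP; have [] := (lP _).1 (dg j).
have [dh1 dh2] := dh.
have dif : differentiable h 0 by exact/derivable1_diffP.
have dFh : differentiable (F \o h) 0.
  by apply: differentiable_comp => //; rewrite h0.
apply: DeriveDef; first exact/derivable1_diffP.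
have -> : (fun s : K => (F \o g) (x + s *: v)) = F \o h by [].
rewrite deriveE// diff_comp ?h0//= -(deriveE _ dif) dh2 deriveE//.
Qed.

(** The class is that of [F (g x) * P x] with [F] and [P] smooth: the chain rule produces
    derivatives of [g] as factors, and [P] absorbs them. *)
Lemma smooth_comp m n (V : set 'rV[K]_n) (U : set 'rV[K]_m) (F : 'rV[K]_n -> K)
    (g : 'rV[K]_m -> 'rV[K]_n) : open V -> open U ->
  smooth V F -> (forall j, smooth U (fun y => g y ord0 j)) ->
  (forall x, U x -> V (g x)) -> smooth U (fun x => F (g x)).
Proof.
move=> oV oU sF sg UV.
apply: (@smooth_coindW K m U (fun H => exists (F : 'rV[K]_n -> K) (P : 'rV[K]_m -> K), [/\ smooth V F, smooth U P &
   H = fun x => F (g x) * P x])) => //; last first.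
  exists F, (fun=> 1); split => //; first exact: smooth_cst.
  by apply/funext => x; rewrite mulr1.
- move=> _ i [{sF}F [P [sF sP ->]]]; set e := stdv K i.
  exists (fun x => \sum_j 'D_(stdv K j) F (g x) * ('D_e (fun y => g y ord0 j) x * P x)
     + F (g x) * 'D_e P x).
    apply: lspanD; last first.
      apply: lspanW; exists F, (fun x => 'D_e P x).
      by split; [exact: sF|exact: smooth_derive|].
    apply: lspan_sum => j; apply: lspanW.
    exists (fun x => 'D_(stdv K j) F x), (fun x => 'D_e (fun y => g y ord0 j) x * P x).
    split; [exact: smooth_derive| |by []].
    by apply: smoothM sP => //; exact: smooth_derive.
  move=> x Ux.
  have d : differentiable F (g x) by exact: smooth_differentiable (UV _ Ux).
  have dP := smooth_is_derive e sP Ux.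
  pose w : 'rV[K]_n := \row_j 'D_e (fun y => g y ord0 j) x.
  have dw : forall j, is_derive x e (fun y => g y ord0 j) (w ord0 j).
    by move=> j; rewrite mxE; exact: smooth_is_derive (sg j) Ux.
  have := is_derive_comp_row d dw; rewrite (smooth_deriveE _ oV)//; last exact: UV.
  move=> dc; apply: (is_derive_eq (is_deriveM dc dP)).
  rewrite addrC; congr (_ + _); rewrite [_ *: _]mulr_sumr; apply: eq_bigr => j _.
  by rewrite [w _ _]mxE [LHS]mulrC [X in X * P x]mulrC -mulrA.
- move=> _ [{sF}F [P [sF sP ->]]] x Ux.
  have [N HN] := smooth_bounded sP Ux; exists ((`|F (g x)| + 1) * N).
  have cg : {for x, continuous (F \o g)}.
    have d : differentiable F (g x) by exact: smooth_differentiable (UV _ Ux).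
    apply: continuous_comp; last exact: differentiable_continuous.
    apply/continuous_distP => e e0; near=> y.
    rewrite [leLHS]/Num.Def.normr/= mx_normrE (bigmax_le _ (ltW e0))//= => -[i j] _.
    rewrite !mxE/= (ord1 i); move: j {i}; near: y; apply: filter_forall => j.
    exact: (continuous_distP _ _).1 (smooth_continuous (sg j) Ux) _ e0.
  near=> y; rewrite normrM ler_pM//; last by near: y; exact: HN.
  rewrite -[F (g y)](subrK (F (g x))) addrC (le_trans (ler_normD _ _))// lerD2l distrC.
  by near: y; exact: (continuous_distP _ _).1 cg _ ltr01.
Unshelve. all: by end_near. Qed.

(** Coinduction is for scalar functions; vector-valued ones are reached through their
    coordinates. *)
Lemma smooth_row m n (V : set 'rV[K]_m) (g : 'rV[K]_m -> 'rV[K]_n) :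
  open V -> smooth V g <-> (forall j, smooth V (fun y => g y ord0 j)).
Proof.
move=> oV.
(* Either side of the equivalence suffices for this identity, so it is proved once for both
   directions. *)
have E vs : (forall j, smooth V (fun y => g y ord0 j)) \/ smooth V g ->
    forall x, V x -> iterDK vs g x = \row_j iterDK vs (fun y => g y ord0 j) x.
  elim: vs => [_ x _ /=|v vs IH H x Vx /=].
    by apply/rowP => j; rewrite mxE.
  have E : \forall y \near x, (\row_j iterDK vs (fun y => g y ord0 j) y) = iterDK vs g y.
    by near=> y; apply/esym/IH => //; near: y; exact: open_near.
  rewrite -(near_eq_derive _ E) derive_mx.
    by apply/rowP => j; rewrite !mxE; congr ('D_v _ x); apply/funext => y; rewrite mxE.
  case: H => H; last first.
    by apply: near_eq_derivable ((H vs).2 v _ Vx); near do apply/esym.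
  apply/derivable_mxP => i j; under eq_fun do rewrite mxE.
  exact: (H j vs).2.
split=> [H j vs|H vs].
  have E1 x : V x -> \forall y \near x,
      iterDK vs g y ord0 j = iterDK vs (fun y => g y ord0 j) y.
    move=> Vx; near=> y; rewrite E ?mxE//; first by right.
    by near: y; exact: open_near.
  split=> [x Vx|v x Vx].
    apply: near_eq_continuous (E1 _ Vx) _.
    apply: (continuous_distP _ _).2 => e e0.
    have /continuous_distP/(_ e e0) := (H vs).1 x Vx; apply: filterS => y.
    by apply: le_trans; have := coord_ler_norm (iterDK vs g x - iterDK vs g y) j; rewrite !mxE.
  apply: near_eq_derivable (E1 _ Vx) _.
  by move/derivable_mxP : ((H vs).2 v x Vx); exact.
have E1 x : V x -> \forall y \near x,
    (\row_j iterDK vs (fun y => g y ord0 j) y) = iterDK vs g y.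
  move=> Vx; near=> y; rewrite E ?mxE//; first by left.
  by near: y; exact: open_near.
split=> [x Vx|v x Vx].
  apply: near_eq_continuous (E1 _ Vx) _.
  apply/continuous_distP => e e0; near=> y.
  rewrite [leLHS]/Num.Def.normr/= mx_normrE (bigmax_le _ (ltW e0))//= => -[i j] _.
  rewrite !mxE/=; move: j {i}; near: y; apply: filter_forall => j.
  exact: (continuous_distP _ _).1 ((H j vs).1 _ Vx) _ e0.
apply: near_eq_derivable (E1 _ Vx) _.
apply/derivable_mxP => i j; under eq_fun do rewrite mxE.
exact: (H j vs).2.
Unshelve. all: by end_near. Qed.

End composition.

Lemma smoothE m (W : normedModType R) (V : set 'rV[R]_m) (F : 'rV[R]_m -> W) :
  smooth_on V F = smooth V F.
Proof.
have E (vs : seq 'rV[R]_m) : @Defs.iterD m W vs F = iterDK vs F by elim: vs => //= v vs ->.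
by rewrite /smooth_on /smooth; under eq_forall do rewrite E.
Qed.

#[global] Opaque smooth iterDK.

(** * Functions of one real variable *)

Section one_variable.
Context (K : realType).
Implicit Types (A : set K) (f g : K -> K).

Lemma is_derive_coord1 f (x : 'rV[K]_1) (l : K) :
  is_derive (x ord0 ord0) 1 f l ->
  is_derive x (stdv K ord0) (fun y : 'rV[K]_1 => f (y ord0 ord0)) l.
Proof.
move=> df.
have := @is_derive_lineP K _ _ f (x ord0 ord0) 1 0 l.
rewrite scale0r addr0 => /iffLR/(_ df) {}df.
have := @is_derive_lineP K _ _ (fun y : 'rV[K]_1 => f (y ord0 ord0)) x (stdv K ord0) 0 l.
rewrite scale0r addr0 => /iffRL; apply.
rewrite (_ : (fun _ => _) = (fun s : K => f (x ord0 ord0 + s *: 1)))//.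
by apply/funext => s; rewrite !mxE.
Qed.

Lemma is_derive_const1 f (t l : K) :
  is_derive (const_mx t : 'rV[K]_1) (stdv K ord0) (fun y : 'rV[K]_1 => f (y ord0 ord0)) l ->
  is_derive t 1 f l.
Proof.
move=> df.
have := @is_derive_lineP K _ _ f t 1 0 l.
rewrite scale0r addr0 => /iffRL; apply.
have := @is_derive_lineP K _ _ (fun y : 'rV[K]_1 => f (y ord0 ord0)) (const_mx t) (stdv K ord0) 0 l.
rewrite scale0r addr0 => /iffLR/(_ df).
rewrite (_ : (fun _ => _) = (fun s : K => f (t + s *: 1)))//.
by apply/funext => s; rewrite !mxE.
Qed.

(** A real variable is read as the coordinate of ['rV_1], so that the closure results for several
    variables apply. *)
Definition smooth1 A f :=
  smooth [set x : 'rV[K]_1 | A (x ord0 ord0)] (fun x : 'rV[K]_1 => f (x ord0 ord0)).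

Lemma continuous_coord m (i : 'I_m) : continuous (fun x : 'rV[K]_m => x ord0 i).
Proof.
move=> x; apply: smooth_continuous (smooth_coord _ i) _; first exact: openT.
by [].
Qed.

Lemma open_coord m (i : 'I_m) A : open A -> open [set x : 'rV[K]_m | A (x ord0 i)].
Proof. by move=> oA; apply: open_comp => // x _; exact: continuous_coord. Qed.

(** In one variable derivability already yields continuity, hence the local boundedness that
    [smooth_coindW] asks for. *)
Lemma smooth1_coind A (C : (K -> K) -> Prop) : open A ->
  (forall f, C f -> exists2 g, lspan C g & forall t, A t -> is_derive t 1 f (g t)) ->
  forall f, C f -> smooth1 A f.
Proof.
move=> oA dC f Cf.
have oV := @open_coord 1 ord0 A oA.
apply: (@smooth_coindW K 1 _ (fun F => exists2 f, C f &
  F = fun x : 'rV[K]_1 => f (x ord0 ord0))) => //; last by exists f.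
- move=> _ {Cf}[{}f Cf ->] x Ax; have [g _ /(_ _ Ax) df] := dC f Cf.
  have [d _] := is_derive_coord1 df.
  have cf : {for x ord0 ord0, continuous f}.
    by case: df => /derivable1_diffP/differentiable_continuous.
  have cF : {for x, continuous (fun x : 'rV[K]_1 => f (x ord0 ord0))}.
    by apply: continuous_comp => //; exact: continuous_coord.
  exists (`|f (x ord0 ord0)| + 1).
  have := (continuous_distP _ _).1 cF _ ltr01; apply: filterS => y H.
  rewrite -[f (y _ _)](subrK (f (x ord0 ord0))) addrC (le_trans (ler_normD _ _))// lerD2l.
  by rewrite distrC.
- move=> _ i {Cf}[{}f Cf ->]; have [g sg dg] := dC f Cf.
  exists (fun x => g (x ord0 ord0)); last first.
    by move=> x Ax; rewrite (ord1 i); apply/is_derive_coord1/dg.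
  elim: sg => [|a h h' Ch _ IH]; first exact: lspan0.
  by apply: (lspan_step a) IH; exists h.
Qed.

Lemma smooth1_is_derive A f t : smooth1 A f -> A t ->
  is_derive t 1 f ('D_1 f t).
Proof.
move=> sf At; apply/derivableP.
have := @smooth_is_derive K 1 _ _ _ (stdv K ord0) (const_mx t) sf.
by rewrite /= mxE => /(_ At)/is_derive_const1[].
Qed.

Lemma smooth1_derive A f : open A -> smooth1 A f -> smooth1 A (fun t => 'D_1 f t).
Proof.
move=> oA sf; apply: smooth_eq (smooth_derive (stdv K ord0) sf); first exact: open_coord.
by move=> x Ax; have [_ ->] := is_derive_coord1 (smooth1_is_derive sf Ax).
Qed.

Lemma smooth1_primitive A f g : open A -> smooth1 A g ->
  (forall t, A t -> is_derive t 1 f (g t)) -> smooth1 A f.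
Proof.
move=> oA sg df.
apply: (@smooth1_coind A (fun h => h = f \/ smooth1 A h)) => //; last by left.
move=> h [->|sh]; first by exists g => //; apply: lspanW; right.
exists (fun t => 'D_1 h t); first by apply: lspanW; right; exact: smooth1_derive.
by move=> t; exact: smooth1_is_derive.
Qed.

Lemma smooth1_comp m A (U : set 'rV[K]_m) f (g : 'rV[K]_m -> K) : open A -> open U ->
  smooth1 A f -> smooth U g -> (forall x, U x -> A (g x)) -> smooth U (fun x => f (g x)).
Proof.
move=> oA oU sf sg UA.
have -> : (fun x => f (g x)) =
   (fun x => (fun y : 'rV[K]_1 => f (y ord0 ord0)) (const_mx (g x))).
  by apply/funext => x; rewrite mxE.
apply: (smooth_comp (@open_coord 1 ord0 A oA) oU sf).
  by move=> j; under eq_fun do rewrite mxE.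
by move=> x Ux /=; rewrite mxE; exact: UA.
Qed.

Lemma smooth1_compf A (B : set K) f g : open A -> open B ->
  smooth1 A f -> smooth1 B g -> (forall x, B x -> A (g x)) -> smooth1 B (fun x => f (g x)).
Proof.
move=> oA oB sf sg BA.
exact: smooth1_comp oA (@open_coord 1 ord0 B oB) sf sg (fun x => BA (x ord0 ord0)).
Qed.

Lemma smooth1_affine A (a b : K) : open A -> smooth1 A (fun t => a * t + b).
Proof.
move=> oA; have oV := @open_coord 1 ord0 A oA.
apply: smoothD; [exact: oV| |exact: smooth_cst].
by apply: smoothZ => //; exact: smooth_coord.
Qed.

Lemma is_derive_inv (t : K) : t != 0 -> is_derive t 1 (fun s : K => s^-1) (- t ^- 2).
Proof.
move=> t0.
have := @is_deriveV K id t 1 1 t0 (is_derive_id t 1).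
by move=> H; apply: (is_derive_eq H); rewrite [_ *: _]mulr1.
Qed.

Lemma is_derive_pow f (t l : K) n : is_derive t 1 f l ->
  is_derive t 1 (fun s => f s ^+ n) (n%:R * f t ^+ n.-1 * l).
Proof.
move=> df; elim: n => [|n IH].
  by rewrite !mul0r; under eq_fun do rewrite expr0; exact: is_derive_cst.
under eq_fun do rewrite exprS.
apply: (is_derive_eq (is_deriveM df IH)); rewrite /GRing.scale/=.
case: n {IH} => [|n] /=; first by rewrite expr0; ring.
rewrite [in RHS]mulrS exprS; ring.
Qed.

(** All powers of the inverse together are stable: the derivative of one is a multiple of the
    next. *)
Lemma smooth1_inv : smooth1 [set t | t != 0] (fun t : K => t^-1).
Proof.
have oA : open [set t : K | t != 0] by exact: open_neq.
apply: (@smooth1_coind _ (fun h => exists n, h = fun t : K => (t^-1) ^+ n)) => //.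
  move=> _ [n ->]; exists (fun t : K => - n%:R * (t^-1) ^+ n.+1).
    by apply: lspanZ; apply: lspanW; exists n.+1.
  move=> t t0; have dV := is_derive_inv t0.
  apply: (is_derive_eq (is_derive_pow n dV)).
  case: n => [|n]; first by rewrite /= !mul0r oppr0 mul0r.
  by rewrite /= -[t ^- 2]exprVn !exprS; ring.
by exists 1%N; apply/funext => t; rewrite expr1.
Qed.

(** The class is the square root together with all powers of its inverse; differentiating such a
    power raises its exponent by two. *)
Lemma smooth1_sqrt : smooth1 [set t : K | 0 < t] (fun t : K => Num.sqrt t).
Proof.
have oA : open [set t : K | 0 < t] by exact: open_gt.
apply: (@smooth1_coind _ (fun h => h = (fun t : K => Num.sqrt t) \/
    exists n, h = fun t : K => (Num.sqrt t)^-1 ^+ n)) => //; last by left.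
move=> _ [->|[n ->]].
  exists (fun t => 2^-1 * (Num.sqrt t)^-1 ^+ 1).
    by apply: lspanZ; apply: lspanW; right; exists 1%N.
  by move=> t t0; rewrite expr1 -invfM; exact: is_derive1_sqrt.
exists (fun t => (- n%:R / 2) * (Num.sqrt t)^-1 ^+ n.+2).
  by apply: lspanZ; apply: lspanW; right; exists n.+2.
move=> t t0; have s0 : Num.sqrt t != 0 by rewrite gt_eqF ?sqrtr_gt0.
have dV := is_deriveV s0 (is_derive1_sqrt t0).
apply: (is_derive_eq (is_derive_pow n dV)).
case: n => [|n]; first by rewrite /= !mul0r oppr0 !mul0r.
by rewrite /= -[_ ^- 2]exprVn invfM [in LHS]/GRing.scale/= !exprS; ring.
Qed.

(** By the mean value theorem each difference quotient at [x] is a value of [g] at a nearby point,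
    and continuity of [g] at [x] gives the limit. Used at [0] for the flat function and at the seam
    of Seeley's reflection. *)
Lemma is_derive_removable f g (x d : K) : 0 < d ->
  (forall t, t != x -> `|t - x| < d -> is_derive t 1 f (g t)) ->
  {for x, continuous f} -> {for x, continuous g} -> is_derive x 1 f (g x).
Proof.
move=> d0 df cf cg.
have mvt a b : a < b -> (forall t, t \in `[a, b] -> `|t - x| < d) ->
    (forall t, t \in `]a, b[ -> t != x) ->
    exists2 c, c \in `]a, b[ & f b - f a = g c * (b - a).
  move=> ab abd abx; apply: MVT => //.
    by move=> t tab; apply: df; [exact: abx|exact/abd/subset_itv_oo_cc].
  apply: continuous_in_subspaceT => t /set_mem tab.
  have [->//|tx] := eqVneq t x.
  by have [/derivable1_diffP/differentiable_continuous] := df _ tx (abd _ tab).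
have L : (fun h : K => h^-1 *: ((f \o shift x) (h *: 1) - f x)) @ 0^' --> g x.
  apply/cvgrPdist_le => e e0.
  have /nbhs_ballP[r /= r0 rH] := (continuous_distP _ _).1 cg _ e0.
  near=> h; have h0 : h != 0 by near: h; exact: nbhs_dnbhs_neq.
  have hrd : `|h| < Num.min r d by near: h; apply: dnbhs0_lt; rewrite lt_min r0.
  have [hr hd] : `|h| < r /\ `|h| < d by apply/andP; rewrite -lt_min.
  have [c ch ->] : exists2 c, `|c - x| <= `|h| & f (h *: 1 + x) - f x = g c * h.
    rewrite [h *: 1]mulr1.
    have [hp|hn|h00] := ltgtP 0 h; last by rewrite h00 eqxx in h0.
      have [|t|t|c] := mvt x (h + x).
      - by rewrite ltrDr.
      - rewrite in_itv/= => /andP[xt th]; rewrite ger0_norm ?subr_ge0//.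
        by rewrite (le_lt_trans _ hd)// lerBlDr (le_trans th)// lerD2r ler_norm.
      - by rewrite in_itv/= => /andP[xt _]; rewrite gt_eqF.
      rewrite in_itv/= addrK => /andP[xc ch] E; exists c => //.
      by rewrite gtr0_norm ?subr_gt0// lerBlDr (le_trans (ltW ch))// lerD2r ler_norm.
    have [|t|t|c] := mvt (h + x) x.
    - by rewrite gtrDr.
    - rewrite in_itv/= => /andP[xt th]; rewrite ler0_norm ?subr_le0// opprB.
      by rewrite (le_lt_trans _ hd)// (ltr0_norm hn) lerBlDr -lerBlDl opprK addrC.
    - by rewrite in_itv/= => /andP[_ xt]; rewrite lt_eqF.
    rewrite in_itv/= => /andP[xc ch] E; exists c => //.
      rewrite ltr0_norm ?subr_lt0// opprB (ltr0_norm hn) lerBlDr -lerBlDl opprK addrC.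
      exact: ltW.
    by rewrite -[LHS]opprB E opprD addrCA subrr addr0 mulrN opprK.
  rewrite [_ *: _]mulrC mulfK//; apply: rH.
  by rewrite -ball_normE /ball_/= distrC (le_lt_trans ch).
by apply: DeriveDef; [apply/cvg_ex; exists (g x)|exact/cvg_lim].
Unshelve. all: by end_near. Qed.

End one_variable.

(** * The flat function, the step [lam] and the ramp [phi] *)

Section bumps.
Context (K : realType).

Lemma near_lt (x a : K) : x < a -> \forall y \near x, y < a.
Proof. by move=> xa; apply: open_nbhs_nbhs; split => //; exact: open_lt. Qed.

Lemma near_gt (x a : K) : a < x -> \forall y \near x, a < y.
Proof. by move=> xa; apply: open_nbhs_nbhs; split => //; exact: open_gt. Qed.

Lemma MVT_derive (f df : K -> K) (a b : K) :
  (forall t : K, is_derive t 1 f (df t)) -> a < b ->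
  exists c, [/\ a < c, c < b & f b - f a = df c * (b - a)].
Proof.
move=> H ab.
have cf : {within `[a, b], continuous f}.
  by apply: derivable_within_continuous => t _; case: (H t).
have [c + E] := MVT ab (fun t _ => H t) cf.
by rewrite in_itv/= => /andP[? ?]; exists c.
Qed.

Lemma derive_ge0_ndecr (f df : K -> K) (a b : K) :
  (forall t : K, is_derive t 1 f (df t)) -> (forall t, 0 <= df t) -> a <= b -> f a <= f b.
Proof.
move=> H df0; rewrite le_eqVlt => /predU1P[->//|ab].
have [c [_ _ E]] := MVT_derive H ab.
by rewrite -subr_ge0 E mulr_ge0// subr_ge0 ltW.
Qed.

Lemma smooth1_continuous (A : set K) (f : K -> K) (t : K) :
  smooth1 A f -> A t -> {for t, continuous f}.
Proof.
by move=> sf /(smooth1_is_derive sf) [/derivable1_diffP/differentiable_continuous].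
Qed.

Definition flat (t : K) : K := if t <= 0 then 0 else expR (- t^-1).

Lemma flat_ge0 t : 0 <= flat t.
Proof. by rewrite /flat; case: ifP => // _; exact: expR_ge0. Qed.

Lemma flat_gt0 t : 0 < t -> 0 < flat t.
Proof. by move=> t0; rewrite /flat leNgt t0 /= expR_gt0. Qed.

Lemma flat_eq0 t : t <= 0 -> flat t = 0.
Proof. by rewrite /flat => ->. Qed.

(** The class is that of the [L k], that is [t^-k exp(-1/t)] continued by zero, with derivative
    [-k L(k+1) + L(k+2)]; the delicate point is [0]. *)
Lemma smooth1_flat : smooth1 setT flat.
Proof.
pose L k (t : K) : K := if t <= 0 then 0 else t^-1 ^+ k * expR (- t^-1).
have L0 k t : t <= 0 -> L k t = 0 by rewrite /L => ->.
(* With [s = 1/h] this is [s^k exp(-s) <= (k+1)!/s], from a single term of the exponential series;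
   every [L k] is thus continuous at [0]. *)
have Lb k (h : K) : `|L k h| <= (k.+1)`!%:R * `|h|.
  have [h0|h0] := leP h 0; first by rewrite L0// normr0 mulr_ge0.
  rewrite /L [h <= 0]leNgt h0 /=.
  have s0 : 0 < h^-1 by rewrite invr_gt0.
  rewrite gtr0_norm ?mulr_gt0 ?exprn_gt0 ?expR_gt0// gtr0_norm//.
  have := expR_ge1Dxn k (ltW s0) => H.
  rewrite expRN ler_pdivrMr ?expR_gt0//.
  have f0 : (k.+1)`!%:R != 0 :> K by rewrite pnatr_eq0 -lt0n fact_gt0.
  have -> : h^-1 ^+ k = (k.+1)`!%:R * h * (h^-1 ^+ k.+1 / (k.+1)`!%:R).
    by rewrite exprS; field; rewrite f0 gt_eqF.
  rewrite ler_wpM2l ?mulr_ge0 ?ltW//.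
  by apply: lt_le_trans H; rewrite ltrDr.
have L_cont k : {for (0 : K), continuous (L k)}.
  apply/continuous_distP => e e0; rewrite L0//; near=> h.
  rewrite sub0r normrN (le_trans (Lb _ _))//.
  have f0 : 0 < (k.+1)`!%:R :> K by rewrite ltr0n fact_gt0.
  rewrite mulrC -ler_pdivlMr// -[h]opprK normrN -[- h]sub0r.
  by near: h; apply: (@cvgr_dist_le _ _ _ _ _ id) => //; rewrite divr_gt0.
pose D k (t : K) := - k%:R * L k.+1 t + 1 * L k.+2 t.
have D_cont k : {for (0 : K), continuous (D k)}.
  by apply: cvgD; apply: cvgM; [exact: cvg_cst|exact: L_cont|exact: cvg_cst|exact: L_cont].
have dL k (t : K) : is_derive t 1 (L k) (D k t).
  have dneq (s : K) : s != 0 -> is_derive s 1 (L k) (D k s).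
    move=> s0; have [sn|sp] := ltP s 0.
      have E : \forall y \near s, 0 = L k y.
        by near=> y; rewrite L0// ltW//; near: y; exact: near_lt.
      rewrite /D !L0 ?ltW// !mulr0 addr0.
      by apply: near_eq_is_derive E _; exact: is_derive_cst.
    have {}sp : 0 < s by rewrite lt_neqAle eq_sym s0.
    have E : \forall y \near s, y^-1 ^+ k * expR (- y^-1) = L k y.
      near=> y; rewrite /L ifF//; apply/negbTE; rewrite -ltNge; near: y.
      exact: near_gt.
    apply: near_eq_is_derive E _.
    have dV := is_derive_inv s0.
    have dE := @is_derive1_comp K expR (fun y => - y^-1) s _ _ (is_derive_expR (- s^-1)) (is_deriveN dV).
    apply: (is_derive_eq (is_deriveM (is_derive_pow k dV) dE)).
    rewrite /D /L leNgt sp /= /GRing.scale /=.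
    case: k {L_cont D D_cont Lb L0} => [|n].
      by rewrite /= -[s ^- 2]exprVn !exprS; ring.
    by rewrite /= -[s ^- 2]exprVn !exprS; ring.
  have [->|] := eqVneq t 0; last exact: dneq.
  by apply: (is_derive_removable ltr01) => // s s0 _; exact: dneq.
apply: (@smooth1_coind K _ (fun f => exists k, f = L k)); first exact: openT.
  move=> _ [k ->]; exists (D k); last by move=> t _; exact: dL.
  by apply: lspanD; apply: lspanZ; apply: lspanW; [exists k.+1|exists k.+2].
by exists 0; apply/funext => t; rewrite /L /flat expr0 mul1r.
Unshelve. all: by end_near. Qed.

Definition ointK (a b : K) (f : K -> K) : K :=
  if a <= b then \int[lebesgue_measure]_(x in `[a, b]) f x
  else - \int[lebesgue_measure]_(x in `[b, a]) f x.

Lemma continuous_itv_integrable (f : K -> K) (a b : K) : continuous f ->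
  (@lebesgue_measure K).-integrable `[a, b] (EFin \o f).
Proof.
move=> cf; apply: continuous_compact_integrable; first exact: segment_compact.
exact: continuous_subspaceT.
Qed.

(** A base point [a] below both [0] and [y] removes the case distinction of the oriented integral,
    so that the fundamental theorem applies on either side of [0]. *)
Lemma ointE (f : K -> K) (a y : K) : continuous f -> a <= 0 -> a <= y ->
  ointK 0 y f = \int[lebesgue_measure]_(x in `[a, y]) f x -
    \int[lebesgue_measure]_(x in `[a, 0]) f x.
Proof.
move=> cf a0 ay; rewrite /ointK.
have iB (u v : K) : a <= u -> u <= v -> \int[lebesgue_measure]_(x in `[u, v]) f x =
    \int[lebesgue_measure]_(x in `[a, v]) f x - \int[lebesgue_measure]_(x in `[a, u]) f x.
  move=> au uv; rewrite Rintegral_itvB ?bnd_simp//; last exact: continuous_itv_integrable.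
  rewrite Rintegral_itv_obnd_cbnd//.
  apply: integrableS (continuous_itv_integrable u v cf) => //.
  exact: subset_itv_oc_cc.
have [y0|y0] := leP 0 y; first exact: iB.
by rewrite (iB _ _ ay (ltW y0)) opprB.
Qed.

Lemma is_derive_oint (f : K -> K) (x : K) : continuous f ->
  is_derive x 1 (fun y => ointK 0 y f) (f x).
Proof.
move=> cf; pose a := Num.min 0 x - 1.
have a0 : a <= 0 by rewrite /a lerBlDr add0r ge_min ler01.
have ax : a < x by rewrite /a ltrBlDr gt_min ltrDl ltr01 orbT.
pose F y := \int[lebesgue_measure]_(t in `[a, y]) f t.
have x1 : x < x + 1 by rewrite ltrDl.
have [dF F'] := continuous_FTC1_closed x1 (continuous_itv_integrable _ _ cf) ax (cf x).
have dFx : is_derive x 1 F (f x)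
  by apply: DeriveDef; [exact: dF|rewrite -derive1E; exact: F'].
have E : \forall y \near x, F y - F 0 = ointK 0 y f.
  near=> y; rewrite (@ointE _ a)//; apply: ltW; near: y; exact: near_gt.
apply: near_eq_is_derive E _.
apply: (is_derive_eq (is_deriveB dFx (is_derive_cst (F 0) x 1))).
by rewrite subr0.
Unshelve. all: by end_near. Qed.

Lemma ointxx (f : K -> K) : ointK 0 0 f = 0.
Proof. by rewrite /ointK lexx set_itv1 Rintegral_set1. Qed.

Definition bumpK (x : K) : K := flat (3 * x) * flat (3 - 3 * x).

Lemma smooth1_bump : smooth1 setT bumpK.
Proof.
have oT : open (setT : set K) by exact: openT.
apply: smoothM; first exact: (@open_coord K 1 ord0 _ oT).
  apply: (smooth1_compf oT oT smooth1_flat (g := fun x => 3 * x)) => //.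
  by under eq_fun do rewrite -[3 * _]addr0; exact: smooth1_affine.
apply: (smooth1_compf oT oT smooth1_flat (g := fun x => 3 - 3 * x)) => //.
by under eq_fun do rewrite addrC -mulNr; exact: smooth1_affine.
Qed.

Lemma bumpK_continuous : continuous bumpK.
Proof. by move=> t; exact: (smooth1_continuous smooth1_bump). Qed.

Lemma bumpK_ge0 x : 0 <= bumpK x.
Proof. by rewrite mulr_ge0 ?flat_ge0. Qed.

Lemma bumpK_sym x : bumpK (1 - x) = bumpK x.
Proof. by rewrite /bumpK mulrC; congr (flat _ * flat _); ring. Qed.

Lemma bumpK_le0 x : x <= 0 -> bumpK x = 0.
Proof. by move=> x0; rewrite /bumpK flat_eq0 ?mul0r//; lra. Qed.

Lemma bumpK_gt0 x : 0 < x < 1 -> 0 < bumpK x.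
Proof. by move=> x01; rewrite mulr_gt0// flat_gt0//; lra. Qed.

Definition alphaK : K := ointK 0 1 bumpK.

Lemma alphaK_gt0 : 0 < alphaK.
Proof.
have [c [c0 c1]] := MVT_derive (fun x => is_derive_oint x bumpK_continuous) ltr01.
rewrite ointxx !subr0 mulr1 /alphaK => ->.
by rewrite bumpK_gt0// c0.
Qed.

Definition lamK (t : K) : K := alphaK^-1 * ointK 0 t bumpK.

Lemma is_derive_lamK (t : K) : is_derive t 1 lamK (alphaK^-1 * bumpK t).
Proof. exact: is_deriveZ (is_derive_oint t bumpK_continuous). Qed.

Lemma smooth1_lamK : smooth1 setT lamK.
Proof.
have oT : open (setT : set K) by exact: openT.
apply: (@smooth1_primitive _ _ _ (fun t => alphaK^-1 * bumpK t)) => //; last first.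
  by move=> t _; exact: is_derive_lamK.
by apply: smoothZ smooth1_bump; exact: (@open_coord K 1 ord0 _ oT).
Qed.

Lemma lamK_continuous : continuous lamK.
Proof. by move=> t; exact: (smooth1_continuous smooth1_lamK). Qed.

(** The symmetry of the bump about [1/2] makes the derivative of the left side zero; at [0] the left
    side is [lamK 1 = 1]. *)
Lemma lamK_sym t : lamK t + lamK (1 - t) = 1.
Proof.
have dh (x : K) : is_derive x 1 (fun x : K => 1 - x) (-1).
  have := is_deriveB (is_derive_cst (1 : K) x 1) (is_derive_id x (1 : K)).
  by rewrite sub0r.
have d (x : K) : is_derive x 1 (fun x => lamK x + lamK (1 - x)) 0.
  have d2 := @is_derive1_comp K lamK (fun x => 1 - x) x _ _ (is_derive_lamK (1 - x)) (dh x).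
  apply: (is_derive_eq (is_deriveD (is_derive_lamK x) d2)).
  by rewrite bumpK_sym mulrN1 subrr.
rewrite (@is_derive_0_is_cst K _ t 0 d) subr0 /lamK ointxx mulr0 add0r.
by rewrite -/alphaK mulVf// gt_eqF// alphaK_gt0.
Qed.

Lemma lamK_le0 t : t <= 0 -> lamK t = 0.
Proof.
rewrite le_eqVlt => /predU1P[->|t0]; first by rewrite /lamK ointxx mulr0.
have [c [_ c0 /eqP]] := MVT_derive is_derive_lamK t0.
rewrite bumpK_le0 ?ltW// mulr0 mul0r subr_eq0 => /eqP <-.
by rewrite /lamK ointxx mulr0.
Qed.

Lemma lamK_ge1 t : 1 <= t -> lamK t = 1.
Proof.
by move=> t1; have := lamK_sym t; rewrite [lamK (1 - t)]lamK_le0 ?addr0// subr_le0.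
Qed.

Lemma lamK_ndecr s t : s <= t -> lamK s <= lamK t.
Proof.
apply: (derive_ge0_ndecr is_derive_lamK) => x.
by rewrite mulr_ge0 ?bumpK_ge0// invr_ge0 ltW// alphaK_gt0.
Qed.

Lemma lamK_ge0 t : 0 <= lamK t.
Proof.
have [t0|t0] := leP t 0; first by rewrite lamK_le0.
by rewrite -(lamK_le0 (lexx 0)) lamK_ndecr// ltW.
Qed.

Definition phiK (t : K) : K := ointK 0 (2^-1 + t) lamK.

Lemma is_derive_phiK (t : K) : is_derive t 1 phiK (lamK (2^-1 + t)).
Proof.
have dh : is_derive t 1 (fun x : K => 2^-1 + x) 1.
  have := is_deriveD (is_derive_cst (2^-1 : K) t 1) (is_derive_id t (1 : K)).
  by rewrite add0r.
have := is_derive1_comp (is_derive_oint (2^-1 + t) lamK_continuous) dh.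
by rewrite mulr1.
Qed.

Lemma smooth1_phiK : smooth1 setT phiK.
Proof.
have oT : open (setT : set K) by exact: openT.
apply: (@smooth1_primitive _ _ _ (fun t => lamK (2^-1 + t))) => //; last first.
  by move=> t _; exact: is_derive_phiK.
apply: (smooth1_compf oT oT smooth1_lamK (g := fun x => 2^-1 + x)) => //.
by under eq_fun do rewrite addrC -[X in X + _]mul1r; exact: smooth1_affine.
Qed.

Lemma phiK_ndecr s t : s <= t -> phiK s <= phiK t.
Proof. by apply: (derive_ge0_ndecr is_derive_phiK) => x; exact: lamK_ge0. Qed.

Lemma phiK_eq0 t : t <= - 2^-1 -> phiK t = 0.
Proof.
have p0 : phiK (- 2^-1) = 0 by rewrite /phiK subrr ointxx.
rewrite le_eqVlt => /predU1P[->//|t0].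
have [c [_ c0 /eqP]] := MVT_derive is_derive_phiK t0.
rewrite lamK_le0; last by lra.
by rewrite mul0r subr_eq0 p0 => /eqP.
Qed.

Lemma phiK_ge0 t : 0 <= phiK t.
Proof.
have [t0|t0] := leP t (- 2^-1); first by rewrite phiK_eq0.
by rewrite -(phiK_eq0 (lexx _)) phiK_ndecr// ltW.
Qed.

(** [phiK t - phiK (- t) - t] has derivative zero because [lamK (1/2 + t) + lamK (1/2 - t) = 1], and
    it vanishes at [0]. For the cells this means that where [|u| + |v| <= 3/2] the set D is given by
    [|v| <= 1]. *)
Lemma phiK_id t : 2^-1 <= t -> phiK t = t.
Proof.
move=> t0.
have dN (x : K) : is_derive x 1 (fun x : K => - x) (-1).
  exact: is_deriveN (is_derive_id x (1 : K)).
have d (x : K) : is_derive x 1 (fun x => phiK x - phiK (- x) - x) 0.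
  have d2 := @is_derive1_comp K phiK (fun x => - x) x _ _ (is_derive_phiK (- x)) (dN x).
  apply: (is_derive_eq (is_deriveB (is_deriveB (is_derive_phiK x) d2) (is_derive_id x 1))).
  rewrite mulrN1 opprK.
  have -> : 2^-1 - x = 1 - (2^-1 + x) by field.
  by rewrite lamK_sym subrr.
have := @is_derive_0_is_cst K _ t 0 d; rewrite oppr0 subrr addr0.
by rewrite [phiK (- t)]phiK_eq0 ?lerN2// subr0 => /eqP; rewrite subr_eq0 => /eqP.
Qed.

End bumps.

#[global] Opaque flat lamK phiK.

(** * Weights for Seeley's reflection *)

Section weights.
Context (K : realType).
Implicit Types (l : seq (K * K)) (p : K * K).

(** A list of pairs [(a, b)] stands for the operator sending [G] to the sum of the functions
    [a * G (- b s)] of [s]; [moment i] is the factor it applies to the [i]-th derivative at [0]. *)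
Definition moment i l : K := \sum_(p <- l) p.1 * (- p.2) ^+ i.
Definition abs_moment i l : K := \sum_(p <- l) `|p.1| * `|p.2| ^+ i.

Lemma moment_cat i l l' : moment i (l ++ l') = moment i l + moment i l'.
Proof. by rewrite /moment big_cat. Qed.

Definition dilate (c B : K) l := [seq (c * p.1, B * p.2) | p <- l].

Lemma moment_dilate c B i l : moment i (dilate c B l) = c * B ^+ i * moment i l.
Proof.
rewrite /moment big_map mulr_sumr; apply: eq_bigr => p _ /=.
by rewrite -mulrN exprMn; ring.
Qed.

Lemma abs_moment_dilate c B i l :
  abs_moment i (dilate c B l) = `|c| * `|B| ^+ i * abs_moment i l.
Proof.
rewrite /abs_moment big_map mulr_sumr; apply: eq_bigr => p _ /=.
by rewrite !normrM exprMn; ring.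
Qed.

(** Passing from [N] to [N.+1] multiplies [moment j] by [2^j - 2^N], which kills exactly the order
    [j = N]. All nodes are powers of two. *)
Fixpoint vanishing N : seq (K * K) :=
  if N is N'.+1 then dilate 1 2 (vanishing N') ++ dilate (- 2 ^+ N') 1 (vanishing N')
  else [:: (1, 1)].

Lemma moment_vanishing N j :
  moment j (vanishing N.+1) = (2 ^+ j - 2 ^+ N) * moment j (vanishing N).
Proof. by rewrite /= moment_cat !moment_dilate expr1n; ring. Qed.

Lemma moment_vanishing0 N j : (j < N)%N -> moment j (vanishing N) = 0.
Proof.
elim: N => // N IH; rewrite ltnS leq_eqVlt moment_vanishing => /predU1P[->|/IH ->].
  by rewrite subrr mul0r.
by rewrite mulr0.
Qed.

Lemma moment_vanishing_neq0 N j : (N <= j)%N -> moment j (vanishing N) != 0.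
Proof.
elim: N j => [|N IH] j Nj.
  by rewrite /moment big_seq1 mul1r signr_eq0.
rewrite moment_vanishing mulf_neq0 ?IH 1?ltnW// subr_eq0.
by rewrite gt_eqF// ltr_eXn2l// ltr1n.
Qed.

Lemma vanishing_ge1 N p : p \in vanishing N -> 1 <= p.2.
Proof.
elim: N p => [|N IH] p /=; first by rewrite inE => /eqP ->.
rewrite mem_cat => /orP[] /mapP[q /IH q1 ->] /=; last by rewrite mul1r.
by rewrite (le_trans q1)// ler_peMl ?ler1n// (le_trans _ q1).
Qed.

Lemma abs_moment_ge0 i l : 0 <= abs_moment i l.
Proof. by apply: sumr_ge0 => p _; rewrite mulr_ge0// exprn_ge0. Qed.

(** Rescale [vanishing N] by a large [B] and normalise the moment of order [N] to [e]: absolute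
    moments of order [j < N] then shrink like [B^(j - N)]. *)
Lemma block_ex N (e beta delta : K) : 0 < delta ->
  exists l, [/\ forall p, p \in l -> beta <= p.2,
    forall j, (j < N)%N -> moment j l = 0, moment N l = e &
    forall j, (j < N)%N -> abs_moment j l <= delta].
Proof.
move=> d0; set m := moment N (vanishing N).
have m0 : m != 0 by exact: moment_vanishing_neq0.
pose S : K := \sum_(j < N) abs_moment j (vanishing N).
have S0 : 0 <= S by apply: sumr_ge0 => j _; exact: abs_moment_ge0.
(* The summands ensure in turn [B >= 1], nodes at least [beta], and lower absolute moments at most
   [delta]. *)
pose B := 1 + `|beta| + `|e / m| * S / delta.
have Q0 : 0 <= `|e / m| * S / delta by rewrite divr_ge0 ?mulr_ge0// ltW.
have B1 : 1 <= B by rewrite /B -addrA lerDl addr_ge0.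
have B0 : 0 < B by rewrite (lt_le_trans _ B1).
exists (dilate (e / (B ^+ N * m)) B (vanishing N)); split.
- move=> p /mapP[q /vanishing_ge1 q1 ->] /=.
  rewrite (@le_trans _ _ B)//; last by rewrite ler_peMr// ltW.
  rewrite (le_trans (ler_norm _))// /B addrAC lerDr addr_ge0//.
- by move=> j jN; rewrite moment_dilate moment_vanishing0// mulr0.
- rewrite moment_dilate -/m; field.
  by rewrite m0 expf_neq0// gt_eqF.
- move=> j jN; rewrite abs_moment_dilate.
  have -> : `|e / (B ^+ N * m)| * `|B| ^+ j = `|e / m| * B ^- (N - j).
    rewrite [`|B|]gtr0_norm// [B ^+ N * m]mulrC invfM mulrA normrM -mulrA; congr (_ * _).
    rewrite gtr0_norm ?invr_gt0 ?exprn_gt0// -{1}(subnK (ltnW jN)) exprD invfM -mulrA.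
    by rewrite mulVf ?mulr1// expf_neq0// gt_eqF.
  have BV : B ^- (N - j) <= B^-1.
    by rewrite lef_pV2 ?posrE ?exprn_gt0// ler_eXnr// subn_gt0.
  have VS : abs_moment j (vanishing N) <= S.
    rewrite /S (bigD1 (Ordinal jN))//= lerDl sumr_ge0// => i _; exact: abs_moment_ge0.
  apply: (@le_trans _ _ (`|e / m| * B^-1 * S)).
    by rewrite ler_pM ?abs_moment_ge0 ?mulr_ge0 ?ler_wpM2l// invr_ge0 exprn_ge0// ltW.
  rewrite mulrAC ler_pdivrMr// -ler_pdivrMl// mulrC /B lerDr.
  by rewrite addr_ge0.
Qed.

(* Weights for Seeley's extension operator: [\sum a (-b)^i = 1] for every [i]. *)
Lemma seeley_weights : exists w : nat -> seq (K * K),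
  [/\ forall N p, p \in w N -> (N.+2)%:R <= p.2,
      forall i N, (i < N)%N -> \sum_(k < N) moment i (w k) = 1 &
      forall i, exists C, forall N, \sum_(k < N) abs_moment i (w k) <= C].
Proof.
have d0 N : 0 < 2^-1 ^+ N :> K by rewrite exprn_gt0 // invr_gt0.
have /choice[b Hb] : forall Ne : nat * K, exists l,
    [/\ forall p, p \in l -> (Ne.1.+2)%:R <= p.2,
    forall j, (j < Ne.1)%N -> moment j l = 0, moment Ne.1 l = Ne.2 &
    forall j, (j < Ne.1)%N -> abs_moment j l <= 2^-1 ^+ Ne.1].
  by move=> [N e]; exact: block_ex.
(* Block [N] corrects the [N]-th moment of the preceding blocks to [1] and leaves the lower ones
   alone. Its absolute moments of order below [N] are at most [2^-N], so their sums over the blocks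
   stay bounded. *)
pose fix W N := if N is N'.+1 then W N' ++ b (N', 1 - moment N' (W N')) else [::].
pose w N := b (N, 1 - moment N (W N)).
have WE i N : moment i (W N) = \sum_(k < N) moment i (w k).
  elim: N => [|N IH]; first by rewrite big_ord0 /moment big_nil.
  by rewrite big_ord_recr /= -IH moment_cat.
exists w; split.
- by move=> N p; have [+ _ _ _] := Hb (N, 1 - moment N (W N)); exact.
- move=> i N; rewrite -WE; elim: N => // N IH; rewrite ltnS leq_eqVlt /= moment_cat.
  have [_ H1 H2 _] := Hb (N, 1 - moment N (W N)).
  by move=> /predU1P[->|iN]; [rewrite H2 addrC subrK|rewrite H1 ?addr0 ?IH].
- move=> i; exists (\sum_(k < i.+1) abs_moment i (w k) + 2) => N.
  have H k : \sum_(i.+1 <= j < i.+1 + k) abs_moment i (w j) <= 2 - 2^-1 ^+ k :> K.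
    elim: k => [|k IH].
      by rewrite addn0 big_geq// expr0; lra.
    rewrite addnS big_nat_recr ?leq_addr//=.
    have [_ _ _ /(_ i)] := Hb ((i.+1 + k)%N, 1 - moment (i.+1 + k) (W (i.+1 + k)%N)).
    rewrite /= leq_addr => /(_ isT) H2.
    apply: le_trans (lerD IH H2) _.
    have : 2^-1 ^+ (i.+1 + k) <= 2^-1 ^+ k.+1 :> K.
      by rewrite ler_wiXn2l ?invr_ge0 ?invf_le1 ?ler1n// addSn ltnS leq_addl.
    rewrite exprS => H3; lra.
  have [Ni|iN] := leqP N i.+1.
    rewrite -(big_mkord xpredT (fun k => abs_moment i (w k))).
    rewrite -(big_mkord xpredT (fun k => abs_moment i (w k))).
    rewrite [in leRHS](big_cat_nat (leq0n N) Ni)//= -addrA lerDl addr_ge0//.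
    by apply: sumr_ge0 => k _; exact: abs_moment_ge0.
  rewrite -(big_mkord xpredT (fun k => abs_moment i (w k))).
  rewrite (big_cat_nat (leq0n i.+1) (ltnW iN))//= big_mkord lerD2l.
  have := H (N - i.+1)%N; rewrite subnKC 1?ltnW// => /le_trans; apply.
  by rewrite lerBlDr lerDl ltW.
Qed.

End weights.

Lemma near_dist_le (K : realType) (W : normedModType K) (x : W) (e : K) : 0 < e ->
  \forall y \near x, `|x - y| <= e.
Proof. by move=> e0; exact: (continuous_distP id x).1 (@cvg_id _ _) _ e0. Qed.

(** * Integrals along the first coordinate and Hadamard's lemma *)

Section cylinder.
Context (K : realType) (m : nat).
Notation V := 'rV[K]_m.+1.
Local Notation e0 := (stdv K (ord0 : 'I_m.+1)).
Implicit Types (z y : V) (G : V -> K).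

Definition setc (t : K) z : V := \row_j if j == ord0 then t else z ord0 j.

Lemma setc0 t z : setc t z ord0 ord0 = t.
Proof. by rewrite mxE eqxx. Qed.

Lemma setc_line t z : setc t z = setc 0 z + t *: e0.
Proof.
apply/rowP => j; rewrite !mxE eqxx /=; case: eqVneq => _ /=.
  by rewrite mulr1 add0r.
by rewrite mulr0 addr0.
Qed.

Lemma setc_id z : setc (z ord0 ord0) z = z.
Proof. by apply/rowP => j; rewrite mxE; case: eqVneq => // ->. Qed.

Lemma setcK s t z : setc s (setc t z) = setc s z.
Proof. by apply/rowP => j; rewrite !mxE; case: eqVneq. Qed.

Lemma setc_add_ne t z (h : K) j : j != ord0 ->
  setc t (z + h *: stdv K j) = setc t z + h *: stdv K j.
Proof.
move=> j0; apply/rowP => i; rewrite !mxE eqxx/=; case: eqVneq => // ->.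
by rewrite eq_sym (negbTE j0) mulr0 addr0.
Qed.

Lemma setc_add0 t z (h : K) : setc t (z + h *: e0) = setc t z.
Proof.
apply/rowP => i; rewrite !mxE eqxx/=; case: eqVneq => // i0.
by rewrite mulr0 addr0.
Qed.

Lemma setc_dist t z y : `|setc t z - setc t y| <= `|z - y|.
Proof.
rewrite [leLHS]/Num.Def.normr/= mx_normrE (bigmax_le _ (normr_ge0 _))// => -[i j] _ /=.
rewrite !mxE; case: eqVneq => _; first by rewrite subrr normr0.
by have := coord_ler_norm (z - y) j; rewrite !mxE.
Qed.

Context (O : set V).
Hypothesis oO : open O.
Hypothesis cylO : forall z t, O z -> O (setc t z).

Lemma is_derive_setc G z (t : K) : smooth O G -> O z ->
  is_derive t 1 (fun s => G (setc s z)) ('D_e0 G (setc t z)).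
Proof.
move=> sG Oz.
have := (is_derive_lineP G (setc 0 z) e0 t ('D_e0 G (setc t z))).1.
rewrite -setc_line => /(_ (smooth_is_derive e0 sG (cylO t Oz))).
rewrite (_ : (fun _ => _) = (fun s => G (setc s z)))//.
by apply/funext => s; rewrite [in RHS]setc_line.
Qed.

Lemma is_derive_setcM G z (t a : K) : smooth O G -> O z ->
  is_derive t 1 (fun s => G (setc (s * a) z)) ('D_e0 G (setc (t * a) z) * a).
Proof.
move=> sG Oz; have dl : is_derive t 1 (fun t : K => t * a) a.
  have := is_deriveM (is_derive_id t (1 : K)) (is_derive_cst a t (1 : K)).
  by move=> H; apply: (is_derive_eq H); rewrite scaler0 add0r [_ *: _]mulr1.
exact: (@is_derive1_comp K (fun u : K => G (setc u z)) (fun t : K => t * a) t _ _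
    (is_derive_setc _ sG Oz) dl).
Qed.

(** A maximum over a compact slab around [z]. Uniformity in [t] is what domination under the
    integral sign and bounds on reflected values require. *)
Lemma cylinder_bounded G z (T : K) : smooth O G -> O z -> 0 <= T ->
  exists M, 0 <= M /\ \forall y \near z, forall t, `|t| <= T -> `|G (setc t y)| <= M.
Proof.
move=> sG Oz T0.
have /nbhs_ballP[r /= r0 rO] := open_near oO Oz.
(* The second condition compares [w] with [z] in the other coordinates only; the slab lies in [O]
   because [O] is a cylinder. *)
pose A := [set w : V | `|w ord0 ord0| <= T] `&`
          [set w : V | `|setc (z ord0 ord0) w - z| <= r / 2].
have AO : A `<=` O.
  move=> w [_ /= H]; rewrite -(setc_id w) -(setcK _ (z ord0 ord0)); apply: cylO; apply: rO.
  by rewrite -ball_normE /ball_/= distrC (le_lt_trans H)// ltr_pdivrMr// mulr2n mulrDr mulr1 ltrDl.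
have cA : compact A.
  apply: bounded_closed_compact.
    exists (T + `|z| + r); split; first exact: num_real.
    move=> M HM w [/= w0 wz]; apply: le_trans (ltW HM).
    have P0 : 0 <= T + `|z| + r by rewrite !addr_ge0// ltW.
    rewrite [leLHS]/Num.Def.normr/= mx_normrE bigmax_le// => -[i j] _ /=.
    rewrite (ord1 i); have [->|j0] := eqVneq j ord0.
      by rewrite (le_trans w0)// -addrA lerDl addr_ge0// ltW.
    have := coord_ler_norm (setc (z ord0 ord0) w - z) j; rewrite !mxE (negbTE j0) => H.
    rewrite -[w ord0 j](subrK (z ord0 j)) (le_trans (ler_normD _ _))//.
    rewrite addrC -addrA ler_wpDl// lerD ?coord_ler_norm//.
    rewrite (le_trans H)// (le_trans wz)//; lra.
  apply: closedI.
    apply: (@closed_comp _ _ (fun w : V => `|w ord0 ord0|) [set x | x <= T]) => //.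
      by move=> w _; apply: continuous_comp; [exact: continuous_coord|exact: norm_continuous].
  apply: (@closed_comp _ _ (fun w : V => `|setc (z ord0 ord0) w - z|) [set x | x <= r / 2]) => //.
  move=> w _; apply/continuous_distP => e e0'.
  have := near_dist_le (w : V) e0'.
  apply: filterS => y; apply: le_trans; rewrite (le_trans (ler_dist_dist _ _))//.
  by rewrite opprB addrA subrK setc_dist.
have A0 : A !=set0.
  exists (setc 0 z); split => /=; first by rewrite setc0 normr0.
  by rewrite setcK setc_id subrr normr0 divr_ge0// ltW.
have [] := @EVT_max_rV K _ (fun w => `|G w|) A A0 cA.
  apply: continuous_in_subspaceT => w /set_mem /AO Ow.
  by apply: continuous_comp; [exact: smooth_continuous sG Ow|exact: norm_continuous].
move=> c cA' H; exists `|G c|; split => //.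
near=> y => t tT; apply: H; rewrite inE; split => /=; first by rewrite setc0.
rewrite setcK -{2}(setc_id z) (le_trans (setc_dist _ _ _))// distrC.
by near: y; apply: (@cvgr_dist_le _ _ _ _ _ id) => //; rewrite divr_gt0.
Unshelve. all: by end_near. Qed.

Local Notation mu := (@lebesgue_measure K).

(** The integral remainder of Hadamard's lemma. A derivative in the first coordinate brings out a
    factor [t], so with the weight [t^n] the family over all [n] is stable under partial
    derivatives. *)
Definition average n G z : K :=
  \int[mu]_(t in `[0, 1]) (t ^+ n * G (setc (t * z ord0 ord0) z)).

Lemma average_continuous n G z : smooth O G -> O z ->
  continuous (fun t : K => t ^+ n * G (setc (t * z ord0 ord0) z)).
Proof.
move=> sG Oz t.
have c2 : {for t, continuous (fun t : K => G (setc (t * z ord0 ord0) z))}.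
  have [d _] := is_derive_setcM t (z ord0 ord0) sG Oz.
  by move/derivable1_diffP/differentiable_continuous : d.
by apply: cvgM; [exact: exprn_continuous|exact: c2].
Qed.

Lemma average_le n G z (M : K) : smooth O G -> O z ->
  (forall t, `|t| <= `|z ord0 ord0| -> `|G (setc t z)| <= M) -> `|average n G z| <= M.
Proof.
move=> sG Oz HM.
have iG := continuous_itv_integrable 0 1 (@average_continuous n G z sG Oz).
rewrite (le_trans (le_normr_Rintegral _ iG))//.
have iM : mu.-integrable `[0, 1] (EFin \o cst M).
  by apply: continuous_itv_integrable => x; exact: cvg_cst.
rewrite (@le_trans _ _ (\int[mu]_(t in `[0, 1]) M))//.
  apply: le_Rintegral => //.
    by move: iG => /integrable_norm; congr (mu.-integrable _ _).
  move=> t /=; rewrite in_itv/= => /andP[t0 t1].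
  rewrite normrM -[leRHS]mul1r ler_pM//.
    by rewrite normrX ger0_norm// exprn_ile1.
  by apply: HM; rewrite normrM ger0_norm// ler_piMl.
rewrite Rintegral_cst//= lebesgue_measure_itv /= lte_fin ltr01 oppr0 adde0 /=.
by rewrite mulr1.
Qed.

Lemma is_derive_average n G z j : smooth O G -> O z ->
  is_derive z (stdv K j) (average n G)
    (average (if j == ord0 then n.+1 else n) (fun y => 'D_(stdv K j) G y) z).
Proof.
move=> sG Oz; set e := stdv K j; set n' := if _ then _ else _.
have sD : smooth O (fun y => 'D_e G y) by exact: smooth_derive.
(* The speed at which the argument of the integrand moves when [z] moves along [e]. *)
pose c (t : K) : K := if j == ord0 then t else 1.
have ct (t : K) : t ^+ n * c t = t ^+ n'.
  by rewrite /c /n'; case: ifP => _; rewrite ?exprSr// mulr1.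
have shift (t s : K) :
    setc (t * (z + s *: e) ord0 ord0) (z + s *: e) = setc (t * z ord0 ord0) z + (s * c t) *: e.
  rewrite /c /e; have [->|j0] := eqVneq j ord0.
    rewrite setc_add0 !mxE eqxx /= mulr1 mulrDr setc_line scalerDl addrA -setc_line.
    by rewrite [t * s]mulrC.
  by rewrite setc_add_ne// mulr1 !mxE eq_sym (negbTE j0) /= mulr0 addr0.
(* [M] will dominate the differentiated integrand: for [|s| < 1] the first coordinate of
   [z + s *: e] is bounded by that of [z] plus one. *)
have [M [M0 /nbhs_ballP[r /= r0 rH]]] := cylinder_bounded (T := `|z ord0 ord0| + 1) sD Oz
  (addr_ge0 (normr_ge0 _) ler01).
have /nbhs_ballP[r' /= r'0 rO] := open_near oO Oz.
pose d := Num.min 1 (Num.min r r').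
have d0 : 0 < d by rewrite !lt_min ltr01 r0 r'0.
have ne : `|e| <= 1.
  rewrite /e [leLHS]/Num.Def.normr/= mx_normrE bigmax_le// => -[i k] _ /=.
  by rewrite !mxE; case: andP; rewrite ?normr1 ?normr0.
have near_z (s : K) : `|s| < d -> [/\ `|s| < 1, ball z r (z + s *: e) & ball z r' (z + s *: e)].
  rewrite !lt_min => /and3P[s1 sr sr'].
  have H : `|z - (z + s *: e)| <= `|s|.
    by rewrite opprD addNKr normrN normrZ ler_piMr.
  by split => //; rewrite -ball_normE /ball_/=; exact: le_lt_trans H _.
have Os (s : K) : `|s| < d -> O (z + s *: e) by move=> /near_z[_ _]; exact: rO.
pose f (s t : K) : K := t ^+ n * G (setc (t * (z + s *: e) ord0 ord0) (z + s *: e)).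
have df (s t : K) : `|s| < d -> is_derive s 1 (f ^~ t)
    (t ^+ n' * 'D_e G (setc (t * (z + s *: e) ord0 ord0) (z + s *: e))).
  move=> sd.
  have Op : O (setc (t * (z + s *: e) ord0 ord0) (z + s *: e)) by exact/cylO/Os.
  have dG := smooth_is_derive e sG Op; rewrite shift in dG.
  have dG' := (is_derive_lineP G _ e _ _).1 dG.
  have dc : is_derive s 1 (fun s : K => s * c t) (c t).
    have := is_deriveM (is_derive_id s (1 : K)) (is_derive_cst (c t) s (1 : K)).
    by move=> H; apply: (is_derive_eq H); rewrite scaler0 add0r [_ *: _]mulr1.
  have := @is_derive1_comp K (fun u : K => G (setc (t * z ord0 ord0) z + u *: e))
    (fun s : K => s * c t) s _ _ dG' dc.
  move=> /(is_deriveZ (t ^+ n)) H.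
  rewrite (_ : f ^~ t = (t ^+ n \*: ((fun s0 : K => G (setc (t * z ord0 ord0) z + s0 *: e)) \o
     (fun s0 : K => s0 * c t)))); last by apply/funext => u; rewrite /f shift.
  apply: (is_derive_eq H); rewrite -shift -ct.
  by rewrite [_ *: _]mulrA mulrAC.
have I0 : `](- d), d[%classic (0 : K) by rewrite /= in_itv/= oppr_lt0 d0.
have Id (s : K) : `](- d), d[%classic s -> `|s| < d by rewrite /= in_itv/= ltr_norml.
have intf (s : K) : `](- d), d[%classic s -> mu.-integrable `[0, 1] (EFin \o f s).
  by move=> /Id /Os Oz'; apply: continuous_itv_integrable; exact: average_continuous.
have derf (s t : K) : `](- d), d[%classic s -> `[0, 1]%classic t -> derivable (f ^~ t) s 1.
  by move=> /Id sd _; have [] := df s t sd.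
have bnd (s t : K) : `](- d), d[%classic s -> `[0, 1]%classic t ->
    `|partial1of2 f s t| <= cst M t.
  move=> /Id sd; rewrite /= in_itv/= => /andP[t0 t1]; rewrite partial1of2E.
  have [_ ->] := df s t sd; rewrite normrM -[leRHS]mul1r ler_pM//.
    by rewrite normrX ger0_norm// exprn_ile1.
  have [s1 sr _] := near_z s sd; apply: rH => //.
  rewrite normrM ger0_norm// (@le_trans _ _ `|(z + s *: e) ord0 ord0|) ?ler_piMl//.
  rewrite [(z + _) _ _]mxE [(s *: e) _ _]mxE (le_trans (ler_normD _ _))// lerD2l normrM.
  rewrite -[leRHS]mulr1; apply: ler_pM => //; first exact: ltW.
  exact: le_trans (coord_ler_norm e ord0) ne.
have iM : mu.-integrable `[0, 1] (EFin \o cst M).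
  by apply: continuous_itv_integrable => x; exact: cvg_cst.
have mB : measurable (`[0, 1]%classic : set K) by exact: measurable_itv.
have cM (t : K) : 0 <= cst M t by [].
have dI := @derivable_under_integral K _ _ mu f _ mB 0 (- d) d I0 intf derf (cst M) cM iM bnd.
have DI := @differentiation_under_integral K _ _ mu f _ mB 0 (- d) d I0 intf derf (cst M) cM iM bnd.
have Hz : is_derive (0 : K) 1 (fun s => average n G (z + s *: e))
    (average n' (fun y => 'D_e G y) z).
  apply: DeriveDef; first exact: dI.
  rewrite -derive1E; apply: etrans DI _.
  apply: eq_Rintegral => t /set_mem tB; rewrite partial1of2E.
  by have [_ ->] := df 0 t (Id _ I0); rewrite scale0r addr0.
have := (is_derive_lineP (average n G) z e 0 _).2 Hz.
by rewrite scale0r addr0.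
Unshelve. all: by end_near. Qed.

Lemma smooth_average n G : smooth O G -> smooth O (average n G).
Proof.
move=> sG.
apply: (@smooth_coindW K _ O (fun F => exists n (G : V -> K), smooth O G /\ F = average n G)) => //.
- move=> _ {n G sG}[n [G [sG ->]]] z Oz.
  have [M [M0 HM]] := cylinder_bounded (T := `|z ord0 ord0| + 1) sG Oz
    (addr_ge0 (normr_ge0 _) ler01).
  exists M; near=> y; apply: average_le => //; first by near: y; exact: open_near.
  move=> t ty; have H : forall t, `|t| <= `|z ord0 ord0| + 1 -> `|G (setc t y)| <= M.
    by near: y.
  apply: H; rewrite (le_trans ty)// -[y _ _](subrK (z ord0 ord0)) addrC.
  rewrite (le_trans (ler_normD _ _))// lerD2l distrC; near: y.
  exact: (continuous_distP _ _).1 (@continuous_coord K _ ord0 z) _ ltr01.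
- move=> _ j {n G sG}[n [G [sG ->]]].
  exists (average (if j == ord0 then n.+1 else n) (fun y => 'D_(stdv K j) G y)).
    apply: lspanW; exists (if j == ord0 then n.+1 else n), (fun y => 'D_(stdv K j) G y).
    by split; [exact: smooth_derive|].
  by move=> z Oz; exact: is_derive_average.
by exists n, G.
Unshelve. all: by end_near. Qed.

(** The fundamental theorem on the segment from [setc 0 z] to [z], parametrised by [[0, 1]] so that
    the quotient depends smoothly on [z]. *)
Lemma hadamard G z : smooth O G -> O z ->
  G z - G (setc 0 z) = z ord0 ord0 * average 0 (fun y => 'D_e0 G y) z.
Proof.
move=> sG Oz; pose F t := G (setc (t * z ord0 ord0) z).
pose f (t : K) := z ord0 ord0 * (t ^+ 0 * 'D_e0 G (setc (t * z ord0 ord0) z)).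
have cf0 := @average_continuous 0 _ z (smooth_derive e0 sG) Oz.
have cf : continuous f by move=> t; apply: cvgM; [exact: cvg_cst|exact: cf0].
have dF (t : K) : is_derive t 1 F (f t).
  have := is_derive_setcM t (z ord0 ord0) sG Oz.
  by move=> H; apply: (is_derive_eq H); rewrite /f expr0 mul1r mulrC.
have cF : continuous F.
  by move=> t; have [/derivable1_diffP/differentiable_continuous] := dF t.
have LR : derivable_oo_LRcontinuous F 0 1.
  split; last 2 first.
  - exact: cvg_at_right_filter (cF 0).
  - exact: cvg_at_left_filter (cF 1).
  by move=> t _; have [] := dF t.
have F' : {in `]0, 1[, F^`()%classic =1 f}.
  by move=> t _; rewrite derive1E; have [_ ->] := dF t.
have E := continuous_FTC2 ltr01 (continuous_subspaceT cf) LR F'.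
have : \int[mu]_(t in `[0, 1]) f t = F 1 - F 0 by rewrite /Rintegral E.
rewrite /F mul1r mul0r setc_id => <-; rewrite /f RintegralZl//.
exact: continuous_itv_integrable.
Qed.

End cylinder.

(** * Seeley's extension of even functions *)

Section seeley.
Context (K : realType) (m : nat).
Notation V := 'rV[K]_m.+1.
Local Notation e0 := (stdv K (ord0 : 'I_m.+1)).
Local Notation "z '._0'" := (z ord0 ord0) (at level 2, format "z '._0'").
Implicit Types (z y : V) (G : V -> K).

Lemma is_derive_bigsum (W : normedModType K) (I : Type) (r : seq I) (h : I -> W -> K)
    (dh : I -> K) (x v : W) :
  (forall i, is_derive x v (h i) (dh i)) ->
  is_derive x v (fun u : W => \sum_(i <- r) h i u) (\sum_(i <- r) dh i).
Proof.
move=> H; elim: r => [|i r IH].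
  by rewrite big_nil; under eq_fun do rewrite big_nil; exact: is_derive_cst.
rewrite big_cons; under eq_fun do rewrite big_cons.
exact: is_deriveD.
Qed.

Context (O : set V).
Hypothesis oO : open O.
Hypothesis cylO : forall z t, O z -> O (setc t z).

(** Evenness makes [G] a function of the square of the first coordinate; the bounded support turns
    the infinite reflection into a finite sum away from [0]. *)
Definition even_supp G := [/\ smooth O G,
  forall z, O z -> G (setc (- z._0) z) = G z &
  forall z, O z -> 1 < `|z._0| -> G z = 0].

Lemma near_line z (e : V) : O z -> \forall s \near (0 : K), O (z + s *: e).
Proof.
move=> Oz.
have c : {for (0 : K), continuous (fun s : K => z + s *: e)}.
  by apply: cvgD; [exact: cvg_cst|exact: scalel_continuous].
have := c O; rewrite /= scale0r addr0; apply.
exact: open_near.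
Qed.

Lemma even_supp_derive0 G v z : even_supp G -> O z -> 1 < `|z._0| -> 'D_v G z = 0.
Proof.
move=> [sG _ G0] Oz z1.
have H1 : \forall x \near (z._0 : K), 1 < `|x|.
  exact: (@norm_continuous _ _ z._0) _ (near_gt z1).
have H2 : \forall y \near z, 1 < `|(y : V) ord0 ord0| by exact: (@continuous_coord K _ ord0 z) _ H1.
have E : \forall y \near z, 0 = G y.
  near=> y; apply/esym/G0; near: y; [exact: open_near|exact: H2].
by rewrite -(near_eq_derive _ E) derive_cst.
Unshelve. all: by end_near. Qed.

Lemma even_supp_partial G j : j != ord0 -> even_supp G ->
  even_supp (fun z => 'D_(stdv K j) G z).
Proof.
move=> j0 eG; have [sG evG G0] := eG; split; first exact: smooth_derive.
  move=> z Oz; set e := stdv K j.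
  have dz := smooth_is_derive e sG Oz.
  have := (is_derive_lineP G z e 0 ('D_e G z)).1; rewrite scale0r addr0 => /(_ dz) d1.
  have E : \forall s \near (0 : K), G (z + s *: e) = G (setc (- z._0) z + s *: e).
    have := near_line e Oz; apply: filterS => s Os.
    rewrite -setc_add_ne// -(evG _ Os) !mxE.
    by rewrite /e [ord0 == j]eq_sym (negbTE j0) andbF mulr0 addr0.
  have d2 := near_eq_is_derive E d1.
  have := (is_derive_lineP G (setc (- z._0) z) e 0 ('D_e G z)).2; rewrite scale0r addr0.
  by move=> /(_ d2) [_ ->].
by move=> z Oz z1; exact: even_supp_derive0.
Qed.

Lemma even_supp_odd G z (t : K) : even_supp G -> O z ->
  'D_e0 G (setc (- t) z) = - 'D_e0 G (setc t z).
Proof.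
move=> [sG evG _] Oz.
have dN : is_derive t 1 (fun s : K => - s) (-1) by exact: is_deriveN (is_derive_id t (1 : K)).
have d := @is_derive1_comp K (fun s => G (setc s z)) (fun s => - s) t _ _
  (is_derive_setc cylO (- t) sG Oz) dN.
have E : (fun s => G (setc s z)) \o (fun s => - s) = fun s => G (setc s z).
  apply/funext => s /=; have := evG (setc s z) (cylO s Oz).
  by rewrite setc0 setcK.
rewrite E in d; have [_ D1] := d; have [_ D2] := is_derive_setc cylO t sG Oz.
by rewrite -D2 D1 mulrN1 opprK.
Qed.

(** The derivative of [G] with respect to the square of the first coordinate, that is the first
    partial divided by twice that coordinate. As an integral of the second derivative it is smooth
    across [0]. *)
Definition quot G z : K := 2^-1 * average 0 (fun y => 'D_e0 (fun x => 'D_e0 G x) y) z.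

Lemma quotE G z : even_supp G -> O z -> 'D_e0 G z = 2 * z._0 * quot G z.
Proof.
move=> eG Oz; have [sG _ _] := eG.
have := hadamard cylO (smooth_derive e0 sG) Oz.
have := even_supp_odd 0 eG Oz; rewrite oppr0 => /eqP.
rewrite -subr_eq0 opprK -mulr2n mulrn_eq0/= => /eqP ->.
by rewrite subr0 => ->; rewrite /quot; field.
Qed.

(** Evenness and support are read off [quotE] by dividing by twice the first coordinate; where that
    is [0], evenness is trivial and the support condition is void. *)
Lemma even_supp_quot G : even_supp G -> even_supp (quot G).
Proof.
move=> eG; have [sG evG G0] := eG; split.
- apply: (smoothZ oO); apply: (smooth_average oO cylO).
  by apply: smooth_derive; exact: smooth_derive.
- move=> z Oz; have [z0|z0] := eqVneq z._0 0.
    by rewrite z0 oppr0 -z0 setc_id.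
  have := quotE eG (cylO (- z._0) Oz).
  rewrite (even_supp_odd _ eG Oz) setc_id (quotE eG Oz) setc0 mulrN mulNr => /eqP.
  rewrite eqr_opp => /eqP /mulfI -> //.
  by rewrite mulf_neq0// pnatr_eq0.
- move=> z Oz z1; have := quotE eG Oz; rewrite (even_supp_derive0 _ eG Oz z1).
  move/esym/eqP; rewrite mulf_eq0 => /orP[|/eqP//].
  rewrite mulf_eq0 pnatr_eq0/= => /eqP z0; move: z1.
  by rewrite z0 normr0 ltr10.
Qed.

Context (w : nat -> seq (K * K)).
Hypothesis w_ge : forall N p, p \in w N -> (N.+2)%:R <= p.2.
Hypothesis w_moment : forall i N, (i < N)%N -> \sum_(k < N) moment i (w k) = 1.
Hypothesis w_abs_moment : forall i, exists C, forall N, \sum_(k < N) abs_moment i (w k) <= C.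

(** The reflected value at [s < 0]. Each derivative in [s] brings out one factor [- p.2], which the
    exponent [i] records. *)
Definition reflection i N G z (s : K) : K :=
  \sum_(k < N) \sum_(p <- w k) p.1 * (- p.2) ^+ i * G (setc (Num.sqrt (- p.2 * s)) z).

(** From block [N] on, the nodes [b] are at least [N + 2]; once [N |s| >= 1] they put [b |s|] beyond
    [1], out of the support. Truncating there loses nothing of the series. *)
Definition cutoff (s : K) := (Num.truncn `|s|^-1).+1.

Definition extend i G z : K :=
  if 0 <= z._0 then G (setc (Num.sqrt z._0) z) else reflection i (cutoff z._0) G z z._0.

Lemma cutoffP (s : K) : s != 0 -> 1 <= (cutoff s)%:R * `|s|.
Proof.
move=> s0; rewrite -ler_pdivrMr ?normr_gt0// div1r.
by rewrite ltW// /cutoff truncnS_gt.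
Qed.

Lemma far_eq0 G z (s b : K) N : even_supp G -> O z -> s < 0 -> 1 <= N%:R * `|s| ->
  N.+2%:R <= b -> G (setc (Num.sqrt (- b * s)) z) = 0.
Proof.
move=> [_ _ G0] Oz s0 Ns Nb; apply: G0; first exact: cylO.
rewrite setc0 ger0_norm ?sqrtr_ge0// -sqrtr1.
have s' : 0 < `|s| by rewrite normr_gt0 lt_eqF.
have H : 1 < - b * s.
  rewrite mulNr -mulrN -(ltr0_norm s0).
  apply: le_lt_trans Ns _; rewrite ltr_pM2r//; apply: lt_le_trans Nb.
  by rewrite ltr_nat.
by rewrite ltr_sqrt// (lt_trans ltr01).
Qed.

Lemma reflection_stable i N M G z s : even_supp G -> O z -> s < 0 -> 1 <= N%:R * `|s| ->
  (N <= M)%N -> reflection i M G z s = reflection i N G z s.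
Proof.
move=> eG Oz s0 Ns; elim: M => [|M IH]; first by rewrite leqn0 => /eqP ->.
rewrite leq_eqVlt => /predU1P[->//|]; rewrite ltnS => NM.
rewrite /reflection big_ord_recr /= -/(reflection i M G z s) IH//.
rewrite big1_seq ?addr0// => p /andP[_ pw].
rewrite (far_eq0 eG Oz s0 Ns) ?mulr0//.
by apply: le_trans (w_ge pw); rewrite ler_nat !ltnS.
Qed.

Lemma extend_ge0 i G z : 0 <= z._0 -> extend i G z = G (setc (Num.sqrt z._0) z).
Proof. by rewrite /extend => ->. Qed.

(** Any large enough truncation gives the same value, so a single [N] serves a whole half-line away
    from [0], where the extension becomes a fixed finite sum. *)
Lemma extend_lt0 i G z N : even_supp G -> O z -> z._0 < 0 -> 1 <= N%:R * `|z._0| ->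
  extend i G z = reflection i N G z z._0.
Proof.
move=> eG Oz z0 Nz; rewrite /extend leNgt z0 /=.
have cz : 1 <= (cutoff z._0)%:R * `|z._0| by apply: cutoffP; rewrite lt_eqF.
rewrite -(reflection_stable i eG Oz z0 cz (leq_maxl _ N)).
by rewrite (reflection_stable i eG Oz z0 Nz (leq_maxr _ _)).
Qed.

Lemma reflection_setc i N G z s t : reflection i N G (setc t z) s = reflection i N G z s.
Proof.
by apply: eq_bigr => k _; apply: eq_bigr => p _; rewrite setcK.
Qed.

Lemma w_gt0 N p : p \in w N -> 1 <= p.2.
Proof. by move=> /w_ge; apply: le_trans; rewrite ler1n. Qed.

Lemma even_supp_bounded G z : even_supp G -> O z ->
  exists M, 0 <= M /\ \forall y \near z, forall t : K, `|G (setc t y)| <= M.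
Proof.
move=> [sG _ G0] Oz; have [M [M0 HM]] := cylinder_bounded oO cylO sG Oz ler01.
exists M; split => //; near=> y => t.
have Oy : O y by near: y; exact: open_near.
have [t1|t1] := leP `|t| 1; last by rewrite G0 ?normr0// ?setc0//; exact: cylO.
have H : forall t, `|t| <= 1 -> `|G (setc t y)| <= M by near: y.
exact: H.
Unshelve. all: by end_near. Qed.

Lemma reflection_le i N (c : K) (F : K * K -> K) :
  0 <= c -> (forall k p, p \in w k -> `|F p| <= c) ->
  `|\sum_(k < N) \sum_(p <- w k) p.1 * (- p.2) ^+ i * F p|
    <= c * \sum_(k < N) abs_moment i (w k).
Proof.
move=> c0 H; rewrite (le_trans (ler_norm_sum _ _ _))// mulr_sumr ler_sum// => k _.
rewrite (le_trans (ler_norm_sum _ _ _))// mulr_sumr.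
rewrite !big_seq ler_sum// => p pw.
rewrite !normrM normrX normrN mulrC ler_wpM2r ?mulr_ge0 ?exprn_ge0//.
exact: H pw.
Qed.

Lemma extend_bounded i G z : even_supp G -> O z -> locally_bounded (extend i G) z.
Proof.
move=> eG Oz; have [M [M0 HM]] := even_supp_bounded eG Oz.
have [C HC] := w_abs_moment i.
have C0 : 0 <= C by apply: le_trans (HC 0%N); rewrite big_ord0.
exists (M + M * C); near=> y.
have H : forall t : K, `|G (setc t y)| <= M by near: y.
rewrite /extend; case: ifP => _; first by rewrite (le_trans (H _))// lerDl mulr_ge0.
apply: le_trans (_ : M * C <= _); last by rewrite lerDr.
rewrite (le_trans _ (ler_wpM2l M0 (HC (cutoff y._0))))//.
by apply: reflection_le => // k p _; exact: H.
Unshelve. all: by end_near. Qed.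

Lemma is_derive_extend_ne i G z j : j != ord0 -> even_supp G -> O z ->
  is_derive z (stdv K j) (extend i G) (extend i (fun y => 'D_(stdv K j) G y) z).
Proof.
move=> j0 eG Oz; have [sG _ _] := eG; set e := stdv K j.
have := (is_derive_lineP (extend i G) z e 0 (extend i (fun y => 'D_e G y) z)).2.
rewrite scale0r addr0; apply.
have d (r : K) : is_derive (0 : K) 1 (fun s : K => G (setc r z + s *: e)) ('D_e G (setc r z)).
  have := (is_derive_lineP G (setc r z) e 0 ('D_e G (setc r z))).1.
  by rewrite scale0r addr0; apply; exact: smooth_is_derive sG (cylO _ Oz).
have c0 (s : K) : (z + s *: e)._0 = z._0.
  by rewrite !mxE eq_sym (negbTE j0) andbF mulr0 addr0.
rewrite /extend; under eq_fun do rewrite c0.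
case: ifP => _.
  by under eq_fun do rewrite setc_add_ne//; exact: d.
rewrite /reflection.
apply: is_derive_bigsum => k; apply: is_derive_bigsum => p.
under eq_fun do rewrite setc_add_ne//.
exact: is_deriveZ (d _).
Qed.

Lemma is_derive_sqrt_quot G z (a s : K) : even_supp G -> O z -> 0 < a * s ->
  is_derive s 1 (fun u => G (setc (Num.sqrt (a * u)) z))
    (a * quot G (setc (Num.sqrt (a * s)) z)).
Proof.
move=> eG Oz as0; have [sG _ _] := eG.
have dl : is_derive s 1 (fun u : K => a * u) a.
  have := is_deriveZ a (is_derive_id s (1 : K)).
  by move=> H; apply: (is_derive_eq H); rewrite [_ *: _]mulr1.
have d1 := @is_derive1_comp K _ (fun u : K => a * u) s _ _ (is_derive1_sqrt as0) dl.
have d2 := @is_derive1_comp K (fun u => G (setc u z)) _ s _ _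
  (is_derive_setc cylO (Num.sqrt (a * s)) sG Oz) d1.
apply: (is_derive_eq d2).
have s0 : Num.sqrt (a * s) != 0 by rewrite gt_eqF ?sqrtr_gt0.
rewrite (quotE eG (cylO _ Oz)) setc0; field.
by [].
Qed.

(** One constant serves all [t >= 0] because the derivative vanishes beyond [|t| = 1]. *)
Lemma even_supp_lipschitz G z : even_supp G -> O z ->
  exists C, 0 <= C /\ forall t, 0 <= t -> `|G (setc t z) - G (setc 0 z)| <= C * t.
Proof.
move=> eG Oz; have [sG _ _] := eG.
have [M [M0 HM]] := cylinder_bounded oO cylO (smooth_derive e0 sG) Oz ler01.
exists M; split => // t; rewrite le_eqVlt => /predU1P[<-|t0].
  by rewrite subrr normr0 mulr0.
have [c [_ _ ->]] := MVT_derive (fun t => is_derive_setc cylO t sG Oz) t0.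
rewrite subr0 normrM (gtr0_norm t0) ler_pM2r//.
have [c1|c1] := leP `|c| 1; first exact: (nbhs_singleton HM).
by rewrite (even_supp_derive0 _ eG (cylO _ Oz)) ?normr0// setc0.
Qed.

(** As the moments of order [i] sum to [1], the deviation at [s < 0] is a weighted sum of
    differences [G (sqrt (b |s|)) - G 0], each at most [C b sqrt |s|] since [b >= 1]. The extra [b]
    is paid for by the absolute moment of order [i + 1]. *)
Lemma extend_continuous0 i G z : even_supp G -> O z ->
  {for (0 : K), continuous (fun s => extend i G (setc s z))}.
Proof.
move=> eG Oz.
have [C [C0 HC]] := even_supp_lipschitz eG Oz.
have [D HD] := w_abs_moment i.+1.
have D0 : 0 <= D by apply: le_trans (HD 0%N); rewrite big_ord0.
pose B := C * (1 + D) + 1.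
have B0 : 0 < B by rewrite ltr_wpDl// mulr_ge0// addr_ge0.
have E0 : extend i G (setc 0 z) = G (setc 0 z).
  by rewrite extend_ge0 setc0// sqrtr0 setcK.
have key (s : K) : `|extend i G (setc s z) - G (setc 0 z)| <= B * Num.sqrt `|s|.
  have r0 : 0 <= Num.sqrt `|s| by exact: sqrtr_ge0.
  have [s0|s0] := leP 0 s.
    rewrite extend_ge0 setc0// setcK (ger0_norm s0) (le_trans (HC _ (sqrtr_ge0 _)))//.
    rewrite ler_wpM2r ?sqrtr_ge0// /B mulrDr mulr1 -addrA lerDl addr_ge0// mulr_ge0//.
  have sn : `|s| = - s by exact: ltr0_norm.
  (* The first bound makes the reflection complete, the second is what the moment identity of order
     [i] asks for. *)
  pose N := maxn (cutoff s) i.+1.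
  have Ns : 1 <= N%:R * `|s|.
    apply: le_trans (@cutoffP s _) _; first by rewrite lt_eqF.
    by rewrite ler_wpM2r// ler_nat leq_maxl.
  rewrite (@extend_lt0 i G (setc s z) N eG (cylO _ Oz)) ?setc0// reflection_setc.
  rewrite -[G (setc 0 z)]mul1r -(@w_moment i N) ?leq_maxr//.
  rewrite mulr_suml /reflection -sumrB.
  (* The weight takes one more factor [- p.2], divided out of the difference again, to bring in
     [abs_moment i.+1]. *)
  rewrite (_ : \sum_(k < N) _ = \sum_(k < N) \sum_(p <- w k) p.1 * (- p.2) ^+ i.+1 *
     ((- p.2)^-1 * (G (setc (Num.sqrt (- p.2 * s)) z) - G (setc 0 z)))).
    rewrite (@le_trans _ _ (C * Num.sqrt `|s| * D))//; last first.
      rewrite -mulrA [_ * D]mulrC mulrA ler_wpM2r// /B mulrDr mulr1 addrAC lerDr.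
      by rewrite addr_ge0.
    rewrite (le_trans _ (ler_wpM2l (mulr_ge0 C0 r0) (HD N)))//.
    apply: reflection_le => //; first exact: mulr_ge0.
    move=> k p /w_gt0 p1; have p0 : 0 < p.2 by exact: lt_le_trans p1.
    rewrite normrM normfV normrN (gtr0_norm p0) mulrC ler_pdivrMr//.
    rewrite (le_trans (HC _ (sqrtr_ge0 _)))// -mulrA ler_wpM2l//.
    rewrite mulNr -mulrN -sn mulrC sqrtrM// ler_wpM2l//.
    apply: (@le_trans _ _ (Num.sqrt (p.2 ^+ 2))); last by rewrite sqrtr_sqr gtr0_norm.
    by rewrite ler_wsqrtr// expr2 ler_peMr// ltW.
  apply: eq_bigr => k _; rewrite /moment mulr_suml -sumrB big_seq [RHS]big_seq.
  apply: eq_bigr => p /w_gt0 p1; have p0 : p.2 != 0 by rewrite gt_eqF// (lt_le_trans _ p1).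
  rewrite exprS; field.
  by rewrite ?oppr_eq0 p0.
apply/continuous_distP => e e00; rewrite E0.
have d0 : 0 < (e / B) ^+ 2 by rewrite exprn_gt0// divr_gt0.
have := near_dist_le (0 : K) d0; apply: filterS => s.
rewrite sub0r normrN distrC => sB; apply: le_trans (key s) _.
rewrite mulrC -ler_pdivlMr//; apply: (@le_trans _ _ (Num.sqrt ((e / B) ^+ 2))).
  by rewrite ler_wsqrtr.
by rewrite sqrtr_sqr gtr0_norm// divr_gt0.
Qed.

(** For [s > 0] the derivative of [G (sqrt s)] is [quot G (sqrt s)]; for [s < 0] each term gains in
    addition a factor [- p.2], whence [i.+1]. The family of all [extend i G] is therefore stable. *)
Lemma is_derive_extend0 i G z : even_supp G -> O z ->
  is_derive z e0 (extend i G) (extend i.+1 (quot G) z).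
Proof.
move=> eG Oz.
pose f s := extend i G (setc s z); pose g s := extend i.+1 (quot G) (setc s z).
have eQ := even_supp_quot eG.
have dneq (s : K) : s != 0 -> is_derive s 1 f (g s).
  move=> sneq0; have [s0|s0] := ltP s 0.
    (* This truncation is valid for all [u < s / 2], a neighbourhood of [s]. *)
    pose N := cutoff (s / 2).
    have s2 : s / 2 < 0 by lra.
    have Ns (u : K) : u < s / 2 -> 1 <= N%:R * `|u|.
      move=> us; apply: le_trans (@cutoffP (s / 2) _) _; first by rewrite (lt_eqF s2).
      by rewrite ler_wpM2l// !ltr0_norm ?lerN2 ?ltW// (lt_trans us).
    have E (u : K) : u < s / 2 -> f u = reflection i N G z u.
      move=> us; rewrite /f (@extend_lt0 _ _ _ N eG (cylO _ Oz)) setc0 ?reflection_setc//.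
        exact: lt_trans s2.
      exact: Ns.
    have E1 : \forall u \near s, reflection i N G z u = f u.
      have : s < s / 2 by lra.
      by move/near_lt; apply: filterS => u /E ->.
    apply: near_eq_is_derive E1 _.
    have -> : g s = reflection i.+1 N (quot G) z s.
      rewrite /g (@extend_lt0 _ _ _ N eQ (cylO _ Oz)) setc0 ?reflection_setc//.
      by apply: Ns; lra.
    apply: is_derive_bigsum => k.
    have H (p : K * K) : p \in w k ->
        is_derive s 1 (fun u => p.1 * (- p.2) ^+ i * G (setc (Num.sqrt (- p.2 * u)) z))
        (p.1 * (- p.2) ^+ i.+1 * quot G (setc (Num.sqrt (- p.2 * s)) z)).
      move=> /w_gt0 p1.
      have ps : 0 < - p.2 * s by rewrite nmulr_rgt0// oppr_lt0 (lt_le_trans _ p1).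
      apply: (is_derive_eq (is_deriveZ _ (is_derive_sqrt_quot eG Oz ps))).
      by rewrite exprS [_ *: _]mulrA; congr (_ * _); rewrite -!mulrA; congr (_ * _); rewrite mulrC.
    elim: (w k) H => [|p r IH] H.
      by rewrite big_nil; under eq_fun do rewrite big_nil; exact: is_derive_cst.
    rewrite big_cons; under eq_fun do rewrite big_cons.
    apply: is_deriveD; first by apply: H; rewrite mem_head.
    by apply: IH => q qr; apply: H; rewrite in_cons qr orbT.
  have {}s0 : 0 < s by rewrite lt_neqAle eq_sym sneq0.
  have E1 : \forall u \near s, G (setc (Num.sqrt (1 * u)) z) = f u.
    have := near_gt s0; apply: filterS => u u0.
    by rewrite /f extend_ge0 setc0 ?setcK ?mul1r// ltW.
  apply: near_eq_is_derive E1 _.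
  have -> : g s = 1 * quot G (setc (Num.sqrt (1 * s)) z).
    by rewrite /g extend_ge0 setc0 ?setcK ?mul1r// ltW.
  by apply: is_derive_sqrt_quot; rewrite ?mul1r.
have d (s : K) : is_derive s 1 f (g s).
  (* At the seam the function and its candidate derivative are both continuous, so the derivative
     extends there. *)
  have [->|/dneq//] := eqVneq s 0.
  apply: (@is_derive_removable K f g 0 1 ltr01); last 2 first.
  - exact: extend_continuous0.
  - exact: extend_continuous0.
  by move=> t t0 _; exact: dneq.
have := (is_derive_lineP (extend i G) (setc 0 z) e0 z._0 (g z._0)).2.
rewrite -setc_line /g setc_id; apply.
rewrite (_ : (fun _ => _) = f); first by have := d z._0; rewrite /g setc_id.
by apply/funext => s; rewrite /f [in RHS]setc_line.
Qed.

Lemma smooth_extend i G : even_supp G -> smooth O (extend i G).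
Proof.
move=> eG.
apply: (@smooth_coindW K _ O (fun F => exists i G, even_supp G /\ F = extend i G)) => //.
- by move=> _ {i G eG}[i [G [eG ->]]] z Oz; exact: extend_bounded.
- move=> _ j {i G eG}[i [G [eG ->]]]; have [->|j0] := eqVneq j ord0.
    exists (extend i.+1 (quot G)).
      by apply: lspanW; exists i.+1, (quot G); split; [exact: even_supp_quot|].
    by move=> z Oz; exact: is_derive_extend0.
  exists (extend i (fun y => 'D_(stdv K j) G y)).
    apply: lspanW; exists i, (fun y => 'D_(stdv K j) G y).
    by split; [exact: even_supp_partial|].
  by move=> z Oz; exact: is_derive_extend_ne.
by exists i, G.
Qed.

(** Every node is at least [2], so all arguments leave the support. The extension thus ends before
    [|u| = 0], where polar coordinates break down. *)
Lemma extend_far i G z : even_supp G -> O z -> z._0 < - 2^-1 -> extend i G z = 0.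
Proof.
move=> eG Oz z0.
have zn : z._0 < 0 by lra.
have N2 : 1 <= 2%:R * `|z._0| by rewrite ltr0_norm//; lra.
rewrite (extend_lt0 i eG Oz zn N2); rewrite /reflection big1// => k _.
rewrite big1_seq// => p /andP[_ pw]; have [_ _ G0] := eG.
rewrite G0 ?mulr0//; first exact: cylO.
have p2 : 2 <= p.2 by apply: le_trans (w_ge pw); rewrite ler_nat.
have H : 1 < - p.2 * z._0 by nra.
rewrite setc0 ger0_norm ?sqrtr_ge0// -sqrtr1.
by rewrite ltr_sqrt// (lt_trans ltr01).
Qed.

End seeley.

(* Seeley's reflection: an even function of the first coordinate t is a smooth function
   of t^2, and extends smoothly to negative values of t^2. *)
Lemma even_extension (K : realType) m (O : set 'rV[K]_m.+1) (G : 'rV[K]_m.+1 -> K) :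
  open O -> (forall z t, O z -> O (setc t z)) -> even_supp O G ->
  exists H : 'rV[K]_m.+1 -> K, [/\ smooth O H,
    forall z, O z -> 0 <= z ord0 ord0 -> H z = G (setc (Num.sqrt (z ord0 ord0)) z) &
    forall z, O z -> z ord0 ord0 < - 2^-1 -> H z = 0].
Proof.
move=> oO cylO eG; have [w [w1 w2 w3]] := seeley_weights K.
exists (extend w 0 G); split; first exact: smooth_extend eG.
  by move=> z Oz z0; exact: extend_ge0.
by move=> z Oz z0; exact: extend_far Oz z0.
Qed.

(** * An additional coordinate, and rescaling of [u] and [v] *)

Section behead_cons.
Context (K : realType) (N : nat).
Implicit Types (z : 'rV[K]_N.+1) (p : 'rV[K]_N).

Definition behead_row z : 'rV[K]_N := \row_j z ord0 (lift ord0 j).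

Definition cons_row (t : K) p : 'rV[K]_N.+1 :=
  \row_j if unlift ord0 j is Some i then p ord0 i else t.

Lemma behead_cons t p : behead_row (cons_row t p) = p.
Proof. by apply/rowP => j; rewrite !mxE liftK. Qed.

Lemma cons_row0 t p : cons_row t p ord0 ord0 = t.
Proof. by rewrite mxE unlift_none. Qed.

Lemma setc_cons s t p : setc s (cons_row t p) = cons_row s p.
Proof.
apply/rowP => j; rewrite !mxE; case: unliftP => [i ->|->]; last by rewrite eqxx.
by rewrite eq_sym (negbTE (neq_lift _ _)).
Qed.

Lemma behead_setc t z : behead_row (setc t z) = behead_row z.
Proof.
by apply/rowP => j; rewrite !mxE eq_sym (negbTE (neq_lift _ _)).
Qed.

Lemma smooth_cons (U : set 'rV[K]_N) (f : 'rV[K]_N -> K) : open U -> smooth U f ->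
  forall j, smooth U (fun p => cons_row (f p) p ord0 j).
Proof.
move=> oU sf j; under eq_fun do rewrite mxE.
by case: unliftP => [i _|_]; [exact: smooth_coord|exact: sf].
Qed.

Lemma smooth_behead (A : set 'rV[K]_N) (U : set 'rV[K]_N.+1) (f : 'rV[K]_N -> K) :
  open A -> open U -> smooth A f -> (forall z, U z -> A (behead_row z)) ->
  smooth U (fun z => f (behead_row z)).
Proof.
move=> oA oU sf UA; apply: (smooth_comp oA oU sf) => // j.
by under eq_fun do rewrite mxE; exact: smooth_coord.
Qed.

Lemma near_cons (W : set 'rV[K]_N.+1) (f : 'rV[K]_N -> K) p :
  open W -> W (cons_row (f p) p) -> {for p, continuous f} ->
  \forall q \near p, W (cons_row (f q) q).
Proof.
move=> oW Wp cf; have /nbhs_ballP[r /= r0 rW] := open_near oW Wp.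
have r2 : 0 < r / 2 by rewrite divr_gt0.
apply: filterS2 (near_dist_le p r2) ((continuous_distP _ _).1 cf _ r2) => q pq fq.
apply: rW; rewrite -ball_normE /ball_/= (@le_lt_trans _ _ (r / 2))//; last by lra.
rewrite [leLHS]/Num.Def.normr/= mx_normrE (bigmax_le _ (ltW r2))// => -[i j] _ /=.
rewrite !mxE; case: unliftP => [k _|_] //.
by have := coord_ler_norm (p - q) k; rewrite !mxE => /le_trans; apply.
Qed.

End behead_cons.

Section polar.
Context (K : realType) (n m : nat).
Notation V := 'rV[K]_(n + m).
Implicit Types (p q : V).

Definition sqL p : K := \sum_(i < n) p ord0 (lshift m i) ^+ 2.
Definition sqR p : K := \sum_(i < m) p ord0 (rshift n i) ^+ 2.
Definition normL p : K := Num.sqrt (sqL p).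
Definition normR p : K := Num.sqrt (sqR p).

(** With positive factors this changes [|u|] and [|v|] independently while keeping both
    directions. *)
Definition scale2 (a b : K) p : V := \row_j ((if (j < n)%N then a else b) * p ord0 j).

Lemma sqL_ge0 p : 0 <= sqL p. Proof. by apply: sumr_ge0 => i _; exact: sqr_ge0. Qed.
Lemma normL_ge0 p : 0 <= normL p. Proof. exact: sqrtr_ge0. Qed.
Lemma normR_ge0 p : 0 <= normR p. Proof. exact: sqrtr_ge0. Qed.
Lemma sqr_normL p : normL p ^+ 2 = sqL p. Proof. exact/sqr_sqrtr/sqL_ge0. Qed.

Lemma normL_scale2 a b p : normL (scale2 a b p) = `|a| * normL p.
Proof.
rewrite /normL -sqrtr_sqr -sqrtrM ?sqr_ge0//; congr Num.sqrt.
rewrite /sqL mulr_sumr; apply: eq_bigr => i _.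
by rewrite mxE /= ltn_ord exprMn.
Qed.

Lemma normR_scale2 a b p : normR (scale2 a b p) = `|b| * normR p.
Proof.
rewrite /normR -sqrtr_sqr -sqrtrM ?sqr_ge0//; congr Num.sqrt.
rewrite /sqR mulr_sumr; apply: eq_bigr => i _.
by rewrite mxE /= ltnNge leq_addr exprMn.
Qed.

Lemma scale2_id a b p : a = 1 -> b = 1 -> scale2 a b p = p.
Proof. by move=> -> ->; apply/rowP => j; rewrite mxE if_same mul1r. Qed.

Lemma smooth_sq (I : finType) (f : I -> 'I_(n + m)) :
  smooth setT (fun p : V => \sum_i p ord0 (f i) ^+ 2).
Proof.
have oT : open (setT : set V) by exact: openT.
apply: (smooth_sum oT) => i; under eq_fun do rewrite expr2.
exact: (smoothM oT (smooth_coord oT _) (smooth_coord oT _)).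
Qed.

Lemma smooth_sqL : smooth setT sqL. Proof. exact: smooth_sq. Qed.
Lemma smooth_sqR : smooth setT sqR. Proof. exact: smooth_sq. Qed.

Lemma normL_continuous (p : V) : {for p, continuous normL}.
Proof.
apply: continuous_comp; last exact: sqrt_continuous.
exact: smooth_continuous smooth_sqL I.
Qed.

Lemma normR_continuous (p : V) : {for p, continuous normR}.
Proof.
apply: continuous_comp; last exact: sqrt_continuous.
exact: smooth_continuous smooth_sqR I.
Qed.

Lemma open_normL_gt (c : K) : open [set p | c < normL p].
Proof. by apply: (@open_comp _ _ normL [set x | c < x]); [move=> p _; exact: normL_continuous|exact: open_gt]. Qed.

Lemma open_normL_lt (c : K) : open [set p | normL p < c].
Proof. by apply: (@open_comp _ _ normL [set x | x < c]); [move=> p _; exact: normL_continuous|exact: open_lt]. Qed.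

Lemma open_normR_gt (c : K) : open [set p | c < normR p].
Proof. by apply: (@open_comp _ _ normR [set x | c < x]); [move=> p _; exact: normR_continuous|exact: open_gt]. Qed.

Lemma smooth_normL : smooth [set p | 0 < normL p] normL.
Proof.
apply: (@smooth1_comp K _ [set t | 0 < t] _ (fun t => Num.sqrt t) sqL).
- exact: open_gt.
- exact: open_normL_gt.
- exact: smooth1_sqrt.
- exact: smooth_sub smooth_sqL.
- by move=> p /=; rewrite sqrtr_gt0.
Qed.

Lemma smooth_normR : smooth [set p | 0 < normR p] normR.
Proof.
apply: (@smooth1_comp K _ [set t | 0 < t] _ (fun t => Num.sqrt t) sqR).
- exact: open_gt.
- exact: open_normR_gt.
- exact: smooth1_sqrt.
- exact: smooth_sub smooth_sqR.
- by move=> p /=; rewrite sqrtr_gt0.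
Qed.

Lemma coord_le_norms p j : `|p ord0 j| <= normL p + normR p.
Proof.
rewrite -sqrtr_sqr; case: (split_ordP j) => i ->.
  apply: (@le_trans _ _ (normL p)); last by rewrite lerDl normR_ge0.
  rewrite ler_wsqrtr// /sqL (bigD1 i)//= lerDl.
  by apply: sumr_ge0 => k _; exact: sqr_ge0.
apply: (@le_trans _ _ (normR p)); last by rewrite lerDr normL_ge0.
rewrite ler_wsqrtr// /sqR (bigD1 i)//= lerDl.
by apply: sumr_ge0 => k _; exact: sqr_ge0.
Qed.

Lemma smooth_scale2 k (U : set 'rV[K]_k) (a b : 'rV[K]_k -> K) (F : 'rV[K]_k -> V) :
  open U -> smooth U a -> smooth U b -> (forall j, smooth U (fun x => F x ord0 j)) ->
  smooth U (fun x => scale2 (a x) (b x) (F x)).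
Proof.
move=> oU sa sb sF; apply: (smooth_row _ oU).2 => j.
have -> : (fun x => scale2 (a x) (b x) (F x) ord0 j) =
    (fun x => (if (j < n)%N then a x else b x) * F x ord0 j).
  by apply/funext => x; rewrite mxE.
by case: (j < n)%N; [exact: (smoothM oU sa (sF j))|exact: (smoothM oU sb (sF j))].
Qed.

End polar.

Lemma continuous_near_lt (K : realType) k (f : 'rV[K]_k -> K) (x : 'rV[K]_k) (c : K) :
  {for x, continuous f} -> f x < c -> \forall y \near x, f y < c.
Proof. by move=> cf fx; exact: cf _ (near_lt fx). Qed.

Lemma continuous_fcst (K : realType) (W : normedModType K) (x : W) (a : K) :
  {for x, continuous (fun=> a)}.
Proof. exact: cvg_cst. Qed.

Lemma continuous_fsub (K : realType) (W : normedModType K) (f g : W -> K) (x : W) :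
  {for x, continuous f} -> {for x, continuous g} -> {for x, continuous (fun y => f y - g y)}.
Proof. by move=> cf cg; apply: continuousB. Qed.

Lemma continuous_fadd (K : realType) (W : normedModType K) (f g : W -> K) (x : W) :
  {for x, continuous f} -> {for x, continuous g} -> {for x, continuous (fun y => f y + g y)}.
Proof. by move=> cf cg; apply: continuousD. Qed.

Lemma open_smooth_pos (K : realType) k (U : set 'rV[K]_k) (f : 'rV[K]_k -> K) :
  open U -> smooth U f -> open [set x | U x /\ 0 < f x].
Proof.
move=> oU sf; rewrite openE => x [Ux fx].
have := smooth_continuous sf Ux; move=> /(_ _ (near_gt fx)) H.
by apply: filterS2 (open_near oU Ux) H => y.
Qed.

(* Smoothness and openness for the subset diffeology of [S], for total functions. *)
Definition plot_smooth (K : realType) N (S : set 'rV[K]_N) (g : 'rV[K]_N -> K) :=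
  forall k (U : set 'rV[K]_k) (P : 'rV[K]_k -> 'rV[K]_N), open U -> smooth U P ->
    (forall x, U x -> S (P x)) -> smooth U (fun x => g (P x)).

Definition plot_open (K : realType) N (S : set 'rV[K]_N) (O : set 'rV[K]_N) :=
  forall k (U : set 'rV[K]_k) (P : 'rV[K]_k -> 'rV[K]_N), open U -> smooth U P ->
    (forall x, U x -> S (P x)) -> open [set x | U x /\ O (P x)].

Lemma smooth_idrow (K : realType) N (U : set 'rV[K]_N) : open U -> smooth U (fun p => p).
Proof. by move=> oU; apply: (smooth_row _ oU).2 => j; exact: smooth_coord. Qed.

(** * Extending functions over one cell *)

Section extension.
Context (K : realType) (n m : nat).
Notation V := 'rV[K]_(n + m).
Notation N := (n + m)%N.

Lemma plot_smooth_extension (S : set V) (g : V -> K) :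
  (forall p, 1 <= normL p -> S p) -> plot_smooth S g ->
  exists E : V -> K, smooth setT E /\ forall p, 1 <= normL p -> E p = g p.
Proof.
move=> HS sg.
pose U := [set p : V | 0 < normL p].
have oU : open U by exact: open_normL_gt.
pose O := [set z : 'rV[K]_N.+1 | U (behead_row z)].
have oO : open O.
  apply: open_comp => // z _; apply/continuous_distP => e e0.
  have := near_dist_le z e0; apply: filterS => y; apply: le_trans.
  rewrite [leLHS]/Num.Def.normr/= mx_normrE (bigmax_le _ (normr_ge0 _))// => -[i j] _ /=.
  by have := coord_ler_norm (z - y) (lift ord0 j); rewrite !mxE.
have cylO z t : O z -> O (setc t z) by rewrite /O /= behead_setc.
(* The plot [|u| = 1 + t^2]: [t] is the extra coordinate, the direction of [u] and all of [v] come
   from the others. [O] leaves out [u = 0], where there is no direction. *)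
pose Q (z : 'rV[K]_N.+1) : V :=
  scale2 ((1 + z ord0 ord0 ^+ 2) / normL (behead_row z)) 1 (behead_row z).
have nQ z : O z -> normL (Q z) = 1 + z ord0 ord0 ^+ 2.
  rewrite /O /U /= => z0; rewrite normL_scale2 normrM normfV (gtr0_norm z0).
  by rewrite divfK ?gt_eqF// ger0_norm// addr_ge0// sqr_ge0.
have sz2 : smooth O (fun z : 'rV[K]_N.+1 => z ord0 ord0 ^+ 2).
  under eq_fun do rewrite expr2.
  exact: (smoothM oO (smooth_coord oO _) (smooth_coord oO _)).
have sinv : smooth O (fun z => (normL (behead_row z))^-1).
  have sL := smooth_behead oU oO (@smooth_normL K n m) (fun z Oz => Oz).
  apply: (smooth1_comp _ oO (@smooth1_inv K) sL); first exact: open_neq.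
  by move=> z; rewrite /O /U /= => z0; rewrite gt_eqF.
have sQ : smooth O Q.
  apply: (smooth_scale2 oO); last 2 first.
  - exact: smooth_cst.
  - by move=> j; under eq_fun do rewrite mxE; exact: smooth_coord.
  exact: (smoothM oO (smoothD oO (smooth_cst oO _) sz2) sinv).
have sF : smooth O (fun z => g (Q z)).
  by apply: (sg _ _ _ oO sQ) => z Oz; apply: HS; rewrite nQ// lerDl; exact: sqr_ge0.
(* [chi] is [1] up to [1/4] and [0] from [1/2] on: [chi (t^2)] kills the pullback for [|t| > 1] and
   leaves it untouched near [|u| = 1]. *)
pose chi (s : K) := 1 - lamK (4 * s - 1).
have sl : smooth1 setT (fun s : K => lamK (4 * s - 1)).
  apply: (smooth1_compf openT openT (@smooth1_lamK K) (g := fun s => 4 * s - 1)) => //.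
  exact/smooth1_affine/openT.
have schi : smooth1 setT chi.
  have oT1 := @open_coord K 1 ord0 _ openT.
  exact: (smoothB oT1 (smooth_cst oT1 1) sl).
pose G (z : 'rV[K]_N.+1) := chi (z ord0 ord0 ^+ 2) * g (Q z).
have eG : even_supp O G.
  split.
  - exact: (smoothM oO (smooth1_comp openT oO schi sz2 (fun _ _ => I)) sF).
  - by move=> z Oz; rewrite /G /Q behead_setc setc0 sqrrN.
  - move=> z Oz z1; rewrite /G /chi lamK_ge1 ?subrr ?mul0r//.
    have : 1 < z ord0 ord0 ^+ 2 by rewrite -real_normK ?num_real// exprn_egt1.
    lra.
have [H [sH H1 H2]] := even_extension oO cylO eG.
(* [g] is split in two: [T1] continues the part near [|u| = 1] by reflection, and [T2] is the rest,
   zero for [|u| <= 5/4] and hence extended by zero. *)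
pose T1 p := if 0 < normL p then H (cons_row (normL p - 1) p) else 0.
pose T2 p := lamK (4 * (normL p - 1) - 1) * g p.
have sT1 : smooth setT T1.
  (* For [|u| < 1/2] the reflection vanishes, so the default [0] at [u = 0] fits in smoothly. *)
  apply: smooth_loc => p _; have [p0|p0] := ltP (normL p) 2^-1.
    exists [set q | normL q < 2^-1] => //.
    apply: (@smooth_eq K (n + m) _ _ (fun=> 0 : K)); [exact: open_normL_lt| |]; last first.
      exact/smooth_cst/open_normL_lt.
    move=> q /= q1; rewrite /T1; case: ifP => // q0.
    by rewrite H2 ?cons_row0//; [rewrite /O /U /= behead_cons|lra].
  exists U; first by rewrite /U /=; lra.
  apply: (@smooth_eq K (n + m) _ _ (fun q => H (cons_row (normL q - 1) q)) _ oU).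
    by move=> q; rewrite /U /= /T1 => ->.
  apply: (smooth_comp oO oU sH).
    exact: (smooth_cons oU (smoothB oU (@smooth_normL K n m) (smooth_cst oU 1))).
  by move=> q Uq; rewrite /O /= behead_cons.
have sT2 : smooth setT (fun p => if 1 < normL p then T2 p else 0).
  apply: smooth_loc => p _; have [p0|p0] := ltP (normL p) (5 / 4).
    exists [set q | normL q < 5 / 4] => //.
    apply: (@smooth_eq K (n + m) _ _ (fun=> 0 : K)); [exact: open_normL_lt| |]; last first.
      exact/smooth_cst/open_normL_lt.
    move=> q /= q1; case: ifP => // _; rewrite /T2 lamK_le0 ?mul0r//; lra.
  have o1 : open [set q : V | 1 < normL q] by exact: open_normL_gt.
  exists [set q | 1 < normL q]; first by rewrite /=; lra.
  apply: (@smooth_eq K (n + m) _ _ T2 _ o1); first by move=> q /= ->.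
  have sL : smooth [set q : V | 1 < normL q] (@normL K n m).
    by apply: smooth_sub (@smooth_normL K n m) => q /=; lra.
  have s1 := smooth1_comp openT o1 sl (smoothB o1 sL (smooth_cst o1 1)) (fun _ _ => I).
  apply: (smoothM o1 s1); apply: (sg _ _ _ o1 (smooth_idrow o1)).
  by move=> q /= q1; apply: HS; rewrite ltW.
exists (fun p => T1 p + (if 1 < normL p then T2 p else 0)); split.
  exact: (smoothD openT sT1 sT2).
move=> p p1; have p0 : 0 < normL p by lra.
rewrite /T1 p0 H1 ?cons_row0 ?subr_ge0//; last by rewrite /O /U /= behead_cons.
rewrite setc_cons /G cons_row0 sqr_sqrtr ?subr_ge0//.
have -> : Q (cons_row (Num.sqrt (normL p - 1)) p) = p.
  rewrite /Q behead_cons cons_row0 sqr_sqrtr ?subr_ge0//; apply: scale2_id => //.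
  by rewrite addrC subrK divff// gt_eqF.
case: ltP => p1'; first by rewrite /T2 /chi -mulrDl subrK mul1r.
have -> : normL p = 1 by apply/eqP; rewrite eq_le p1 p1'.
by rewrite subrr addr0 /chi lamK_le0 ?subr0 ?mul1r//; lra.
Qed.

Definition gap (p : V) : K := normL p - 1 + phiK (2 - normL p - normR p).

Lemma gap_continuous (p : V) : {for p, continuous gap}.
Proof.
have cL := @normL_continuous K n m p; have cR := @normR_continuous K n m p.
have c0 := continuous_fsub cL (@continuous_fcst K _ p 1).
have c1 := continuous_fsub (@continuous_fcst K _ p 2) cL.
have c3 := continuous_comp (continuous_fsub c1 cR) (smooth1_continuous (@smooth1_phiK K) I).
exact: continuous_fadd c0 c3.
Qed.

Definition DsetK : set V := [set p | 0 <= gap p].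

(** With [v = 0] the gap is positive: it is [1] where [phiK] is the identity, and at least [|u| - 1]
    beyond. So [|v|] is smooth near every point with zero gap. *)
Lemma gap_eq0_normR p : gap p = 0 -> 0 < normR p.
Proof.
rewrite lt_neqAle normR_ge0 andbT eq_sym /gap => H; apply/eqP => r0; move: H.
rewrite r0 subr0 => /eqP H; have [a1|a1] := leP (normL p) (3 / 2).
  by move: H; rewrite phiK_id; lra.
have := phiK_ge0 (2 - normL p); lra.
Qed.

Lemma plot_open_nbhs (O : set V) p : plot_open DsetK O -> DsetK p -> O p ->
  \forall q \near p, DsetK q -> O q.
Proof.
move=> oO Dp Op; have [gp|gp] := ltP 0 (gap p).
  have oU : open [set q : V | 0 < gap q].
    by apply: (@open_comp _ _ gap [set x | 0 < x]); [move=> q _; exact: gap_continuous|exact: open_gt].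
  (* In the interior the identity is itself a plot of D. *)
  have := oO _ _ _ oU (smooth_idrow oU) (fun q => @ltW _ _ _ _).
  move=> /open_near /(_ (conj gp Op)); apply: filterS => q /= [_ Oq] _ //.
have {gp} gp : gap p = 0 by apply/eqP; rewrite eq_le gp.
have b0 := gap_eq0_normR gp.
have csq : {for p, continuous (fun q : V => Num.sqrt (gap q))}.
  by apply: continuous_comp; [exact: gap_continuous|exact: sqrt_continuous].
pose UR := [set z : 'rV[K]_N.+1 | 0 < normR (behead_row z)].
pose UL := [set z : 'rV[K]_N.+1 | 0 < normL (behead_row z)].
have cb : continuous (@behead_row K N).
  move=> z; apply/continuous_distP => e e0.
  have := near_dist_le z e0; apply: filterS => y; apply: le_trans.
  rewrite [leLHS]/Num.Def.normr/= mx_normrE (bigmax_le _ (normr_ge0 _))// => -[i j] _ /=.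
  by have := coord_ler_norm (z - y) (lift ord0 j); rewrite !mxE.
have oUR : open UR by apply: (@open_comp _ _ _ _ _ (@open_normR_gt K n m 0)) => z _; exact: cb.
have oUL : open UL by apply: (@open_comp _ _ _ _ _ (@open_normL_gt K n m 0)) => z _; exact: cb.
have sz2 (U : set 'rV[K]_N.+1) : open U -> smooth U (fun z : 'rV[K]_N.+1 => z ord0 ord0 ^+ 2).
  move=> oU; under eq_fun do rewrite expr2.
  exact: (smoothM oU (smooth_coord oU _) (smooth_coord oU _)).
have sy (U : set 'rV[K]_N.+1) : open U -> forall j, smooth U (fun z => behead_row z ord0 j).
  by move=> oU j; under eq_fun do rewrite mxE; exact: smooth_coord.
(* It suffices to find a plot [P] of D, defined near (0, p), with P (sqrt (gap q), q) = q
   for [q] in D near [p]. *)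
suff [W [P [oW sP PD Wp PE]]] : exists (W : set 'rV[K]_N.+1) (P : 'rV[K]_N.+1 -> V),
    [/\ open W, smooth W P, forall z, W z -> DsetK (P z), W (cons_row 0 p) &
     \forall q \near p, DsetK q -> P (cons_row (Num.sqrt (gap q)) q) = q].
  have oW' := oO _ _ _ oW sP PD.
  have E0 : P (cons_row 0 p) = p.
    by have := nbhs_singleton PE Dp; rewrite gp sqrtr0.
  have Wp' : [set z | W z /\ O (P z)] (cons_row (Num.sqrt (gap p)) p).
    by rewrite gp sqrtr0 /= E0.
  have H := near_cons oW' Wp' csq.
  by apply: filterS2 PE H => q PEq [_ Oq] Dq; rewrite -(PEq Dq).
have [a0|a0] := ltP 0 (normL p).
  pose a (z : 'rV[K]_N.+1) := normL (behead_row z); pose b (z : 'rV[K]_N.+1) := normR (behead_row z).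
  (* The plot gives [u] the norm [r] and [v] the norm [a + b - r]. As [|u| + |v|] is unchanged, so
     is the argument of [phiK], and the gap of the image is exactly the square of the extra
     coordinate. *)
  pose r (z : 'rV[K]_N.+1) := 1 - phiK (2 - a z - b z) + z ord0 ord0 ^+ 2.
  pose t z := a z + b z - r z.
  pose U := UL `&` UR.
  have oU : open U by exact: openI.
  have sa : smooth U a.
    by apply: (smooth_behead (@open_normL_gt K n m 0) oU (@smooth_normL K n m)) => z [].
  have sb : smooth U b.
    by apply: (smooth_behead (@open_normR_gt K n m 0) oU (@smooth_normR K n m)) => z [].
  have sr : smooth U r.
    have s1 := smoothB oU (smoothB oU (smooth_cst oU 2) sa) sb.
    have s2 := smooth1_comp openT oU (@smooth1_phiK K) s1 (fun _ _ => I).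
    exact: (smoothD oU (smoothB oU (smooth_cst oU 1) s2) (sz2 _ oU)).
  have st : smooth U t by exact: (smoothB oU (smoothD oU sa sb) sr).
  pose W1 := [set z | U z /\ 0 < r z]; pose W := [set z | W1 z /\ 0 < t z].
  have oW1 : open W1 by exact: open_smooth_pos oU sr.
  have W1U : W1 `<=` U by move=> z [].
  have oW : open W by exact: open_smooth_pos oW1 (smooth_sub W1U st).
  have WU : W `<=` U by move=> z [[]].
  have sinv (f : 'rV[K]_N.+1 -> K) : smooth U f -> (forall z, U z -> 0 < f z) ->
      smooth W (fun z => (f z)^-1).
    move=> sf f0.
    apply: (smooth1_comp _ oW (@smooth1_inv K) (smooth_sub WU sf)); first exact: open_neq.
    by move=> z /WU /f0 fz /=; rewrite gt_eqF.
  exists W, (fun z => scale2 (r z / a z) (t z / b z) (behead_row z)); split.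
  - exact: oW.
  - have ia := sinv _ sa (fun z Uz => Uz.1); have ib := sinv _ sb (fun z Uz => Uz.2).
    apply: (smooth_scale2 oW _ _ (sy _ oW)).
      exact: (smoothM oW (smooth_sub WU sr) ia).
    exact: (smoothM oW (smooth_sub WU st) ib).
  - move=> z [[[za zb] rz] tz]; rewrite /DsetK /= /gap normL_scale2 normR_scale2.
    rewrite !normrM !normfV -/(a z) -/(b z) (gtr0_norm rz) (gtr0_norm tz).
    rewrite (gtr0_norm za) (gtr0_norm zb) !divfK ?gt_eqF//.
    have -> : 2 - r z - t z = 2 - a z - b z by rewrite /t; ring.
    have := sqr_ge0 (z ord0 ord0); rewrite {1}/r; lra.
  - have r0 : r (cons_row 0 p) = normL p.
      rewrite /r /a /b behead_cons cons_row0 expr0n addr0; move: gp; rewrite /gap; lra.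
    rewrite /W /W1 /U /UL /UR /= /t r0 /a /b behead_cons.
    by split; [split|rewrite addrAC subrr add0r].
  - have H1 := @normL_continuous K n m p _ (near_gt a0).
    have H2 := @normR_continuous K n m p _ (near_gt b0).
    near=> q => Dq.
    have rq : r (cons_row (Num.sqrt (gap q)) q) = normL q.
      rewrite /r /a /b behead_cons cons_row0 sqr_sqrtr//; rewrite /gap; lra.
    rewrite /t rq /a /b behead_cons; apply: scale2_id.
      by rewrite divff// gt_eqF//; near: q.
    by rewrite [X in X - _]addrC addrK divff// gt_eqF//; near: q.
(* At [u = 0] the norm of [u] is not smooth. Such a boundary point has [|v| = 1], and nearby the gap
   is [1 - |v|], so it suffices to rescale [v] to norm [1 - t^2]. *)
have {a0} a0 : normL p = 0 by apply/eqP; rewrite eq_le a0 normL_ge0.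
have b1 : normR p = 1.
  move: gp; rewrite /gap a0 subr0 => gp.
  have [h|h] := leP (2^-1) (2 - normR p); first by move: gp; rewrite phiK_id//; lra.
  have := phiK_ndecr (ltW h); rewrite [phiK 2^-1]phiK_id//; lra.
pose c (z : 'rV[K]_N.+1) := 1 - z ord0 ord0 ^+ 2.
have sc : smooth UR c by exact: (smoothB oUR (smooth_cst oUR 1) (sz2 _ oUR)).
pose W := [set z | UR z /\ 0 < c z] `&` [set z | normL (behead_row z) < 2^-1].
have oW : open W.
  apply: openI; first exact: open_smooth_pos oUR sc.
  by apply: (@open_comp _ _ _ _ _ (@open_normL_lt K n m 2^-1)) => z _; exact: cb.
have WU : W `<=` UR by move=> z [[]].
exists W, (fun z => scale2 1 (c z / normR (behead_row z)) (behead_row z)); split.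
- exact: oW.
- apply: (smooth_scale2 oW (smooth_cst oW 1) _ (sy _ oW)).
  have sR := smooth_behead (@open_normR_gt K n m 0) oW (@smooth_normR K n m) WU.
  apply: (smoothM oW (smooth_sub WU sc)).
  apply: (smooth1_comp _ oW (@smooth1_inv K) sR); first exact: open_neq.
  by move=> z /WU /= zb; rewrite gt_eqF.
- move=> z [[zb cz] za]; rewrite /DsetK /= /gap normL_scale2 normR_scale2.
  rewrite normr1 mul1r normrM normfV (gtr0_norm cz) (gtr0_norm zb) divfK ?gt_eqF//.
  have s0 := sqr_ge0 (z ord0 ord0); move: za => /= za.
  by rewrite phiK_id /c; lra.
- rewrite /W /UR /= /c behead_cons cons_row0 expr0n subr0 a0 b1.
  by split; [split|rewrite invr_gt0].
- have H1 : \forall q \near p, normL q < 4^-1.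
    by apply: (continuous_near_lt (@normL_continuous K n m p)); rewrite a0 invr_gt0.
  have H2 : \forall q \near p, normR q < 5 / 4.
    by apply: (continuous_near_lt (@normR_continuous K n m p)); rewrite b1; lra.
  have H3 := @normR_continuous K n m p _ (near_gt b0).
  near=> q => Dq; rewrite /c behead_cons cons_row0; apply: scale2_id => //.
  have q1 : normL q < 4^-1 by near: q.
  have q2 : normR q < 5 / 4 by near: q.
  have q3 : 0 < normR q by near: q.
  have gq : gap q = 1 - normR q by rewrite /gap phiK_id; lra.
  rewrite sqr_sqrtr// gq opprB addrC subrK divff// gt_eqF//.
Unshelve. all: by end_near. Qed.

Definition hat (p : V) : K := flat (1 - sqL p).

Lemma smooth_hat : smooth setT hat.
Proof.
exact: (smooth1_comp openT openT (@smooth1_flat K)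
  (smoothB openT (smooth_cst openT 1) (@smooth_sqL K n m)) (fun _ _ => I)).
Qed.

Lemma hat_eq0 p : 1 <= normL p -> hat p = 0.
Proof.
by move=> p1; rewrite /hat flat_eq0// subr_le0 -sqr_normL exprn_ege1.
Qed.

Lemma hat_gt0 p : normL p < 1 -> 0 < hat p.
Proof.
by move=> p1; rewrite /hat flat_gt0// subr_gt0 -sqr_normL exprn_ilt1// normL_ge0.
Qed.

Lemma hat_ge0 p : 0 <= hat p. Proof. exact: flat_ge0. Qed.

(* Off S the handle is bounded, so subtracting a large multiple of a function supported
   off S makes an arbitrary extension negative wherever it has to be. *)
Lemma cell_extension (S O : set V) (g : V -> K) :
  (forall p, 1 <= normL p -> S p) ->
  plot_smooth S g -> plot_open DsetK O ->
  (forall p, DsetK p -> 1 <= normL p -> ~ O p -> g p < 0) ->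
  exists E : V -> K, [/\ smooth setT E, forall p, 1 <= normL p -> E p = g p &
    forall p, DsetK p -> ~ O p -> E p < 0].
Proof.
move=> HS sg oO g0; have [E [sE EE]] := plot_smooth_extension HS sg.
have cE p : {for p, continuous E} by exact: smooth_continuous sE _.
have ch p : {for p, continuous hat} by exact: smooth_continuous smooth_hat _.
(* Points of D with [|u| < 1] satisfy [|u| + |v| <= 5/2]: beyond that [phiK] vanishes and the gap is
   [|u| - 1], negative. *)
have cA : compact [set p : V | `|p| <= 5 / 2].
  apply: bounded_closed_compact.
    by exists (5 / 2); split; [exact: num_real|move=> M HM p /= /le_trans; apply; exact: ltW].
  apply: (@closed_comp _ _ (fun w : V => `|w|) [set x | x <= 5 / 2]) => //.
  by move=> w _; exact: norm_continuous.
have [M HM] : exists M : nat, forall p, `|p| <= 5 / 2 -> DsetK p -> ~ O p ->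
    E p - M%:R * hat p < 0.
  have /compact_near_coveringP cov := cA.
  have /= := cov nat \oo (fun M p => DsetK p -> ~ O p -> E p - M%:R * hat p < 0) _.
  (* Since [hat >= 0], a local threshold serves all larger [M]. Off D nothing is asked nearby; near
     a point of [O] all of D lies in [O]; where [|u| >= 1] negativity persists by continuity; where
     [|u| < 1] the positive [hat] wins for large [M0]. *)
  suff loc : forall p : V, exists M0 : nat, \forall q \near p, forall M, (M0 <= M)%N ->
      DsetK q -> ~ O q -> E q - M%:R * hat q < 0.
    case=> [p _|M0 _ H]; last by exists M0 => p pA; exact: (H M0 (leqnn _) p pA).
    have [M0 HM0] := loc p.
    exists ([set q | forall M, (M0 <= M)%N -> DsetK q -> ~ O q -> E q - M%:R * hat q < 0],
      [set M | (M0 <= M)%N]); first by split => //; exists M0.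
    by move=> [q M] /= [Hq M0M]; exact: Hq.
  move=> p; have [Dp|Dp] := pselect (DsetK p); last first.
    have gp : gap p < 0 by rewrite ltNge; apply/negP.
    exists 0%N; have := continuous_near_lt (@gap_continuous p) gp; apply: filterS => q gq M _ Dq.
    by move: gq; rewrite ltNge Dq.
  have [Op|nOp] := pselect (O p).
    exists 0%N; have := plot_open_nbhs oO Dp Op; apply: filterS => q H M _ Dq nOq.
    by case: nOq; exact: H.
  have [p1|p1] := leP 1 (normL p).
    have Ep : E p < 0 by rewrite EE// g0.
    exists 0%N; have := continuous_near_lt (cE p) Ep; apply: filterS => q Eq M _ _ _.
    rewrite subr_lt0 (lt_le_trans Eq)// mulr_ge0// hat_ge0//.
  have hp := hat_gt0 p1.
  pose M0 := (Num.truncn (`|E p| / hat p)).+1.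
  have HM0 : E p - M0%:R * hat p < 0.
    rewrite subr_lt0 -ltr_pdivrMr// (le_lt_trans _ (truncnS_gt _))//.
    by rewrite ler_pM2r ?invr_gt0// ler_norm.
  have cEh : {for p, continuous (fun q => E q - M0%:R * hat q)}.
    exact: smooth_continuous (smoothB openT sE (smoothZ openT _ smooth_hat)) I.
  exists M0; have := continuous_near_lt cEh HM0; apply: filterS => q Hq M M0M _ _.
  by rewrite (le_lt_trans _ Hq)// lerB// ler_wpM2r ?hat_ge0// ler_nat.
exists (fun p => E p - M%:R * hat p); split.
- exact: (smoothB openT sE (smoothZ openT _ smooth_hat)).
- by move=> p p1; rewrite hat_eq0// mulr0 subr0 EE.
- move=> p Dp nOp; have [p1|p1] := leP 1 (normL p).
    by rewrite hat_eq0// mulr0 subr0 EE// g0.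
  apply: HM => //; move: (Dp); rewrite /DsetK /gap /= => gp.
  have H : normL p + normR p <= 5 / 2.
    by rewrite leNgt; apply/negP => H; move: gp; rewrite phiK_eq0; lra.
  have h52 : 0 <= 5 / 2 :> K by lra.
  rewrite [leLHS]/Num.Def.normr/= mx_normrE bigmax_le// => -[i j] _ /=; rewrite (ord1 i).
  exact: le_trans (coord_le_norms p j) H.
Qed.

(** Serves the cell in whose interior the chosen point lies, with [-1] on the preceding skeleton.
    The height [3/2] lifts [-1] to [1/2] at [p], inside a ball where [|u| < 1] and D lies in [O]. *)
Lemma cell_bump (O : set V) (p : V) : plot_open DsetK O -> DsetK p -> O p ->
  normL p < 1 -> exists E : V -> K, [/\ smooth setT E,
    forall q, 1 <= normL q -> E q = -1, E p = 2^-1 &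
    forall q, DsetK q -> ~ O q -> E q < 0].
Proof.
move=> oO Dp Op p1.
have /nbhs_ballP[r /= r0 rH] : \forall q \near p, (DsetK q -> O q) /\ normL q < 1.
  apply: filterI; first exact: plot_open_nbhs.
  exact: open_near (@open_normL_lt K n m 1) p1.
pose d2 (q : V) : K := \sum_j (q ord0 j - p ord0 j) ^+ 2.
have sd2 : smooth setT d2.
  apply: (smooth_sum openT) => j; under eq_fun do rewrite expr2.
  have oT : open (setT : set V) by exact: openT.
  have s1 := smoothB oT (smooth_coord oT j) (smooth_cst oT (p ord0 j)).
  exact: (smoothM oT s1 s1).
pose b q := flat (r ^+ 2 - d2 q).
have r20 : 0 < r ^+ 2 by rewrite exprn_gt0.
have f0 : 0 < flat (r ^+ 2) by exact: flat_gt0.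
(* The Euclidean ball of radius [r] lies in the sup-norm ball. *)
have far q : ~ ball p r q -> b q = 0.
  move=> nq; rewrite /b flat_eq0// subr_le0 leNgt; apply/negP => H; apply: nq.
  rewrite -ball_normE /ball_/= [ltLHS]/Num.Def.normr/= mx_normrE bigmax_lt// => -[i j] _ /=.
  rewrite !mxE (ord1 i) -[ltRHS]gtr0_norm// -ltr_sqr ?nnegrE// !real_normK ?num_real//.
  apply: le_lt_trans H; rewrite /d2 (bigD1 j)//= -[in leLHS]opprB sqrrN lerDl.
  by apply: sumr_ge0 => k _; exact: sqr_ge0.
exists (fun q => -1 + (3 / 2 / flat (r ^+ 2)) * b q); split.
- have oT : open (setT : set V) by exact: openT.
  have s1 := smooth1_comp openT oT (@smooth1_flat K)
    (smoothB oT (smooth_cst oT (r ^+ 2)) sd2) (fun _ _ => I).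
  exact: (smoothD oT (smooth_cst oT _) (smoothZ oT _ s1)).
- move=> q q1; rewrite far ?mulr0 ?addr0// => /rH [_].
  by rewrite ltNge q1.
- have -> : b p = flat (r ^+ 2).
    by rewrite /b /d2 big1 ?subr0// => j _; rewrite subrr expr0n.
  by rewrite divfK ?gt_eqF//; lra.
- move=> q Dq nOq; rewrite far ?mulr0 ?addr0 ?oppr_lt0// => /rH [H _].
  by apply: nOq; exact: H.
Qed.

End extension.

(** * Passage to the reals of the statement and to diffeological notions *)

Notation RT := RbaseSymbolsImpl_R__canonical__reals_Real.

#[global] Transparent flat lamK phiK.

Lemma phiE : phi = @phiK RT.
Proof. by []. Qed.

#[global] Opaque flat lamK phiK.

Lemma enormL n m (p : 'rV[R]_(n + m)) : enorm (lsubmx p) = @normL RT n m p.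
Proof.
by rewrite /enorm /normL /sqL; congr Num.sqrt; apply: eq_bigr => i _; rewrite mxE.
Qed.

Lemma enormR n m (p : 'rV[R]_(n + m)) : enorm (rsubmx p) = @normR RT n m p.
Proof.
by rewrite /enorm /normR /sqR; congr Num.sqrt; apply: eq_bigr => i _; rewrite mxE.
Qed.

Lemma DsetE n m : Dset n m = @DsetK RT n m.
Proof.
apply/funext => p; apply/propext; rewrite /Dset /DsetK /gap /= enormL enormR phiE.
by split; lra.
Qed.

(** [phiK >= 0] makes the condition of D automatic where [|u| >= 1], so intersecting with D in
    [Sset] removes nothing. *)
Lemma Sset_normL n m (p : 'rV[R]_(n + m)) : 1 <= @normL RT n m p -> Sset n m p.
Proof.
move=> p1; split; last by rewrite /= enormL.
rewrite DsetE /DsetK /= /gap.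
have := @phiK_ge0 RT (2 - normL p - normR p); lra.
Qed.

(** Turns functions on subtypes into total ones, on which the analysis acts; the value [0] off [A]
    is a mere default. *)
Definition ext (T : Type) (A : set T) (f : dom A -> R) (x : T) : R :=
  if pselect (x \in A) is left hx then f (exist _ x hx) else 0.

Lemma ext_val (T : Type) (A : set T) (f : dom A -> R) (y : dom A) : ext f (val y) = f y.
Proof.
case: y => x hx; rewrite /ext /=; case: pselect => // hx'.
by congr (f (exist _ x _)); exact: bool_irrelevance.
Qed.

Lemma ext_exist (T : Type) (A : set T) (f : dom A -> R) x (hx : x \in A) :
  ext f x = f (exist _ x hx).
Proof. exact: (ext_val f (exist _ x hx)). Qed.

Definition corestr k N (U : set 'rV[R]_k) (S : set 'rV[R]_N) (P : 'rV[R]_k -> 'rV[R]_N)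
    (PS : forall x, U x -> S (P x)) (x : dom U) : dom S :=
  exist _ (P (val x)) (mem_set (PS _ (set_mem (valP x)))).

Lemma corestr_plot k N (U : set 'rV[R]_k) (S : set 'rV[R]_N) (P : 'rV[R]_k -> 'rV[R]_N)
    (PS : forall x, U x -> S (P x)) : open U -> @smooth RT _ _ U P ->
  @sub_plots _ (@euc_plots 'rV[R]_N) S k U (corestr PS).
Proof.
move=> oU sP; split; [exact: oU|exists P; split; last by move=> y].
by rewrite smoothE; exact: sP.
Qed.

(** On an open set derivatives see only values on that set, so any witness may be replaced by
    [ext f]. *)
Lemma smoothpP k (U : set 'rV[R]_k) (f : dom U -> R) : open U ->
  @smoothp k R^o U f <-> @smooth RT k RT U (ext f).
Proof.
move=> oU; split=> [[F [sF FE]]|sf].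
  rewrite smoothE in sF; apply: (@smooth_eq RT k RT U F (ext f) oU _ sF) => x Ux.
  by rewrite (ext_exist f (mem_set Ux)) -FE.
by exists (ext f); split; [rewrite smoothE|move=> y; rewrite ext_val].
Qed.

Lemma dsmooth_plot_smooth N (S : set 'rV[R]_N) (f : dom S -> R) :
  dsmooth (sub_plots (@euc_plots 'rV[R]_N) S) (@euc_plots R^o) f ->
  @plot_smooth RT N S (ext f).
Proof.
move=> sf k U P oU sP PS.
have [_ /(smoothpP _ oU) s] := sf _ _ _ (corestr_plot PS oU sP).
apply: smooth_eq oU _ s => x Ux; rewrite (ext_exist _ (mem_set Ux)) /=.
by rewrite (ext_exist f (mem_set (PS x Ux))); congr f; apply: val_inj.
Qed.

Lemma smooth_dsmooth N (S : set 'rV[R]_N) (E : 'rV[R]_N -> R) :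
  @smooth RT N RT setT E ->
  dsmooth (sub_plots (@euc_plots 'rV[R]_N) S) (@euc_plots R^o) (fun x => E (val x)).
Proof.
move=> sE k U P [oU [F [sF FE]]]; split => //.
exists (E \o F); split; last by move=> y /=; rewrite FE.
rewrite smoothE; apply: (@smooth_comp RT _ _ setT U E F openT oU sE) => //.
by apply/(@smooth_row RT _ _ _ F oU); move: sF; rewrite smoothE.
Qed.

Lemma Dopen_plot_open N (S : set 'rV[R]_N) (O : set (dom S)) :
  Dopen (sub_plots (@euc_plots 'rV[R]_N) S) O ->
  @plot_open RT N S [set x | exists hx : x \in S, O (exist _ x hx)].
Proof.
move=> oO k U P oU sP PS.
have := oO _ _ _ (corestr_plot PS oU sP); congr (@open _ _); apply/funext => x.
apply/propext; split=> [[hx Ox]|[Ux [hx Ox]]].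
  split; first exact: set_mem.
  by exists (mem_set (PS _ (set_mem hx))); move: Ox; congr O; exact: val_inj.
exists (mem_set Ux); move: Ox; congr O; exact: val_inj.
Qed.

Lemma euc_diffeology : is_diffeology (@euc_plots R^o).
Proof.
split; [by move=> n U P []|split; [|split]].
- move=> n U x oU; split => //; exists (fun=> x); split => //.
  by rewrite smoothE; exact: (@smooth_cst RT n U oU x).
- move=> n U P oU loc; split => //; apply/smoothpP => //.
  apply: smooth_loc => x Ux; have [V [oV Vx [oVU /(smoothpP _ oVU) s]]] := loc (exist _ x (mem_set Ux)).
  exists (V `&` U); [by split|apply: smooth_eq oVU _ s => y VUy].
  rewrite (ext_exist _ (mem_set VUy)) /= (ext_exist P (mem_set VUy.2)).
  by congr P; exact: val_inj.
- move=> n U P [oU [F [sF FE]]] m V G oV [H [sH HE]]; split => //.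
  exists (F \o H); split; last by move=> y; rewrite /= HE FE.
  rewrite smoothE; apply: (@smooth_comp RT _ _ U V F H oU oV).
  + by move: sF; rewrite smoothE.
  + by apply/(@smooth_row RT _ _ _ H oV); move: sH; rewrite smoothE.
  + by move=> x Vx; have := HE (exist _ x (mem_set Vx)); rewrite /= => ->; exact/set_mem/valP.
Qed.

(** Every map on an open domain is a plot, so smoothness into this space is automatic; with [Prop]
    as the space, universal properties speak about arbitrary subsets. *)
Definition coarse_plots (Y : Type) : plots Y := fun n U P => open U.

Lemma coarse_diffeology (Y : Type) : is_diffeology (@coarse_plots Y).
Proof. by split; [|split; [|split]]. Qed.

Lemma coprod_inj_plot (I : Type) (N : I -> nat) (S : forall i, set 'rV[R]_(N i)) (i : I)
    k (U : set 'rV[R]_k) (Q : dom U -> dom (S i)) :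
  @sub_plots _ (@euc_plots 'rV[R]_(N i)) (S i) k U Q ->
  @coprod_plots _ _ (fun i => sub_plots (@euc_plots 'rV[R]_(N i)) (S i)) k U
    (fun x => existT _ i (Q x)).
Proof.
move=> [oU [F [sF FE]]]; split => // r; exists setT; split; first exact: openT.
split => //; exists i, (fun s => Q (restr s)); split => //.
split; first by apply: openI => //; exact: openT.
exists F; split; last by move=> y; exact: (FE (restr y)).
by move: sF; rewrite !smoothE; apply: smooth_sub => x [].
Qed.

(** * Building the function over the skeleta *)

Section fat_CW.
Context (X : Type) (pX : plots X) (dX : is_diffeology pX).
Context (sk : nat -> set X) (hsk : forall n, prevsk sk n `<=` sk n).
Context (J : nat -> Type) (mJ : forall n, J n -> nat).
Context (h : forall n, {j : J n & fatS n (mJ j)} -> dom (prevsk sk n)).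
Hypothesis h_smooth : forall n, dsmooth
  (coprod_plots (fun j : J n => fatS_plots n (mJ j))) (sub_plots pX (prevsk sk n)) (@h n).
Context (Phi : forall n, {j : J n & fatD n (mJ j)} -> dom (sk n)).
Hypothesis Phi_pushout : forall n, is_pushout (sub_plots pX (prevsk sk n))
  (coprod_plots (fun j : J n => fatD_plots n (mJ j)))
  (coprod_plots (fun j : J n => fatS_plots n (mJ j)))
  (sub_plots pX (sk n)) (@h n)
  (fun s => existT _ (projT1 s) (S_to_D (projT2 s)))
  (@Defs.incl _ _ _ (hsk (n:=n))) (@Phi n).
Hypothesis colim : forall (Y : Type) (pY : plots Y), is_diffeology pY ->
  forall u : forall n, dom (sk n) -> Y,
    (forall n, dsmooth (sub_plots pX (sk n)) pY (u n)) ->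
    (forall n (x : dom (sk n)), u n.+1 (@Defs.incl _ _ _ (hsk (n:=n.+1)) x) = u n x) ->
    exists! w : X -> Y, dsmooth pX pY w /\ forall n (x : dom (sk n)), w (val x) = u n x.

Notation euc := (@euc_plots R^o).
Definition smooth_skel (A : set X) (f : X -> R) :=
  dsmooth (sub_plots pX A) euc (fun x => f (val x)).

(* Uniqueness in the universal property, tested on maps to a coarse space. *)
Lemma skeleton_cases n (y : dom (sk n)) :
  (exists x, y = @Defs.incl _ _ _ (hsk (n:=n)) x) \/ exists c, y = Phi c.
Proof.
have [_ [_ [_ U]]] := Phi_pushout n.
pose P y := (exists x, y = @Defs.incl _ _ _ (hsk (n:=n)) x) \/ exists c, y = Phi c.
have [w [_ uw]] := U Prop (@coarse_plots Prop) (@coarse_diffeology _)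
  (fun=> True) (fun=> True) (fun k V Q q => dX.1 _ _ _ q) (fun k V Q q => q.1) (fun=> erefl).
(* The predicate [P] and the constant [True] agree after composition with both legs of the pushout,
   so uniqueness identifies them. *)
have E1 := uw (fun=> True) (conj (fun k V Q q => dX.1 _ _ _ q)
   (conj (fun=> erefl) (fun=> erefl))).
have E2 := uw P (conj (fun k V Q q => dX.1 _ _ _ q)
   (conj (fun x => propext (conj (fun=> I) (fun=> or_introl (ex_intro _ x erefl))))
         (fun x => propext (conj (fun=> I) (fun=> or_intror (ex_intro _ x erefl)))))).
by rewrite -/(P y) -E2 E1.
Qed.

(** The same test for the colimit: being in some skeleton and the constant [True] agree on each
    skeleton, hence everywhere. *)
Lemma skeleton_cover x : exists n, sk n x.
Proof.
pose P x := exists n, sk n x.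
have [w [_ uw]] := @colim Prop (@coarse_plots Prop) (@coarse_diffeology _)
  (fun _ _ => True) (fun n k V Q q => dX.1 _ _ _ q) (fun n x => erefl).
have E1 := uw (fun=> True) (conj (fun k V Q q => dX.1 _ _ _ q) (fun n x => erefl)).
have PE n (y : dom (sk n)) : P (val y) = True.
  by apply/propext; split => // _; exists n; exact/set_mem/valP.
have E2 := uw P (conj (fun k V Q q => dX.1 _ _ _ q) PE).
by rewrite -/(P x) -E2 E1.
Qed.

Lemma skeleton_first x : exists2 n, sk n x & ~ prevsk sk n x.
Proof.
have [n] := skeleton_cover x; elim: n => [|n IH] skx; first by exists 0%N => // -[].
by have [/IH//|nx] := pselect (sk n x); exists n.+1.
Qed.

Lemma existT_inj (I : Type) (T : I -> Type) i (p q : T i) : existT T i p = existT T i q -> p = q.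
Proof. by move=> e; have := projT2_eq e; rewrite (Prop_irrelevance (projT1_eq e) erefl). Qed.

(** The universal property with target the line. On the coproduct smoothness is checked locally,
    where a plot stays in one cell. *)
Lemma attach_glue n (f : X -> R) (g : forall j : J n, fatD n (mJ j) -> R) :
  smooth_skel (prevsk sk n) f ->
  (forall j, dsmooth (fatD_plots n (mJ j)) euc (@g j)) ->
  (forall j (s : fatS n (mJ j)), f (val (h (existT _ j s))) = g j (S_to_D s)) ->
  exists f', [/\ smooth_skel (sk n) f', forall x, prevsk sk n x -> f' x = f x &
    forall j (p : fatD n (mJ j)), f' (val (Phi (existT _ j p))) = g j p].
Proof.
move=> sf sg fg; have [_ [_ [_ U]]] := Phi_pushout n.
pose v (c : {j : J n & fatD n (mJ j)}) := g (projT1 c) (projT2 c).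
have sv : dsmooth (coprod_plots (fun j : J n => fatD_plots n (mJ j))) euc v.
  move=> k W P [oW loc]; have [_ [_ [euc_loc _]]] := euc_diffeology.
  apply: euc_loc => // r; have [V [oV [Vr [i [Q [pQ PQ]]]]]] := loc r.
  exists V; split => //.
  have -> : (v \o P) \o @restr _ V W = @g i \o Q by apply/funext => s /=; rewrite PQ.
  exact: sg.
have [w [[sw [w1 w2]] _]] := U R euc euc_diffeology _ _ sf sv
  (fun c => match c with existT j s => fg j s end).
exists (ext w); split.
- rewrite /smooth_skel; have -> // : (fun x : dom (sk n) => ext w (val x)) = w.
  by apply/funext => x; exact: ext_val.
- move=> x px; have := w1 (exist _ x (mem_set px)); by rewrite -ext_val.
- by move=> j p; rewrite ext_val; exact: (w2 (existT _ j p)).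
Qed.

Lemma smooth_skelS (A B : set X) f : A `<=` B -> smooth_skel B f -> smooth_skel A f.
Proof. by move=> AB sf k U P pP; exact: (sf _ _ (fun x => Defs.incl AB (P x)) pP). Qed.

Lemma attach_compat n (j : J n) (s : fatS n (mJ j)) :
  val (Phi (existT _ j (S_to_D s))) = val (h (existT _ j s)).
Proof. by have [_ [_ [E _]]] := Phi_pushout n; rewrite -(E (existT _ j s)). Qed.

Definition cell_trace n (j : J n) (O : set X) : set 'rV[R]_(n + mJ j) :=
  [set x | exists hx : x \in Dset n (mJ j), O (val (Phi (existT _ j (exist _ x hx))))].

Arguments cell_trace {n} j O.

Lemma cell_trace_open n (j : J n) O : Dopen pX O ->
  @plot_open RT _ (@DsetK RT n (mJ j)) (cell_trace j O).
Proof.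
move=> oO; have [_ [sPhi _]] := Phi_pushout n; rewrite -DsetE.
apply: (@Dopen_plot_open _ (Dset n (mJ j)) [set p | O (val (Phi (existT _ j p)))]).
move=> k U P pP; exact: (oO _ _ _ (sPhi _ _ _
  (@coprod_inj_plot (J n) (fun j => n + mJ j)%N (fun j => Dset n (mJ j)) j k U P pP))).
Qed.

Lemma cell_trace_val n (j : J n) O (p : fatD n (mJ j)) :
  cell_trace j O (val p) <-> O (val (Phi (existT _ j p))).
Proof.
case: p => p hp; split=> [[hp' /=]|Op]; last by exists hp.
by rewrite (bool_irrelevance hp hp').
Qed.

Lemma attaching_dsmooth n (j : J n) f : smooth_skel (prevsk sk n) f ->
  dsmooth (fatS_plots n (mJ j)) euc (fun s => f (val (h (existT _ j s)))).
Proof.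
move=> sf k U P pP; exact: (sf _ _ _ (h_smooth
  (@coprod_inj_plot (J n) (fun j => n + mJ j)%N (fun j => Sset n (mJ j)) j k U P pP))).
Qed.

(** Each cell is extended on its own, and the pushout glues any family of choices. [Q] carries extra
    information on the chosen extensions, such as a prescribed value. *)
Lemma attach_cells n (O : set X) f (Q : forall j : J n, ('rV[R]_(n + mJ j) -> R) -> Prop) :
  smooth_skel (prevsk sk n) f -> (forall y, prevsk sk n y -> ~ O y -> f y < 0) ->
  (forall j, exists E, [/\ @smooth RT _ RT setT E,
     forall s : fatS n (mJ j), f (val (h (existT _ j s))) = E (val s),
     forall p : fatD n (mJ j), ~ O (val (Phi (existT _ j p))) -> E (val p) < 0 & Q j E]) ->
  exists f', [/\ smooth_skel (sk n) f', forall y, prevsk sk n y -> f' y = f y,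
    forall y, sk n y -> ~ O y -> f' y < 0 &
    forall j, exists2 E, Q j E & forall p : fatD n (mJ j), f' (val (Phi (existT _ j p))) = E (val p)].
Proof.
move=> sf fneg H; pose E j := sval (cid (H j)).
have EP j := svalP (cid (H j)).
have [|j s|f' [sf' f'f f'E]] := @attach_glue n f (fun j p => E j (val p)) sf.
- by move=> j; have [sE _ _ _] := EP j; exact: smooth_dsmooth.
- by have [_ -> _ _] := EP j.
exists f'; split => //; last first.
  by move=> j; exists (E j) => //; have [] := EP j.
move=> y sy; have [[x]|[[j p]]] := skeleton_cases (exist _ y (mem_set sy)).
  move=> /(congr1 val) /= -> nO; rewrite f'f; last exact/set_mem/valP.
  by apply: fneg => //; exact/set_mem/valP.
move=> /(congr1 val) /= -> nO; rewrite f'E.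
by have [_ _ + _] := EP j; apply.
Qed.

(** Where [|u| >= 1] the attaching and characteristic maps agree, so negativity of [f] off [O]
    becomes negativity off the trace of [O], as [cell_extension] requires. *)
Lemma skeleton_extension n (O : set X) f : Dopen pX O ->
  smooth_skel (prevsk sk n) f -> (forall y, prevsk sk n y -> ~ O y -> f y < 0) ->
  exists f', [/\ smooth_skel (sk n) f', forall y, prevsk sk n y -> f' y = f y &
    forall y, sk n y -> ~ O y -> f' y < 0].
Proof.
move=> oO sf fneg.
have [j|f' [? ? ? _]] := @attach_cells n O f (fun _ _ => True) sf fneg; last by exists f'.
pose g (s : fatS n (mJ j)) := f (val (h (existT _ j s))).
have [p|p Dp p1 nO|E [sE Eg En]] := @cell_extension RT n (mJ j) (Sset n (mJ j)) (cell_trace j O) (ext g)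
  _ (dsmooth_plot_smooth (attaching_dsmooth (j := j) sf)) (cell_trace_open (j := j) oO).
- exact: Sset_normL.
- rewrite (ext_exist g (mem_set (Sset_normL p1))) /g; apply: fneg; first exact/set_mem/valP.
  rewrite -attach_compat => Oy; apply: nO.
  exact: (proj2 (@cell_trace_val n j O (S_to_D (exist _ p (mem_set (Sset_normL p1))))) Oy).
exists E; split => //.
  move=> s; rewrite Eg ?ext_val //.
  by have [_ /=] := set_mem (valP s); rewrite enormL.
move=> p nO; apply: En; first by rewrite -DsetE; exact/set_mem/valP.
by move/cell_trace_val.
Qed.

(** As [x] is new in this skeleton, its representative has [|u| < 1]; otherwise the attaching map
    would place [x] in the preceding skeleton. That cell receives the bump, everything else the
    constant [-1]. *)
Lemma skeleton_bump n (O : set X) x : Dopen pX O -> O x -> sk n x -> ~ prevsk sk n x ->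
  exists f, [/\ smooth_skel (sk n) f, f x = 2^-1 &
    forall y, sk n y -> ~ O y -> f y < 0].
Proof.
move=> oO Ox sx nx.
have [[y /(congr1 val) /= xy]|[[j0 p0] /(congr1 val) /= xE]] :=
  skeleton_cases (exist _ x (mem_set sx)).
  by case: nx; rewrite xy; exact/set_mem/valP.
have p01 : @normL RT n (mJ j0) (val p0) < 1.
  rewrite ltNge; apply/negP => /Sset_normL S0; apply: nx; rewrite xE.
  have -> : p0 = S_to_D (exist _ (val p0) (mem_set S0)) by exact: val_inj.
  by rewrite attach_compat; exact/set_mem/valP.
(* An equation in the sum type lets the condition be stated for every [j], although the cells have
   different types. *)
pose Q (j : J n) (E : 'rV[R]_(n + mJ j) -> R) := forall p : fatD n (mJ j),
  existT (fun j => fatD n (mJ j)) j p = existT _ j0 p0 -> E (val p) = 2^-1.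
have [k U P pP|y _ _|j|f [sf _ fneg fQ]] := @attach_cells n O (fun=> -1) Q.
- by have [_ [+ _]] := euc_diffeology; apply; exact: dX.1 _ _ _ pP.
- by rewrite ltrN10.
- have [[p e]|ne] := pselect (exists p : fatD n (mJ j),
    existT (fun j => fatD n (mJ j)) j p = existT _ j0 p0); last first.
    exists (fun=> -1); split => //; last first.
    + by move=> p e; case: ne; exists p.
    + exact: (smooth_cst openT).
  have p1 : @normL RT n (mJ j) (val p) < 1
    by move: p01; rewrite -[normL _]/((fun c : {j : J n & fatD n (mJ j)} =>
      @normL RT n (mJ (projT1 c)) (val (projT2 c))) (existT _ j0 p0)) -e.
  have [||E [sE Em Ep En]] := @cell_bump RT n (mJ j) (cell_trace j O) (val p)
    (cell_trace_open (j := j) oO) _ _ p1.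
  + by rewrite -DsetE; exact/set_mem/valP.
  + by apply/cell_trace_val; rewrite e; move: Ox; rewrite xE.
  exists E; split => //.
  + by move=> s; rewrite Em //; have [_ /=] := set_mem (valP s); rewrite enormL.
  + by move=> q nO; apply: En; [rewrite -DsetE; exact/set_mem/valP|move/cell_trace_val].
  + by move=> q qe; rewrite (existT_inj (etrans qe (esym e))).
- exists f; split => //; rewrite xE.
  by have [E + ->] := fQ j0; apply.
Qed.

Lemma skeleton_mono i k : sk k `<=` sk (i + k).
Proof. by elim: i => // i IH y /IH; exact: (hsk (n:=(i + k).+1)). Qed.

Lemma bump_function (O : set X) x : Dopen pX O -> O x ->
  exists f, [/\ dsmooth pX euc f, f x = 2^-1 & forall y, ~ O y -> f y < 0].
Proof.
move=> oO Ox; have [n skx nx] := skeleton_first x.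
have [f0 [sf0 f0x f0neg]] := skeleton_bump oO Ox skx nx.
(* Stage [k] lives on skeleton [k + n], where [n] is the first to contain [x]. *)
pose good k f := smooth_skel (sk (k + n)) f /\ forall y, sk (k + n) y -> ~ O y -> f y < 0.
(* An extension is chosen for every pair, with [f0] as default where [good] fails, so that the
   sequence is an ordinary recursion. *)
have /choice[F FP] (kf : nat * (X -> R)) : exists f', good kf.1 kf.2 ->
    good kf.1.+1 f' /\ forall y, sk (kf.1 + n) y -> f' y = kf.2 y.
  have [[sf fneg]|ng] := pselect (good kf.1 kf.2); last by exists f0.
  by have [f' [? ? ?]] := @skeleton_extension (kf.1 + n).+1 O kf.2 oO sf fneg; exists f'.
pose s := fix s k := if k is k'.+1 then F (k', s k') else f0.
have sP k : good k (s k) by elim: k => [|k IH]; [split|case: (FP (k, s k) IH)].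
have sE k y : sk (k + n) y -> s k.+1 y = s k y by case: (FP (k, s k) (sP k)) => _; apply.
have skS k : sk k `<=` sk (k + n) by rewrite addnC; exact: skeleton_mono.
(* The colimit expects stage [k] on skeleton [k]; it is restricted from the larger skeleton [k + n],
   which also covers the skeleta before [n]. *)
have [w [[sw wE] _]] := @colim R euc euc_diffeology (fun k y => s k (val y))
  (fun k => smooth_skelS (skS k) (sP k).1) (fun k y => sE k _ (skS k _ (set_mem (valP y)))).
have {}wE k y : sk k y -> w y = s k y.
  by move=> ky; exact: (wE k (exist _ y (mem_set ky))).
have sx k : s k x = 2^-1.
  by elim: k => // k <-; apply: sE; exact: skeleton_mono.
exists w; split => //; first by rewrite (wE n).
move=> y nO; have [k ky] := skeleton_cover y; rewrite (wE k) //.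
exact: (sP k).2 y (skS k y ky) nO.
Qed.

End fat_CW.

(** Along a plot the set is cut out by two strict positivity conditions on smooth functions, each
    open by continuity. *)
Lemma Dopen_unit_preimage (X : Type) (pX : plots X) (f : X -> R) :
  dsmooth pX (@euc_plots R^o) f -> Dopen pX [set x | 0 < f x < 1].
Proof.
move=> sf k U P pP; have [oU /(smoothpP _ oU) s] := sf _ _ _ pP.
have -> : [set x | exists hx : x \in U, [set x | 0 < f x < 1] (P (exist _ x hx))] =
    [set x | U x /\ 0 < ext (f \o P) x] `&` [set x | U x /\ 0 < 1 - ext (f \o P) x].
  apply/seteqP; split => x /=.
    by move=> [hx]; rewrite (ext_exist _ hx) subr_gt0 => /andP[? ?]; have := set_mem hx.
  move=> [[Ux +] [_ +]]; rewrite (ext_exist _ (mem_set Ux)) subr_gt0 => ? ?.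
  by exists (mem_set Ux); apply/andP.
apply: openI; first exact: (@open_smooth_pos RT k U _ oU s).
exact: (@open_smooth_pos RT k U _ oU (smoothB oU (smooth_cst oU 1) s)).
Qed.

Theorem theorem6p3 (X : Type) (pX : plots X) :
  is_diffeology pX -> is_fat_CW pX -> enough_smooth_functions pX.
Proof.
move=> dX [sk [hsk [J [mJ [h [sh [pushout colim]]]]]]]; split => [f|O oO x Ox].
  exact: Dopen_unit_preimage.
have [f [sf fx fneg]] := @bump_function X pX dX sk hsk J mJ h sh
  (fun n => projT1 (cid (pushout n))) (fun n => projT2 (cid (pushout n))) colim O x oO Ox.
exists f; split => //; split; first by rewrite fx; apply/andP; split; lra.
move=> y /= /andP[f0 _]; apply: contrapT => /fneg; lra.
Qed.
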